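(* Let $n,N\in\mathbb{N}$, $\Omega=\prod_{i=1}^N[a_i,b_i]$, $\delta\in\mathbb{N}_0^N$, let $\mathcal{D}_i\subseteq S_2^{\delta_i\mathrm{e}_i,n}[\Omega]$ ($i=1,\dots,N$) be admissible and consistent lifted univariate domains, and let $\mathcal{D}:=\bigcap_{i=1}^N\mathcal{D}_i$. Let $A_\alpha\in\mathbb{R}^{n\times n}[s]$ for each $\vec 0\le\alpha\le\delta$. Define $\mathcal{T}:=\prod_{i=1}^N\mathcal{T}_i$ and $\mathcal{A}:=\sum_{\vec 0\le\alpha\le\delta}\mathrm{M}[A_\alpha]\prod_{i=1}^N\mathcal{A}_{i,\alpha_i}$, with $\mathcal{T}_i,\mathcal{A}_{i,j}$ as in the context. Then: 1. If $\mathbf{u}$ solves the PDE defined by $\{A_\alpha,\mathcal{D}_i\}$ with initial value $\mathbf{u}_0\in\mathcal{D}$, then $\mathbf{v}:=D^\delta\mathbf{u}$ solves the PIE defined by $\{\mathcal{T},\mathcal{A}\}$ with initial value $\mathbf{v}_0=D^\delta\mathbf{u}_0$, and $\mathbf{u}=\mathcal{T}\mathbf{v}$. 2. If $\mathbf{v}$ solves the PIE defined by $\{\mathcal{T},\mathcal{A}\}$ with initial value $\mathbf{v}_0\in L_2^n[\Omega]$, then $\mathbf{u}=\mathcal{T}\mathbf{v}$ solves the PDE defined by $\{A_\alpha,\mathcal{D}_i\}$ with initial value $\mathbf{u}_0=\mathcal{T}\mathbf{v}_0$, and $\mathbf{v}=D^\delta\mathbf{u}$.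
   Context: Notation: $\alpha\le\beta$ for multi-indices is componentwise; $D^\alpha=\partial_{s_1}^{\alpha_1}\cdots\partial_{s_N}^{\alpha_N}$; $L_2^n[\Omega]$ is the space of square-integrable $\mathbb{R}^n$-valued functions; $\mathbb{R}^{n\times n}[s]$ is the set of $n\times n$ matrix polynomials in $s=(s_1,\dots,s_N)$; $(\mathrm{M}[A]\mathbf{u})(s)=A(s)\mathbf{u}(s)$; $\mathrm{e}_i$ is the $i$th standard basis vector of $\mathbb{R}^N$; $S_2^{\delta,n}[\Omega]:=\{\mathbf{u}\in L_2^n[\Omega]: D^\alpha\mathbf{u}\in L_2^n[\Omega]\ \forall\,\vec 0\le\alpha\le\delta\}$ (with its natural Hilbert norm). Univariate domains: for $d\in\mathbb{N}_0$, $[a,b]\subset\mathbb{R}$ and $B_{j,k},C_{j,k}\in\mathbb{R}^{n\times n}$ ($0\le j,k\le d-1$), consider $\{\mathbf{u}\in S_2^{d,n}[a,b]:\ \sum_{k=0}^{d-1}[B_{j,k}(\partial_s^k\mathbf{u})(a)+C_{j,k}(\partial_s^k\mathbf{u})(b)]=0\ \ \forall j\in\{0,\dots,d-1\}\}$. Let $H_a,H_b\in\mathbb{R}^{nd\times nd}$ be the block matrices with blocks $B_{j,k}$, $C_{j,k}$, and let $Q(z)\in\mathbb{R}^{nd\times nd}$ be block upper triangular with $(k,l)$ block $\frac{z^{l-k}}{(l-k)!}I_n$ for $l\ge k$ and $0$ otherwise. The domain is admissible if $H_a+H_bQ(b-a)$ is invertible (no condition if $d=0$, where the domain is $L_2^n[a,b]$);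 then set $K:=(H_a+H_bQ(b-a))^{-1}H_b$. Lifted domains: given for each $i$ a univariate domain $\{\mathbf{w}\in S_2^{\delta_i,n}[a_i,b_i]:\ \sum_{k=0}^{\delta_i-1}[B^i_{j,k}(\partial_s^k\mathbf{w})(a_i)+C^i_{j,k}(\partial_s^k\mathbf{w})(b_i)]=0\ \ \forall j\in\{0,\dots,\delta_i-1\}\}$ (i.e. $d=\delta_i$, $[a,b]=[a_i,b_i]$) with parameters $B^i_{j,k},C^i_{j,k}\in\mathbb{R}^{n\times n}$, $\mathcal{D}_i$ is the set of $\mathbf{u}\in S_2^{\delta_i\mathrm{e}_i,n}[\Omega]$ such that for almost every value of the variables $s_j$, $j\ne i$, the function $s_i\mapsto\mathbf{u}(s)$ lies in that univariate domain. $\mathcal{D}_i$ is admissible if the univariate domain is; its matrix $K$ is denoted $K^i$, with $n\times n$ blocks $K^i_{k,l}$, $1\le k,l\le\delta_i$. The intersection $\bigcap_{i=1}^N\mathcal{D}_i$ is taken within $S_2^{\delta,n}[\Omega]$. The (admissible) domains are consistent if $K^i_{k,p}K^j_{\ell,q}=K^j_{\ell,q}K^i_{k,p}$ for all $i\ne j$ and all $k,p\in\{1,\dots,\delta_i\}$, $\ell,q\in\{1,\dots,\delta_j\}$. Operators: with $d=\delta_i$, let $E_1(z):=[I_n,\,zI_n,\dots,\frac{z^{d-1}}{(d-1)!}I_n]^T$ and $E_d(z):=[\frac{z^{d-1}}{(d-1)!}I_n,\dots,zI_n,I_n]^T$, both in $\mathbb{R}^{nd\times n}$. For $0\le j<\delta_i$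 define on $L_2^n[\Omega]$ $$(\mathcal{A}_{i,j}\mathbf{v})(s):=\int_{a_i}^{s_i}\tfrac{(s_i-\theta)^{\delta_i-1-j}}{(\delta_i-1-j)!}\mathbf{v}(s)|_{s_i=\theta}\,d\theta-\int_{a_i}^{b_i}\bigl(\tfrac{d^j}{dz^j}E_1\bigr)(s_i-a_i)^TK^iE_{\delta_i}(b_i-\theta)\,\mathbf{v}(s)|_{s_i=\theta}\,d\theta,$$ $\mathcal{A}_{i,\delta_i}:=I$, and $\mathcal{T}_i:=\mathcal{A}_{i,0}$ (so $\mathcal{T}_i=I$ if $\delta_i=0$). Products $\prod_{i=1}^N$ denote composition. Solutions: $\mathbf{u}:[0,\infty)\to S_2^{\delta,n}[\Omega]$ solves the PDE defined by $\{A_\alpha,\mathcal{D}_i\}$ with initial condition $\mathbf{u}_0\in\mathcal{D}$ if $\mathbf{u}$ is Fréchet differentiable, $\mathbf{u}(0)=\mathbf{u}_0$, and for all $t\ge0$: $\mathbf{u}(t)\in\mathcal{D}$ and $\partial_t\mathbf{u}(t,s)=\sum_{\vec 0\le\alpha\le\delta}A_\alpha(s)D^\alpha\mathbf{u}(t,s)$. $\mathbf{v}:[0,\infty)\to L_2^n[\Omega]$ solves the PIE defined by $\{\mathcal{T},\mathcal{A}\}$ with initial state $\mathbf{v}_0\in L_2^n[\Omega]$ if $\mathbf{v}$ is Fréchet differentiable, $\mathbf{v}(0)=\mathbf{v}_0$, and $\partial_t\mathcal{T}\mathbf{v}(t)=\mathcal{A}\mathbf{v}(t)$ for all $t\ge0$.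 *)

(* Defs.v *)
From HB Require Import structures.
From mathcomp Require Import all_boot all_order all_algebra.
From mathcomp Require Import all_classical all_reals all_analysis.
From mathcomp.multinomials Require mpoly.

Set Implicit Arguments.
Unset Strict Implicit.
Unset Printing Implicit Defensive.

Import Order.TTheory GRing.Theory Num.Theory.
Import numFieldNormedType.Exports.

Local Open Scope classical_set_scope.
Local Open Scope ring_scope.

Section iterated_product_measure.
Local Open Scope ereal_scope.
Context d (T : measurableType d) (R : realType).
Variable m1 : {sigma_finite_measure set T -> \bar R}.

Definition cons_pt N (p : T * N.-tuple T) : N.+1.-tuple T :=
  [tuple of p.1 :: p.2].

Lemma measurable_cons_pt N : measurable_fun setT (@cons_pt N).
Proof. exact: measurable_cons. Qed.

Section cons_measure.
Context N (m2 : {sigma_finite_measure set (N.-tuple T) -> \bar R}).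

Definition cons_measure : set (N.+1.-tuple T) -> \bar R :=
  pushforward (m1 \x m2) (@cons_pt N).

Let cons_measure0 : cons_measure set0 = 0.
Proof. by rewrite /cons_measure /pushforward preimage_set0 measure0. Qed.

Let cons_measure_ge0 A : 0 <= cons_measure A.
Proof. by rewrite /cons_measure /pushforward; exact: measure_ge0. Qed.

Let cons_measure_sigma_additive : semi_sigma_additive cons_measure.
Proof.
move=> F mF tF mUF; rewrite /cons_measure /pushforward preimage_bigcup.
apply: measure_semi_sigma_additive.
- by move=> n; rewrite -[X in measurable X]setTI; exact: measurable_cons_pt.
- apply/trivIsetP => /= i j _ _ ij; rewrite -preimage_setI.
  by move/trivIsetP : tF => /(_ _ _ _ _ ij) ->//; rewrite preimage_set0.
- by rewrite -preimage_bigcup -[X in measurable X]setTI;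
    exact: measurable_cons_pt.
Qed.

HB.instance Definition _ := isMeasure.Build _ _ _ cons_measure
  cons_measure0 cons_measure_ge0 cons_measure_sigma_additive.

Let cons_measure_sigma_finite : sigma_finite setT cons_measure.
Proof.
have /sigma_finiteP[F [TF ndF Foo]] := sigma_finiteT m1.
have /sigma_finiteP[G [TG ndG Goo]] := sigma_finiteT m2.
pose g (s : N.+1.-tuple T) : T * N.-tuple T := (thead s, [tuple of behead s]).
have gK : cancel (@cons_pt N) g.
  move=> [x y]; rewrite /g /cons_pt theadE /=; congr pair.
  exact: val_inj.
have mg : measurable_fun setT g.
  apply/measurable_fun_pairP; split.
    exact: measurable_tnth.
  exact: measurable_behead.
exists (fun k => g @^-1` (F k `*` G k)).
  rewrite -preimage_bigcup (_ : \bigcup_k _ = setT) ?preimage_setT//.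
  rewrite -subTset => -[x y] _.
  have [i _ Fix] : (\bigcup_k F k) x by rewrite -TF.
  have [j _ Gjy] : (\bigcup_k G k) y by rewrite -TG.
  exists (maxn i j) => //; split.
  - by move: x Fix; exact/subsetPset/ndF/leq_maxl.
  - by move: y Gjy; exact/subsetPset/ndG/leq_maxr.
move=> k; have [mF Foo_k] := Foo k; have [mG Goo_k] := Goo k; split.
  by rewrite -[X in measurable X]setTI; apply: mg => //; exact: measurableX.
rewrite /cons_measure /pushforward -comp_preimage.
rewrite (_ : g \o _ = id); last by apply/funext => x /=; rewrite gK.
by rewrite preimage_id product_measure1E// lte_mul_pinfty// ge0_fin_numE.
Qed.

HB.instance Definition _ := Measure_isSigmaFinite.Build _ _ _ cons_measure
  cons_measure_sigma_finite.

End cons_measure.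

Fixpoint tuple_measure N : {sigma_finite_measure set (N.-tuple T) -> \bar R} :=
  match N with
  | 0 => [the {sigma_finite_measure set (0.-tuple T) -> \bar R} of
           dirac ([tuple] : 0.-tuple T)]
  | N'.+1 => [the {sigma_finite_measure set (N'.+1.-tuple T) -> \bar R} of
               cons_measure (tuple_measure N')]
  end.

End iterated_product_measure.

(* Points of R^N are tuples, which carry the product Borel sigma-algebra. *)
Notation pt R N := (N.-tuple (measurableTypeR R)).

(* Multi-indices 0 <= alpha <= delta, as a finite type. *)
Notation mindex delta := {dffun forall i, 'I_(delta i).+1}.

Definition lebn (R : realType) N :
    {sigma_finite_measure set (pt R N) -> \bar R} :=
  tuple_measure (@lebesgue_measure R) N.

Section points.
Context (R : realType) (N : nat).

Definition crd (s : pt R N) (i : 'I_N) : R := tnth s i.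

Definition vec (s : pt R N) : 'rV[R]_N := \row_i crd s i.

Definition box (a b : 'I_N -> R) : set (pt R N) :=
  [set s | forall i, a i <= crd s i <= b i].

(* s with s_i replaced by theta *)
Definition upd (i : 'I_N) (theta : R) (s : pt R N) : pt R N :=
  [tuple (if j == i then theta else crd s j) | j < N].

(* the point whose i-th coordinate is theta and whose others are those of x *)
Definition ins (i : 'I_N) (theta : R) (x : pt R N.-1) : pt R N :=
  [tuple (if unlift i j is Some k then tnth x k else theta) | j < N].

End points.

(* An element of L_2^n is handled through a representative; only its values on
   the domain matter, and equality is equality almost everywhere there. *)
Section L2.
Context d (T : measurableType d) (R : realType) (n : nat).
Variables (mu : {measure set T -> \bar R}) (D : set T).

Definition L2 : set (T -> 'cV[R]_n) :=
  [set u : T -> 'cV[R]_n | forall k, measurable_fun D (fun s => u s k 0) /\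
    mu.-integrable D (fun s => ((u s k 0) ^+ 2)%:E)].

Definition L2norm (u : T -> 'cV[R]_n) : \bar R :=
  sqrte (\int[mu]_(s in D) (\sum_k (u s k 0) ^+ 2)%:E)%E.

End L2.

Section sobolev.
Context (R : realType) (N n : nat).
Variables (a b : 'I_N -> R).

Let F : Type := pt R N -> 'cV[R]_n.
Let Omega := box a b.
Let mu := lebn R N.

Definition partial (i : 'I_N) (phi : 'rV[R]_N -> R) : 'rV[R]_N -> R :=
  fun x => 'D_(delta_mx 0 i) phi x.

Definition partials (alpha : 'I_N -> nat) (phi : 'rV[R]_N -> R) :
    'rV[R]_N -> R :=
  (\big[comp/id]_(i < N) iter (alpha i) (partial i)) phi.

Definition smooth (phi : 'rV[R]_N -> R) : Prop :=
  forall l : seq 'I_N, continuous (foldr partial phi l) /\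
    forall i x, derivable (foldr partial phi l) x (delta_mx 0 i).

(* The support is closed in a bounded open box, hence compact. *)
Definition test_function (phi : 'rV[R]_N -> R) : Prop :=
  smooth phi /\
  closure [set x | phi x != 0] `<=` [set x | forall i, a i < x 0 i < b i].

Definition weak_deriv (alpha : 'I_N -> nat) (u w : F) : Prop :=
  forall phi, test_function phi -> forall k,
    \int[mu]_(s in Omega) (u s k 0 * partials alpha phi (vec s)) =
    (-1) ^+ (\sum_i alpha i)%N *
      \int[mu]_(s in Omega) (w s k 0 * phi (vec s)).

Definition S2 (delta : 'I_N -> nat) : set F :=
  [set u : F | L2 mu Omega u /\
    forall alpha : 'I_N -> nat, (forall i, (alpha i <= delta i)%N) ->
      exists2 w, L2 mu Omega w & weak_deriv alpha u w].

(* D^alpha u; the default value 0 is never used on S2 delta, alpha <= delta. *)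
Definition wD (alpha : 'I_N -> nat) (u : F) : F :=
  xget 0 [set w | L2 mu Omega w /\ weak_deriv alpha u w].

Definition S2norm (delta : 'I_N -> nat) (u : F) : \bar R :=
  sqrte (\sum_(alpha : mindex delta)
           L2norm mu Omega (wD (fun i => alpha i) u) ^+ 2)%E.

End sobolev.

Section univariate.
Context (R : realType) (n d : nat).
Variables (a b : R) (B C : 'I_d -> 'I_d -> 'M[R]_n).

Let F : Type := R -> 'cV[R]_n.
Let mu := @lebesgue_measure R.

Definition test_function1 (phi : R -> R) : Prop :=
  (forall k x, derivable (derive1n k phi) x 1) /\
  closure [set x | phi x != 0] `<=` `]a, b[.

Definition weak_deriv1 (k : nat) (u w : F) : Prop :=
  forall phi, test_function1 phi -> forall i,
    \int[mu]_(x in `[a, b]) (u x i 0 * derive1n k phi x) =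
    (-1) ^+ k * \int[mu]_(x in `[a, b]) (w x i 0 * phi x).

Definition S2_1 : set F :=
  [set u : F | L2 mu `[a, b] u /\
    forall k, (k <= d)%N -> exists2 w, L2 mu `[a, b] w & weak_deriv1 k u w].

(* g k is the continuous representative of the k-th weak derivative of u, at
   which the boundary values are taken. *)
Definition univ_domain : set F :=
  [set u : F | S2_1 u /\
    exists g : 'I_d -> F,
      (forall k, {within `[a, b], continuous (g k)} /\ weak_deriv1 k u (g k)) /\
      forall j, \sum_(k < d) (B j k *m g k a + C j k *m g k b) = 0].

Definition Ha := \mxblock_(j < d, k < d) B j k.
Definition Hb := \mxblock_(j < d, k < d) C j k.

Definition Q (z : R) :=
  \mxblock_(k < d, l < d)
    (if (k <= l)%N then (z ^+ (l - k) / (l - k)`!%:R)%:M else 0 : 'M[R]_n).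

Definition admissible : Prop := Ha + Hb *m Q (b - a) \in unitmx.

Definition K := invmx (Ha + Hb *m Q (b - a)) *m Hb.

Definition E1 (z : R) := \mxcol_(k < d) ((z ^+ k / k`!%:R)%:M : 'M[R]_n).

Definition Ed (z : R) :=
  \mxcol_(k < d) ((z ^+ (d - 1 - k) / (d - 1 - k)`!%:R)%:M : 'M[R]_n).

End univariate.

Section lifted.
Context (R : realType) (N n : nat).
Variables (a b : 'I_N -> R).

(* The other variables s_j, j != i, range over R^(N-1) through lift i. *)
Definition lifted_domain (i : 'I_N) (d : nat) (B C : 'I_d -> 'I_d -> 'M[R]_n) :
    set (pt R N -> 'cV[R]_n) :=
  [set u : pt R N -> 'cV[R]_n | S2 a b (fun j => if j == i then d else 0%N) u /\
    {ae lebn R N.-1, forall x, box (a \o lift i) (b \o lift i) x ->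
      univ_domain (a i) (b i) B C (fun theta => u (ins i theta x))}].

Variable delta : 'I_N -> nat.
Variables B C : forall i, 'I_(delta i) -> 'I_(delta i) -> 'M[R]_n.

Definition domain : set (pt R N -> 'cV[R]_n) :=
  [set u : pt R N -> 'cV[R]_n | S2 a b delta u /\
           forall i, lifted_domain i (@B i) (@C i) u].

Definition Kmx (i : 'I_N) := K (a i) (b i) (@B i) (@C i).

Definition consistent : Prop :=
  forall i j, i != j -> forall k p l q,
    submxblock (Kmx i) k p *m submxblock (Kmx j) l q =
    submxblock (Kmx j) l q *m submxblock (Kmx i) k p.

Definition opA (i : 'I_N) (j : nat) (v : pt R N -> 'cV[R]_n) :
    pt R N -> 'cV[R]_n := fun s =>
  if (j < delta i)%N then
    \col_k (
      \int[@lebesgue_measure R]_(theta in `[a i, crd s i])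
        ((crd s i - theta) ^+ (delta i - 1 - j) / (delta i - 1 - j)`!%:R
           * v (upd i theta s) k 0)
    - \int[@lebesgue_measure R]_(theta in `[a i, b i])
        (((derive1n j (@E1 R n (delta i)) (crd s i - a i))^T *m Kmx i
           *m @Ed R n (delta i) (b i - theta) *m v (upd i theta s)) k 0))
  else v s.

Definition opT_ (i : 'I_N) := opA i 0.

Definition opT (v : pt R N -> 'cV[R]_n) : pt R N -> 'cV[R]_n :=
  (\big[comp/id]_(i < N) opT_ i) v.

Variable A : mindex delta -> 'M[mpoly.mpoly N R]_n.

Definition opM (P : 'M[mpoly.mpoly N R]_n) (v : pt R N -> 'cV[R]_n) :
    pt R N -> 'cV[R]_n :=
  fun s => map_mx (mpoly.meval (crd s)) P *m v s.

Definition opPIE (v : pt R N -> 'cV[R]_n) : pt R N -> 'cV[R]_n :=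
  \sum_(alpha : mindex delta)
    opM (A alpha) ((\big[comp/id]_(i < N) opA i (alpha i)) v).

Definition opPDE (u : pt R N -> 'cV[R]_n) : pt R N -> 'cV[R]_n :=
  \sum_(alpha : mindex delta) opM (A alpha) (wD a b (fun i => alpha i) u).

End lifted.

(* w' is the derivative at t >= 0 of w : [0, +oo[ -> F (one-sided at t = 0);
   the values of w at negative times are not looked at. *)
Definition time_deriv (R : realType) (F : lmodType R) (nrm : F -> \bar R)
    (w : R -> F) (t : R) (w' : F) : Prop :=
  nrm (h^-1 *: (w (t + h) - w t) - w')
    @[h --> within [set h | 0 <= t + h] 0^'] --> 0%E.

Section solutions.
Context (R : realType) (N n : nat).
Variables (a b : 'I_N -> R) (delta : 'I_N -> nat).

Let F := pt R N -> 'cV[R]_n.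
Let Omega := box a b.
Let mu := lebn R N.

Definition solves_PDE (B C : forall i, 'I_(delta i) -> 'I_(delta i) -> 'M[R]_n)
    (A : mindex delta -> 'M[mpoly.mpoly N R]_n) (u : R -> F) (u0 : F) : Prop :=
  [/\ domain a b B C u0, ae_eq mu Omega (u 0) u0 &
    forall t, 0 <= t -> domain a b B C (u t) /\
      exists u', [/\ S2 a b delta u', time_deriv (S2norm a b delta) u t u' &
                     ae_eq mu Omega u' (opPDE a b A (u t))]].

Definition solves_PIE (T A : F -> F) (v : R -> F) (v0 : F) : Prop :=
  [/\ L2 mu Omega v0, ae_eq mu Omega (v 0) v0 &
    forall t, 0 <= t ->
      [/\ L2 mu Omega (v t),
          exists2 v', L2 mu Omega v' & time_deriv (L2norm mu Omega) v t v' &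
          exists w, [/\ L2 mu Omega w,
                        time_deriv (L2norm mu Omega) (T \o v) t w &
                        ae_eq mu Omega w (A (v t))]]].

End solutions.

(* Main.v *)
Require Import Defs.
From HB Require Import structures.
From mathcomp Require Import all_boot all_order all_algebra.
From mathcomp Require Import all_classical all_reals all_analysis measurable_realfun.
From mathcomp Require Import ring lra.
From mathcomp.multinomials Require mpoly.

Set Implicit Arguments.
Unset Strict Implicit.
Unset Printing Implicit Defensive.

Import Order.TTheory GRing.Theory Num.Theory.
Import numFieldNormedType.Exports.

Local Open Scope classical_set_scope.
Local Open Scope ring_scope.

(* A lifted domain is parametrised by the highest derivative: on almost every
   line in direction i, Taylor's formula and the boundary conditions give
   u = T_i (d_i^delta_i u), admissibility being what allows one to solve for the
   boundary values. The transpose of A_{i,j} maps a function of s_i to a matrix of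
   functions of s_i; it sends f^(j) under A_{i,0} to (-1)^j times the image of f
   under A_{i,j}, so A_{i,j} v is the j-th weak derivative of T_i v. Testing
   against products of univariate functions shows that operators of different
   directions commute when the matrices K^i do, hence D^alpha (T v) =
   prod_i A_{i,alpha_i} v for alpha <= delta, and conversely u = T (D^delta u) on
   the intersection of the domains, one direction at a time. Thus T is an
   isomorphism from L_2 onto the domain for the norm of S_2^delta, with inverse
   D^delta, and it carries time derivatives and the two equations into each
   other. *)

(** * Integration over boxes *)

(** Three obstacles shape the argument. The domains are defined on lines, up to a null set of lines,
    whereas weak derivatives are tested in all variables at once; the bridge is Fubini along an
    arbitrary coordinate and product functions, whose restriction to a line is a multiple of one
    factor. The transpose of A_{i,0} does not preserve compact support, so identities known for test
    functions are first extended, one factor at a time, to bounded measurable factors, on which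
    transposes can be iterated. Finally, the boundary conditions are known for u only and not for
    its mixed derivatives: these are reached by writing u = A_{i,0} z and transposing onto factor i,
    while the derivatives in the other directions stay on the other factors. Linearity and
    commutation hold almost everywhere only, since on exceptional lines the integrals carry no
    information. In time, one implication needs only that D^delta does not increase the norm from
    S_2^delta to L_2; in the other, the PIE provides the derivative of T v in L_2 alone, and
    uniqueness of limits identifies it with T v'. *)

Section real_integrable.
Context (d : measure_display) (T : measurableType d) (R : realType).
Variables (mu : {measure set T -> \bar R}) (D : set T).
Hypothesis mD : measurable D.
Implicit Types f g : T -> R.
Local Notation rint f := (mu.-integrable D (EFin \o f)).

Lemma bounded_in (g : T -> R) (M : R) : (forall x, D x -> `|g x| <= M) ->
  [bounded g x | x in D].
Proof.
move=> gM; exists M; split; first exact: num_real.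
by move=> y My x Dx; apply: le_trans (gM x Dx) (ltW My).
Qed.

Lemma rint_measurable f : rint f -> measurable_fun D f.
Proof. by move=> /measurable_int/measurable_EFinP. Qed.

Lemma rint_eq f g : (forall x, D x -> f x = g x) -> rint f -> rint g.
Proof.
move=> fg; apply: eq_integrable => // x /set_mem Dx /=; by rewrite fg.
Qed.

Lemma Rint_eq f g : (forall x, D x -> f x = g x) ->
  \int[mu]_(x in D) f x = \int[mu]_(x in D) g x.
Proof. by move=> fg; apply: eq_Rintegral => x /set_mem; exact: fg. Qed.

Lemma rintD f g : rint f -> rint g -> rint (fun x => f x + g x).
Proof. by move=> rf rg; apply: eq_integrable (integrableD mD rf rg). Qed.

Lemma rintB f g : rint f -> rint g -> rint (fun x => f x - g x).
Proof. by move=> rf rg; apply: eq_integrable (integrableB mD rf rg). Qed.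

Lemma rintZ f (c : R) : rint f -> rint (fun x => c * f x).
Proof. by move=> rf; apply: eq_integrable (integrableZl mD c rf). Qed.

Lemma rint0 : rint (fun=> 0). Proof. exact: integrable0. Qed.

Lemma rint_sum (I : Type) (s : seq I) (F : I -> T -> R) :
  (forall i, rint (F i)) -> rint (fun x => \sum_(i <- s) F i x).
Proof.
move=> h; elim: s => [|i s IH].
  by apply: rint_eq rint0 => x _; rewrite big_nil.
by apply: rint_eq (rintD (h i) IH) => x _; rewrite big_cons.
Qed.

Lemma Rint_sum (I : Type) (s : seq I) (F : I -> T -> R) :
  (forall i, rint (F i)) ->
  \int[mu]_(x in D) (\sum_(i <- s) F i x) =
  \sum_(i <- s) \int[mu]_(x in D) F i x.
Proof.
move=> h; elim: s => [|i s IH].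
  rewrite big_nil (Rint_eq (g := fun=> 0)) ?Rintegral_cst ?mul0r// => x _.
  by rewrite big_nil.
rewrite big_cons -IH -RintegralD//; last exact: rint_sum.
by apply: Rint_eq => x _; rewrite big_cons.
Qed.

Lemma rintM f g (M : R) : rint f -> measurable_fun D g ->
  (forall x, D x -> `|g x| <= M) -> rint (fun x => f x * g x).
Proof.
move=> rf mg gM; exact: (integrableMl mD rf mg (bounded_in gM)).
Qed.

Lemma Rint_ae f g : measurable_fun D f -> measurable_fun D g ->
  ae_eq mu D f g -> \int[mu]_(x in D) f x = \int[mu]_(x in D) g x.
Proof.
move=> mf mg fg; congr fine; apply: ae_eq_integral => //.
- exact/measurable_EFinP.
- exact/measurable_EFinP.
- by apply: filterS fg => x h /h ->.
Qed.

Lemma rint_le f g : measurable_fun D f -> rint g ->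
  (forall x, D x -> `|f x| <= g x) -> rint f.
Proof.
move=> mf rg fg; apply: (le_integrable mD _ _ rg); first exact/measurable_EFinP.
by move=> x Dx /=; rewrite lee_fin; apply: le_trans (fg x Dx) (ler_norm _).
Qed.

Lemma Rint_norm_le f (M : R) : rint f -> (mu D < +oo)%E ->
  (forall x, D x -> `|f x| <= M) -> `|\int[mu]_(x in D) f x| <= M * fine (mu D).
Proof.
move=> rf muD fM; apply: le_trans (le_normr_Rintegral mD rf) _.
rewrite -Rintegral_cst//; apply: le_Rintegral => //.
- exact: integrable_norm.
- by apply: measurable_bounded_integrable => //; apply: (bounded_in (M := `|M|)).
Qed.

End real_integrable.

Lemma ae_eq_sub0 (d : measure_display) (T : measurableType d) (R : realType)
    (mu : {measure set T -> \bar R}) (D : set T) (f g : T -> R) :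
  ae_eq mu D (fun x => f x - g x) (cst 0) -> ae_eq mu D f g.
Proof. by apply: filterS => x h Dx; apply/eqP; rewrite -subr_eq0 h. Qed.

Lemma measurable_fun_preimage (d1 d2 d3 : measure_display) (T1 : measurableType d1)
    (T2 : measurableType d2) (T3 : measurableType d3) (phi : T1 -> T2) (D : set T2)
    (f : T2 -> T3) : measurable_fun setT phi -> measurable D -> measurable_fun D f ->
  measurable_fun (phi @^-1` D) (f \o phi).
Proof.
move=> mphi mD mf _ Y mY.
have -> : phi @^-1` D `&` (f \o phi) @^-1` Y = setT `&` phi @^-1` (D `&` f @^-1` Y).
  by rewrite setTI.
by apply: mphi => //; exact: mf.
Qed.

(** * Fubini's theorem for functions integrable on a rectangle *)

Section fubini_rectangle.
Context (d1 d2 : measure_display) (T1 : measurableType d1)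
  (T2 : measurableType d2) (R : realType).
Variables (m1 : {sigma_finite_measure set T1 -> \bar R})
  (m2 : {sigma_finite_measure set T2 -> \bar R}).
Variables (D1 : set T1) (D2 : set T2).
Hypotheses (mD1 : measurable D1) (mD2 : measurable D2).
Variable f : T1 * T2 -> R.
Hypothesis rf : (m1 \x m2)%E.-integrable (D1 `*` D2) (EFin \o f).

(** The theorems of Fubini and Tonelli are applied on the whole product to this extension by
    zero. *)
Let f0 : T1 * T2 -> R := f \_ (D1 `*` D2).

Let mD12 : measurable (D1 `*` D2).
Proof. exact: measurableX. Qed.

Let f0E x y : f0 (x, y) = if x \in D1 then ((fun y => f (x, y)) \_ D2) y else 0.
Proof.
rewrite /f0 !patchE; case: ifPn => [/set_mem[/= h1 h2]|h].
  by rewrite mem_set// mem_set.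
case: ifPn => // /set_mem h1; case: ifPn => // /set_mem h2.
by move: h; rewrite mem_set.
Qed.

Let f0E2 x y : f0 (x, y) = if y \in D2 then ((fun x => f (x, y)) \_ D1) x else 0.
Proof. by rewrite f0E !patchE; case: ifPn; case: ifPn. Qed.

Let rf0 : (m1 \x m2)%E.-integrable setT (EFin \o f0).
Proof. by move/(integrable_mkcond _ mD12) : rf; rewrite restrict_EFin. Qed.

Lemma ae_slice_integrable1 :
  {ae m1, forall x, D1 x -> m2.-integrable D2 (fun y => (f (x, y))%:E)}.
Proof.
apply: filterS (ae_integrable1 rf0) => x h D1x.
apply/(integrable_mkcond _ mD2); rewrite restrict_EFin.
apply: eq_integrable h => // y _ /=; by rewrite f0E mem_set.
Qed.

Lemma ae_slice_integrable2 :
  {ae m2, forall y, D2 y -> m1.-integrable D1 (fun x => (f (x, y))%:E)}.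
Proof.
apply: filterS (ae_integrable2 rf0) => x h D1x.
apply/(integrable_mkcond _ mD1); rewrite restrict_EFin.
apply: eq_integrable h => // y _ /=; by rewrite f0E2 mem_set.
Qed.

Let FE x : Rintegral m2 setT (fun y => f0 (x, y)) =
  ((fun x => \int[m2]_(y in D2) f (x, y)) \_ D1) x.
Proof.
rewrite patchE; case: ifPn => xD1.
  rewrite [RHS]Rintegral_mkcond; apply: Rint_eq => y _.
  by rewrite f0E xD1.
rewrite (Rint_eq _ (g := fun=> 0)) ?Rintegral_cst ?mul0r// => y _.
by rewrite f0E (negbTE xD1).
Qed.

Let GE y : Rintegral m1 setT (fun x => f0 (x, y)) =
  ((fun y => \int[m1]_(x in D1) f (x, y)) \_ D2) y.
Proof.
rewrite patchE; case: ifPn => xD1.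
  rewrite [RHS]Rintegral_mkcond; apply: Rint_eq => x _.
  by rewrite f0E2 xD1.
rewrite (Rint_eq _ (g := fun=> 0)) ?Rintegral_cst ?mul0r// => x _.
by rewrite f0E2 (negbTE xD1).
Qed.

(** [fubini_F] takes values in the extended reals and the inner integral on the right is real; they
    agree where the slice is integrable, that is almost everywhere. *)
Let aeF : ae_eq m1 setT (fubini_F m2 (EFin \o f0))
  (EFin \o ((fun x => \int[m2]_(y in D2) f (x, y)) \_ D1)).
Proof.
apply: filterS (ae_integrable1 rf0) => x h _ /=.
rewrite -FE /Rintegral /fubini_F fineK//.
exact: integrable_fin_num.
Qed.

Let aeG : ae_eq m2 setT (fubini_G m1 (EFin \o f0))
  (EFin \o ((fun y => \int[m1]_(x in D1) f (x, y)) \_ D2)).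
Proof.
apply: filterS (ae_integrable2 rf0) => x h _ /=.
rewrite -GE /Rintegral /fubini_G fineK//.
exact: integrable_fin_num.
Qed.

Let mF : measurable_fun setT (EFin \o ((fun x => \int[m2]_(y in D2) f (x, y)) \_ D1)).
Proof.
apply/measurable_EFinP.
have := measurableT_comp (@fine_measurable R setT measurableT) (measurable_fubini_F rf0).
apply: eq_measurable_fun => x _; rewrite -FE//.
Qed.

Let mG : measurable_fun setT (EFin \o ((fun y => \int[m1]_(x in D1) f (x, y)) \_ D2)).
Proof.
apply/measurable_EFinP.
have := measurableT_comp (@fine_measurable R setT measurableT) (measurable_fubini_G rf0).
apply: eq_measurable_fun => x _; rewrite -GE//.
Qed.

Lemma rint_fubini1 : m1.-integrable D1 (EFin \o (fun x => \int[m2]_(y in D2) f (x, y))).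
Proof.
apply/(integrable_mkcond _ mD1); rewrite restrict_EFin.
have /integrableP[mh h] := integrable_fubini_F rf0.
apply/integrableP; split; first exact: mF.
apply: le_lt_trans h; rewrite le_eqVlt; apply/orP; left; apply/eqP.
apply: ae_eq_integral => //.
- by apply: measurableT_comp => //; exact: mF.
- exact: measurableT_comp.
- by apply: filterS aeF => x hx _; rewrite -hx.
Qed.

Lemma rint_fubini2 : m2.-integrable D2 (EFin \o (fun y => \int[m1]_(x in D1) f (x, y))).
Proof.
apply/(integrable_mkcond _ mD2); rewrite restrict_EFin.
have mh := measurable_fubini_G rf0; have mf0 := measurable_int _ rf0.
have h : (\int[m2]_y `|fubini_G m1 (EFin \o f0) y| < +oo)%E.
  apply: le_lt_trans ((integrable21ltyP m1 m2 mf0).1 rf0).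
  apply: ge0_le_integral => //; first exact: measurableT_comp.
    apply: (measurable_fun_fubini_tonelli_G (abse \o (EFin \o f0))) => //=.
    exact: measurableT_comp.
  by move=> y _; apply: le_abse_integral => //; exact: measurableT_comp.
apply/integrableP; split; first exact: mG.
apply: le_lt_trans h; rewrite le_eqVlt; apply/orP; left; apply/eqP.
apply: ae_eq_integral => //.
- by apply: measurableT_comp => //; exact: mG.
- exact: measurableT_comp.
- by apply: filterS aeG => x hx _; rewrite -hx.
Qed.

Lemma Rfubini1 : \int[(m1 \x m2)%E]_(z in D1 `*` D2) f z =
  \int[m1]_(x in D1) \int[m2]_(y in D2) f (x, y).
Proof.
rewrite Rintegral_mkcond [RHS]Rintegral_mkcond; congr fine.
rewrite -(integral12_prod_meas1 rf0); apply: ae_eq_integral => //.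
exact: (measurable_fubini_F rf0).
Qed.

Lemma Rfubini2 : \int[(m1 \x m2)%E]_(z in D1 `*` D2) f z =
  \int[m2]_(y in D2) \int[m1]_(x in D1) f (x, y).
Proof.
rewrite Rintegral_mkcond [RHS]Rintegral_mkcond; congr fine.
rewrite -(integral21_prod_meas1 rf0); apply: ae_eq_integral => //.
exact: (measurable_fubini_G rf0).
Qed.

Lemma Rfubini_swap : \int[m1]_(x in D1) \int[m2]_(y in D2) f (x, y) =
  \int[m2]_(y in D2) \int[m1]_(x in D1) f (x, y).
Proof. by rewrite -Rfubini1 Rfubini2. Qed.

End fubini_rectangle.

(** By Tonelli the integral of the absolute value over the rectangle is [m1 D1] times the integral
    over [D2], whence the finiteness of [m1 D1]. *)
Lemma rint_snd (d1 d2 : measure_display) (T1 : measurableType d1)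
    (T2 : measurableType d2) (R : realType)
    (m1 : {sigma_finite_measure set T1 -> \bar R})
    (m2 : {sigma_finite_measure set T2 -> \bar R}) (D1 : set T1) (D2 : set T2)
    (f : T2 -> R) : measurable D1 -> measurable D2 -> (m1 D1 < +oo)%E -> m2.-integrable D2 (EFin \o f) ->
  (m1 \x m2)%E.-integrable (D1 `*` D2) (EFin \o (fun p : T1 * T2 => f p.2)).
Proof.
move=> mD1 mD2 fD1 rf; have mDD : measurable (D1 `*` D2) by exact: measurableX.
apply/(integrable_mkcond _ mDD).
have mf : measurable_fun setT ((EFin \o (fun p : T1 * T2 => f p.2)) \_ (D1 `*` D2)).
  apply/(measurable_restrictT _ mDD)/measurable_EFinP.
  have := @measurable_fun_preimage _ _ _ _ _ _ (@snd T1 T2) D2 f measurable_snd mD2 (rint_measurable rf).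
  apply: measurable_funS; last by move=> p [].
  by rewrite -[X in measurable X]setTI; exact: measurable_snd.
apply/(integrable21ltyP m1 m2 mf).
rewrite (eq_integral (fun y => m1 D1 * `|((EFin \o f) \_ D2) y|)%E); last first.
  move=> y _.
  rewrite (eq_integral (fun x => `|((EFin \o f) \_ D2) y| * (\1_D1 x)%:E)%E); last first.
    move=> x _; rewrite !patchE indicE.
    have -> : ((x, y) \in D1 `*` D2) = (x \in D1) && (y \in D2).
      by apply/idP/andP; rewrite !inE/= => -[].
    by case: (x \in D1); case: (y \in D2) => /=; rewrite ?normr0 ?mule1 ?mule0.
  rewrite ge0_integralZl//; last by apply/measurable_EFinP; exact: measurable_indic.
  by rewrite integral_indic// setIT muleC.
have /integrableP[mf0 hf0] := (integrable_mkcond _ mD2).1 rf.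
rewrite ge0_integralZl//; last exact: measurableT_comp.
by rewrite lte_mul_pinfty// ge0_fin_numE.
Qed.

(** Slices may fail to be integrable: Tonelli is applied to the positive and negative parts
    separately, and [fine] of the difference stays measurable. This gives the measurability of
    A_{i,j} v, whose integrals are taken on every line, good or bad. *)
Lemma measurable_Rintegral (d1 d2 : measure_display) (T1 : measurableType d1)
    (T2 : measurableType d2) (R : realType)
    (m2 : {sigma_finite_measure set T2 -> \bar R}) (F : T1 * T2 -> R) :
  measurable_fun setT F -> measurable_fun setT (fun x => \int[m2]_y F (x, y)).
Proof.
move=> mF.
apply: (@measurableT_comp _ _ _ _ _ _ (@fine R) _
  (fun x => \int[m2]_y (F (x, y))%:E)%E); first exact: fine_measurable.
have mEF : measurable_fun setT (EFin \o F) by exact/measurable_EFinP.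
rewrite (_ : (fun x => _) =
    (fun x => fubini_F m2 ((EFin \o F)^\+)%E x - fubini_F m2 ((EFin \o F)^\-)%E x)%E).
  apply: emeasurable_funB.
    by apply: measurable_fun_fubini_tonelli_F => //; exact: measurable_funepos.
  by apply: measurable_fun_fubini_tonelli_F => //; exact: measurable_funeneg.
apply/funext => x; rewrite [LHS]integralE.
under eq_integral do rewrite (funepos_comp (EFin \o F) (fun y => (x, y)))/=.
by under [X in (_ - X = _)%E]eq_integral do
  rewrite (funeneg_comp (EFin \o F) (fun y => (x, y)))/=.
Qed.

Lemma product_measure12E (d1 d2 : measure_display) (T1 : measurableType d1)
    (T2 : measurableType d2) (R : realType)
    (m1 : {sigma_finite_measure set T1 -> \bar R})
    (m2 : {sigma_finite_measure set T2 -> \bar R}) (A : set (T1 * T2)) :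
  measurable A -> (m1 \x m2)%E A = (m1 \x^ m2)%E A.
Proof.
by move=> mA; apply: product_measure_unique => //= ? ? ? ?; rewrite product_measure2E.
Qed.

(** * Splitting off an arbitrary coordinate of R^N *)

Section coordinate_split.
Context (R : realType).
Local Notation leb := (@lebesgue_measure R).

Definition insp N (i : 'I_N) (p : measurableTypeR R * pt R N.-1) : pt R N := ins i p.1 p.2.

Definition outs N (i : 'I_N) (s : pt R N) : pt R N.-1 :=
  [tuple tnth s (lift i k) | k < N.-1].

Lemma crd_ins N (i : 'I_N) t (x : pt R N.-1) : crd (ins i t x) i = t.
Proof. by rewrite /crd tnth_mktuple unlift_none. Qed.

Lemma crd_ins_lift N (i : 'I_N) t (x : pt R N.-1) k :
  crd (ins i t x) (lift i k) = crd x k.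
Proof. by rewrite /crd tnth_mktuple liftK. Qed.

Lemma outs_ins N (i : 'I_N) t (x : pt R N.-1) : outs i (ins i t x) = x.
Proof.
by apply: eq_from_tnth => k; rewrite tnth_mktuple -/(crd _ _) crd_ins_lift.
Qed.

Lemma ins_outs N (i : 'I_N) (s : pt R N) : ins i (crd s i) (outs i s) = s.
Proof.
apply: eq_from_tnth => j; rewrite tnth_mktuple.
by case: unliftP => [k ->|->//]; rewrite tnth_mktuple.
Qed.

Lemma upd_ins N (i : 'I_N) t t' (x : pt R N.-1) : upd i t (ins i t' x) = ins i t x.
Proof.
apply: eq_from_tnth => j; rewrite !tnth_mktuple.
case: unliftP => [k ->|->]; last by rewrite eqxx.
by rewrite eq_sym (negbTE (neq_lift _ _)) crd_ins_lift.
Qed.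

Lemma measurable_crd N (i : 'I_N) : measurable_fun setT (fun s : pt R N => crd s i).
Proof. exact: (measurable_tnth (T := measurableTypeR R) i). Qed.

Lemma measurable_insp N (i : 'I_N) : measurable_fun setT (@insp N i).
Proof.
apply/measurable_fun_tnthP => j.
case: (unliftP i j) => [k ->|->].
  rewrite (_ : _ \o _ = (fun x : pt R N.-1 => tnth x k) \o snd).
    apply: measurableT_comp => //; exact: measurable_tnth.
  by apply/funext => p /=; rewrite -!/(crd _ _) crd_ins_lift.
rewrite (_ : _ \o _ = fst)//.
by apply/funext => p /=; rewrite -!/(crd _ _) crd_ins.
Qed.

Lemma ins_ord0 N (p : measurableTypeR R * pt R N) : insp (ord0 : 'I_N.+1) p = cons_pt p.
Proof.
apply: eq_from_tnth => j; rewrite -/(crd _ _).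
case: (unliftP ord0 j) => [k ->|->].
  by rewrite crd_ins_lift /cons_pt /crd tnthS; congr tnth; apply: val_inj.
by rewrite crd_ins /cons_pt tnth0.
Qed.

Lemma crd_cons0 N (s0 : measurableTypeR R) (y : pt R N) :
  crd (cons_pt (s0, y)) ord0 = s0.
Proof. by rewrite /crd tnth0. Qed.

Lemma crd_consS N (s0 : measurableTypeR R) (y : pt R N) k :
  crd (cons_pt (s0, y)) (lift ord0 k) = crd y k.
Proof. by rewrite /crd tnthS; congr tnth; apply: val_inj. Qed.

Lemma ins_cons N (i : 'I_N.+1) (t s0 : measurableTypeR R) (x : pt R N) :
  ins (lift ord0 i) t (cons_pt (s0, x)) = cons_pt (s0, ins i t x).
Proof.
apply: eq_from_tnth => j; rewrite -/(crd _ _) -/(crd _ _).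
case: (unliftP (lift ord0 i) j) => [k ->|->]; last by rewrite crd_ins crd_consS crd_ins.
rewrite crd_ins_lift.
case: (unliftP ord0 k) => [k' ->|->].
  rewrite crd_consS (_ : lift (lift ord0 i) (lift ord0 k') = lift ord0 (lift i k')).
    by rewrite crd_consS crd_ins_lift.
  by apply: val_inj; rewrite /= /bump/= !add1n ltnS; case: (i <= k')%N.
rewrite crd_cons0 (_ : lift (lift ord0 i) ord0 = ord0) ?crd_cons0//.
exact: val_inj.
Qed.

Lemma lebn_consE N (A : set (pt R N.+1)) :
  lebn R N.+1 A = (leb \x lebn R N)%E ((@cons_pt _ (measurableTypeR R) N) @^-1` A).
Proof. by []. Qed.

(** The measure [lebn] is built by splitting off the first coordinate. For a later coordinate, the
    induction hypothesis splits it off the tail, and Tonelli then exchanges it with the first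
    one. *)
Lemma lebn_ins N (i : 'I_N) (A : set (pt R N)) : measurable A ->
  lebn R N A = (leb \x lebn R N.-1)%E (@insp N i @^-1` A).
Proof.
elim: N i A => [[]//|N IH] i A mA.
case: (unliftP ord0 i) => [j ->|->]; last first.
  rewrite lebn_consE; congr (_ _); apply/seteqP; split => p; rewrite /= ins_ord0//.
case: N IH A mA j {i} => [_ A mA []//|N IH A mA j].
rewrite lebn_consE.
have mc : measurable_fun setT (@cons_pt _ (measurableTypeR R) N.+1) by exact: measurable_cons_pt.
have mcA := mc measurableT _ mA; rewrite setTI in mcA.
(* The set [A] in the variables ((s_0, s_i), others), where s_0 and s_i can be exchanged. *)
pose W : set ((measurableTypeR R * measurableTypeR R) * pt R N) :=
  [set q | A (cons_pt (q.1.1, ins j q.1.2 q.2))].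
have mW : measurable W.
  have mw : measurable_fun setT
      (fun q : (measurableTypeR R * measurableTypeR R) * pt R N =>
         cons_pt (q.1.1, insp j (q.1.2, q.2))).
    apply: measurable_cons; first exact: (measurableT_comp measurable_fst measurable_fst).
    apply: (measurableT_comp (measurable_insp j)).
    apply/measurable_fun_pairP; split; last exact: measurable_snd.
    exact: (measurableT_comp measurable_snd measurable_fst).
  by have := mw measurableT _ mA; rewrite setTI.
pose H (q : measurableTypeR R * measurableTypeR R) := lebn R N (xsection W q).
have mH : measurable_fun setT H := measurable_fun_xsection (lebn R N) mW.
transitivity (\int[leb]_x \int[leb]_y H (x, y))%E.
  apply: eq_integral => x _ /=.
  rewrite (IH j); last exact: measurable_xsection.
  apply: eq_integral => y _ /=; congr (lebn R N _).
  apply/seteqP; split => z; first by move=> /xsectionP/xsectionP h; apply/xsectionP.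
  by move=> /xsectionP h; apply/xsectionP/xsectionP.
etransitivity; first exact: (fubini_tonelli H mH).
apply: eq_integral => y _ /=.
rewrite lebn_consE; apply: eq_integral => x _ /=; congr (lebn R N _).
apply/seteqP; split => z.
  by move=> /xsectionP h; apply/xsectionP/xsectionP; rewrite /= /insp/= ins_cons.
by move=> /xsectionP/xsectionP; rewrite /= /insp/= ins_cons => h; apply/xsectionP.
Qed.

Section box_fubini.
Context (N : nat) (i : 'I_N) (a b : 'I_N -> R).
Let I := `[a i, b i]%classic : set (measurableTypeR R).
Let box' := box (a \o lift i) (b \o lift i) : set (pt R N.-1).

Lemma measurable_box M (a' b' : 'I_M -> R) : measurable (box a' b' : set (pt R M)).
Proof.
rewrite (_ : box a' b' = \bigcap_(i in [set: 'I_M]) ((fun s : pt R M => crd s i) @^-1` `[a' i, b' i])).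
  apply: fin_bigcap_measurable => // k _; rewrite -[X in measurable X]setTI.
  by apply: measurable_crd => //; exact: measurable_itv.
apply/seteqP; split => s h k.
  by move=> _ /=; rewrite in_itv/=; exact: h.
by have := h k Logic.I; rewrite /= in_itv.
Qed.

Lemma insp_box : @insp N i @^-1` box a b = I `*` box'.
Proof.
apply/seteqP; split => -[t x] /=.
  move=> h; split; first by have := h i; rewrite crd_ins /I/= in_itv.
  by move=> k; have := h (lift i k); rewrite crd_ins_lift.
move=> [/=]; rewrite /I/= in_itv/= => It h j.
case: (unliftP i j) => [k ->|->]; last by rewrite crd_ins.
by rewrite crd_ins_lift; exact: h.
Qed.

Lemma box_insP t x : box a b (ins i t x) <-> I t /\ box' x.
Proof.
have := insp_box; rewrite seteqP => -[h1 h2]; split; first exact: (h1 (t, x)).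
exact: (h2 (t, x)).
Qed.

Lemma lebn_pushforward (A : set (pt R N)) : measurable A ->
  lebn R N A = pushforward (leb \x lebn R N.-1)%E (@insp N i) A.
Proof. by move=> mA; rewrite /pushforward -lebn_ins. Qed.

Lemma ge0_integral_ins (D : set (pt R N)) (f : pt R N -> \bar R) : measurable D ->
  measurable_fun D f -> (forall s, D s -> (0 <= f s)%E) ->
  (\int[lebn R N]_(s in D) f s =
   \int[leb \x lebn R N.-1]_(p in @insp N i @^-1` D) f (insp i p))%E.
Proof.
move=> mD mf f0.
rewrite (eq_measure_integral (pushforward (leb \x lebn R N.-1)%E (@insp N i))).
- exact: measurable_insp.
- move=> mi; rewrite ge0_integral_pushforward//.
  by move=> s /set_mem; exact: f0.
- by move=> mi A mA _; exact: lebn_pushforward.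
Qed.

Lemma integrable_ins (D : set (pt R N)) (f : pt R N -> R) : measurable D ->
  (lebn R N).-integrable D (EFin \o f) ->
  (leb \x lebn R N.-1)%E.-integrable (@insp N i @^-1` D) (EFin \o (f \o insp i)).
Proof.
move=> mD /integrableP[mf h]; apply/integrableP; split.
  exact: (measurable_fun_preimage (measurable_insp i) mD mf).
by rewrite ge0_integral_ins// in h; exact: measurableT_comp.
Qed.

Lemma Rintegral_ins (D : set (pt R N)) (f : pt R N -> R) : measurable D ->
  measurable_fun D f ->
  \int[lebn R N]_(s in D) f s =
   \int[(leb \x lebn R N.-1)%E]_(p in @insp N i @^-1` D) f (insp i p).
Proof.
move=> mD mf; have mEf : measurable_fun D (EFin \o f) by exact/measurable_EFinP.
rewrite /Rintegral; congr fine; rewrite integralE [RHS]integralE; congr (_ - _)%E.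
  rewrite (ge0_integral_ins mD (measurable_funepos mEf))//.
  by under [RHS]eq_integral do rewrite (funepos_comp (EFin \o f) (insp i))/=.
rewrite (ge0_integral_ins mD (measurable_funeneg mEf))//.
  by under [RHS]eq_integral do rewrite (funeneg_comp (EFin \o f) (insp i))/=.
Qed.

Let Omega := box a b : set (pt R N).
Let mOmega : measurable Omega. Proof. exact: measurable_box. Qed.
Let mbox' : measurable box'. Proof. exact: measurable_box. Qed.
Let mI : measurable I. Proof. exact: measurable_itv. Qed.

Section integrable.
Variable f : pt R N -> R.
Hypothesis rf : (lebn R N).-integrable Omega (EFin \o f).

Let rfi : (leb \x lebn R N.-1)%E.-integrable (I `*` box') (EFin \o (f \o insp i)).
Proof. by rewrite -insp_box; exact: integrable_ins. Qed.

Lemma ae_integrable_line : {ae lebn R N.-1, forall x, box' x ->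
  leb.-integrable I (EFin \o (fun t => f (ins i t x)))}.
Proof. exact: (ae_slice_integrable2 mI mbox' rfi). Qed.

Lemma rint_line : (lebn R N.-1).-integrable box'
  (EFin \o (fun x => \int[leb]_(t in I) f (ins i t x))).
Proof. exact: (rint_fubini2 mI mbox' rfi). Qed.

Lemma rint_transverse : leb.-integrable I
  (EFin \o (fun t => \int[lebn R N.-1]_(x in box') f (ins i t x))).
Proof. exact: (rint_fubini1 mI mbox' rfi). Qed.

Lemma Rint_line : \int[lebn R N]_(s in Omega) f s =
  \int[lebn R N.-1]_(x in box') \int[leb]_(t in I) f (ins i t x).
Proof.
rewrite Rintegral_ins//; last exact: rint_measurable rf.
by rewrite insp_box (Rfubini2 mI mbox' rfi).
Qed.

Lemma Rint_transverse : \int[lebn R N]_(s in Omega) f s =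
  \int[leb]_(t in I) \int[lebn R N.-1]_(x in box') f (ins i t x).
Proof.
rewrite Rintegral_ins//; last exact: rint_measurable rf.
by rewrite insp_box (Rfubini1 mI mbox' rfi).
Qed.

End integrable.

Lemma measurable_ins_line (D : set (pt R N)) f x : measurable D -> measurable_fun D f ->
  (forall t, I t -> D (ins i t x)) ->
  measurable_fun I (fun t => f (ins i t x) : R).
Proof.
move=> mD mf ID; have mi : measurable_fun setT (fun t : measurableTypeR R => insp i (t, x)).
  apply: (measurableT_comp (measurable_insp i)).
  exact: measurable_pair2.
have := measurable_fun_preimage mi mD mf; apply: measurable_funS => //.
by rewrite -[X in measurable X]setTI; exact: mi.
Qed.

(** A null set is enclosed in a measurable null set, whose slices are null on almost every line by
    Tonelli. *)
Lemma ae_line (P : pt R N -> Prop) :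
  {ae lebn R N, forall s, Omega s -> P s} ->
  {ae lebn R N.-1, forall x, box' x -> {ae leb, forall t, I t -> P (ins i t x)}}.
Proof.
move=> [Z [mZ Z0 PZ]].
have := lebn_ins i mZ; rewrite Z0 => /esym.
have mZ' : measurable (@insp N i @^-1` Z).
  by have mi := measurable_insp i; have := mi measurableT _ mZ; rewrite setTI.
rewrite (product_measure12E _ _ mZ') /product_measure2.
move=> h; have mh := measurable_fun_ysection leb mZ'.
have : (\int[lebn R N.-1]_x `|(leb \o ysection (@insp N i @^-1` Z)) x| = 0)%E.
  by rewrite -h; apply: eq_integral => x _; rewrite gee0_abs.
move=> /(ae_eq_integral_abs _ measurableT mh).
apply: filterS => x /(_ Logic.I) /= hx xb.
exists (ysection (@insp N i @^-1` Z) x); split => //.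
  exact: measurable_ysection.
move=> t /= nt; apply/ysectionP => /=; apply: PZ => /= h'; apply: nt => It.
by apply: h'; apply/box_insP.
Qed.

(** Converse of [ae_line] for equalities. Null slices say something about the exceptional set only
    if that set is measurable, hence the measurability of [f] and [g]. *)
Lemma ae_eq_of_line (f g : pt R N -> R) :
  measurable_fun Omega f -> measurable_fun Omega g ->
  {ae lebn R N.-1, forall x, box' x -> {ae leb, forall t, I t -> f (ins i t x) = g (ins i t x)}} ->
  ae_eq (lebn R N) Omega f g.
Proof.
move=> mf mg fg.
pose Z := Omega `&` [set s | f s != g s].
have mZ : measurable Z.
  rewrite (_ : Z = Omega `&` (fun s => f s - g s) @^-1` (~` [set 0])).
    by apply: measurable_funB => //; exact: measurableC.
  by apply/seteqP; split => s [Os] /= h; split => //=; [apply/eqP; rewrite subr_eq0|rewrite -subr_eq0; apply/eqP].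
exists Z; split => //; last first.
  by move=> s /= ns; split; [|apply/eqP => fgs]; apply: contrapT => h; apply: ns => //.
transitivity ((leb \x lebn R N.-1)%E (@insp N i @^-1` Z)); first exact: lebn_ins.
have mZ' : measurable (@insp N i @^-1` Z).
  by have mi := measurable_insp i; have := mi measurableT _ mZ; rewrite setTI.
rewrite (product_measure12E _ _ mZ') /product_measure2.
have mh := measurable_fun_ysection leb mZ'.
rewrite (ae_eq_integral (cst 0%E))//; first by rewrite integral0.
apply: filterS fg => x h _ /=.
have [xb|xb] := pselect (box' x).
  apply/(negligibleP _ (measurable_ysection _ mZ')).
  have [A [mA A0 hA]] := h xb; exists A; split => //.
  move=> t /ysectionP/= -[Ot ne]; apply: hA => /= h'.
  move/eqP: ne; apply; apply: h'.
  by have /box_insP[] := Ot.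
rewrite (_ : ysection _ _ = set0) ?measure0//.
apply/seteqP; split => // t /ysectionP/= -[Ot _]; apply: xb.
by have /box_insP[] := Ot.
Qed.

End box_fubini.
End coordinate_split.

(** * Bump functions and the fundamental lemma *)

Section smooth_real_functions.
Context (R : realType).
Implicit Types f g : R -> R.

Definition smooth1 f := forall k x, derivable (derive1n k f) x 1.

(** Differentiating first and then recursing makes closure under sums, products and affine
    substitutions an induction on the order with the function generalised, without Leibniz's formula
    for higher derivatives. *)
Fixpoint nderivable n f : Prop :=
  if n is n'.+1 then (forall x, derivable f x 1) /\ nderivable n' (derive1 f)
  else True.

Lemma nderivableW n f : nderivable n.+1 f -> nderivable n f.
Proof.
by elim: n f => [//|n IH] f /= [df [h1 h2]]; split => //; apply: IH; split.
Qed.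

Lemma smooth1P f : smooth1 f <-> forall n, nderivable n f.
Proof.
split.
  move=> sf n; elim: n f sf => [//|n IH] f sf /=; split; first exact: (sf 0%N).
  by apply: IH => k; rewrite -derive1Sn; exact: sf.
move=> h k; elim: k f h => [|k IH] f h x; first by have [+ _] := h 1%N; apply.
by rewrite derive1Sn; apply: IH => n; have [] := h n.+1.
Qed.

Lemma is_derive1E f (x l : R) : is_derive x 1 f l -> derivable f x 1 /\ derive1 f x = l.
Proof. by move=> [df <-]; split => //; rewrite derive1E. Qed.

Lemma derivable_is_derive1 f (x : R) : derivable f x 1 -> is_derive x 1 f (derive1 f x).
Proof. by move=> df; rewrite derive1E; exact: DeriveDef. Qed.

Lemma nderivable_ext n f g : (forall x, f x = g x) -> nderivable n f -> nderivable n g.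
Proof. by move=> /funext ->. Qed.

Lemma nderivableD n f g : nderivable n f -> nderivable n g ->
  nderivable n (fun x => f x + g x).
Proof.
elim: n f g => [//|n IH] f g [df hf] [dg hg].
have dfg (x : R) : is_derive x 1 (fun x => f x + g x) (derive1 f x + derive1 g x).
  by apply: is_deriveD; exact: derivable_is_derive1.
split; first by move=> x; have [] := is_derive1E (dfg x).
apply: nderivable_ext (IH _ _ hf hg) => x.
by have [_ ->] := is_derive1E (dfg x).
Qed.

Lemma nderivableM n f g : nderivable n f -> nderivable n g ->
  nderivable n (fun x => f x * g x).
Proof.
elim: n f g => [//|n IH] f g hf hg; have [df hf'] := hf; have [dg hg'] := hg.
have dfg (x : R) : is_derive x 1 (fun x => f x * g x) (derive1 f x * g x + f x * derive1 g x).
  rewrite addrC (mulrC (derive1 f x)).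
  by apply: is_deriveM; exact: derivable_is_derive1.
split; first by move=> x; have [] := is_derive1E (dfg x).
have := nderivableD (IH _ _ hf' (nderivableW hg)) (IH _ _ (nderivableW hf) hg').
by apply: nderivable_ext => x; have [_ ->] := is_derive1E (dfg x).
Qed.

Lemma nderivable_cst n c : nderivable n (fun=> c).
Proof.
elim: n c => [//|n IH] c /=; split; first by move=> x; exact: derivable_cst.
by apply: nderivable_ext (IH 0) => x; rewrite derive1_cst.
Qed.

Lemma nderivable_affine n f c e : nderivable n f -> nderivable n (fun x => f (c * x + e)).
Proof.
elim: n f => [//|n IH] f [df hf].
have dfg (x : R) : is_derive x 1 (fun x => f (c * x + e)) (c * derive1 f (c * x + e)).
  have dl : is_derive x 1 (fun x => c * x + e) c.
    by apply: is_derive_eq; rewrite addr0 /GRing.scale/= mulr1 ?mulr0 ?add0r ?addr0.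
  by have := @is_derive1_comp _ f (fun x => c * x + e) x _ _
    (derivable_is_derive1 (df (c * x + e))) dl; rewrite mulrC.
split; first by move=> x; have [] := is_derive1E (dfg x).
have := nderivableM (nderivable_cst n c) (IH _ hf).
by apply: nderivable_ext => x; have [_ ->] := is_derive1E (dfg x).
Qed.

Lemma smooth1M f g : smooth1 f -> smooth1 g -> smooth1 (fun x => f x * g x).
Proof.
by move=> /smooth1P sf /smooth1P sg; apply/smooth1P => n; exact: nderivableM.
Qed.

Lemma smooth1D f g : smooth1 f -> smooth1 g -> smooth1 (fun x => f x + g x).
Proof.
by move=> /smooth1P sf /smooth1P sg; apply/smooth1P => n; exact: nderivableD.
Qed.

Lemma smooth1_affine f c e : smooth1 f -> smooth1 (fun x => f (c * x + e)).
Proof. by move=> /smooth1P sf; apply/smooth1P => n; exact: nderivable_affine. Qed.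

Lemma smooth1_cst c : smooth1 (fun=> c).
Proof. by apply/smooth1P => n; exact: nderivable_cst. Qed.

Lemma smooth1_derive1 f : smooth1 f -> smooth1 (derive1 f).
Proof. by move=> sf k; rewrite -derive1Sn; exact: sf. Qed.

Lemma smooth1_derive1n f k : smooth1 f -> smooth1 (derive1n k f).
Proof.
move=> sf; elim: k => [|k IH]; first exact: sf.
by rewrite (derive1nS f k); exact: smooth1_derive1.
Qed.

Lemma smooth1_continuous f : smooth1 f -> continuous f.
Proof.
by move=> sf x; apply: differentiable_continuous; apply/derivable1_diffP; exact: (sf 0%N).
Qed.

Lemma smooth1_measurable f (D : set R) : measurable D -> smooth1 f -> measurable_fun D f.
Proof.
move=> mD sf; apply: measurable_funS (continuous_measurable_fun (smooth1_continuous sf)) => //.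
Qed.

(* The functions q(1/x) e^(-1/x), extended by 0 to x <= 0, are stable under derivation. *)
Definition flat (q : {poly R}) (x : R) : R :=
  if 0 < x then q.[x^-1] * expR (- x^-1) else 0.

(** The constant comes from the termwise bound y^i / i! <= e^y. *)
Lemma horner_le_expR (q : {poly R}) : exists2 C : R, 0 <= C &
  forall y, 0 <= y -> `|q.[y]| <= C * expR y.
Proof.
exists (\sum_(i < size q) `|q`_i| * i`!%:R).
  by apply: sumr_ge0 => i _; rewrite mulr_ge0.
move=> y y0; rewrite horner_coef mulr_suml; apply: le_trans (ler_norm_sum _ _ _) _.
apply: ler_sum => i _; rewrite normrM -mulrA ler_wpM2l// ger0_norm ?exprn_ge0//.
rewrite -ler_pdivrMl ?ltr0n ?fact_gt0// mulrC.
case: (i : nat) => [|k]; first by rewrite expr0 fact0 invr1 mulr1 -expR0 ler_expR.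
by apply: le_trans (expR_ge1Dxn k y0); rewrite lerDr.
Qed.

(** The exponential bound at y = 1/x is used for X q instead of q, which gains one factor x. *)
Lemma flat_le_id (q : {poly R}) : exists2 C : R, 0 <= C &
  forall x, `|flat q x| <= C * `|x|.
Proof.
have [C C0 hC] := horner_le_expR ('X * q).
exists C => // x; rewrite /flat; case: ifPn => [x0|_]; last by rewrite normr0 mulr_ge0.
have xV : 0 <= x^-1 by rewrite invr_ge0 ltW.
have := hC _ xV; rewrite hornerM hornerX normrM (ger0_norm xV) => h.
rewrite normrM [`|expR _|]ger0_norm ?expR_ge0// (gtr0_norm x0) expRN.
rewrite ler_pdivrMr ?expR_gt0//.
rewrite -(ler_pM2l (x := x^-1)) ?invr_gt0//; apply: le_trans h _.
by rewrite mulrAC (mulrC _ x) !mulrA mulVf ?gt_eqF// mul1r.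
Qed.

(** For x > 0 the derivative of q(1/x) e^(-1/x) is x^(-2) (q(1/x) - q'(1/x)) e^(-1/x), again of the
    same form; at 0 all functions of the family have derivative 0. *)
Lemma is_derive_flat (q : {poly R}) (x : R) :
  is_derive x 1 (flat q) (flat ('X^2 * (q - deriv q)) x).
Proof.
have [x0|x0|->] := ltgtP x 0.
- rewrite [X in is_derive _ _ _ X]/flat ltNge (ltW x0)/=.
  have h : \near x, (fun=> 0) x = flat q x.
    near=> y; have y0 : y < 0 by near: y; exact: lt_nbhsl.
    by rewrite /flat ltNge (ltW y0).
  exact: (near_eq_is_derive h (is_derive_cst _ _ _)).
- rewrite [X in is_derive _ _ _ X]/flat x0.
  have h : \near x, (fun y => q.[y^-1] * expR (- y^-1)) x = flat q x.
    near=> y; have y0 : 0 < y by near: y; exact: lt_nbhsr.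
    by rewrite /flat y0.
  apply: (near_eq_is_derive h).
  have x1 : id x != 0 by rewrite gt_eqF.
  have dV : is_derive x 1 (fun y : R => y^-1) (- x ^- 2).
    by have := is_deriveV x1 (is_derive_id x 1); rewrite /GRing.scale/= mulr1.
  have dq := is_derive1_comp (is_derive_poly q x^-1) dV.
  have dN : is_derive x 1 (fun y : R => - y^-1) (x ^- 2).
    by have := is_deriveN dV; rewrite opprK.
  have de := @is_derive1_comp _ expR (fun y : R => - y^-1) x _ _ (is_derive_expR (- x^-1)) dN.
  case: (is_deriveM dq de) => d1 e1; apply: DeriveDef; first exact: d1.
  rewrite [LHS]e1 /GRing.scale/= hornerM hornerXn hornerD hornerN -exprVn; ring.
- rewrite [X in is_derive _ _ _ X]/flat ltxx.
  (* The difference quotient at 0 is [flat ('X * q) h], at most a constant times |h|. *)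
  have cv : h^-1 *: (flat q (h *: 1 + 0) - flat q 0) @[h --> (0:R)^'] --> (0:R).
    have [C C0 hC] := flat_le_id ('X * q).
    apply/cvgrPdist_le => e e0; near=> h.
    rewrite sub0r normrN addr0 {2}/flat ltxx subr0 /GRing.scale/= mulr1.
    apply: (@le_trans _ _ (C * `|h|)).
      apply: le_trans (hC h); rewrite /flat; case: ifPn => [h0|_]; last by rewrite mulr0.
      by rewrite hornerM hornerX mulrA.
    apply: (@le_trans _ _ ((C + 1) * `|h|)); first by rewrite ler_wpM2r// lerDl.
    rewrite -ler_pdivlMl ?ltr_wpDl//.
    by near: h; apply: dnbhs0_le; rewrite mulr_gt0// invr_gt0 ltr_wpDl.
  apply: DeriveDef; first by apply/cvg_ex; exists 0.
  exact: cvg_lim.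
Unshelve. all: by end_near. Qed.

Lemma smooth1_flat (q : {poly R}) : smooth1 (flat q).
Proof.
apply/smooth1P => n; elim: n q => [//|n IH] q; split.
  by move=> x; have [] := is_derive1E (is_derive_flat q x).
apply: nderivable_ext (IH ('X^2 * (q - deriv q))) => x.
by have [_ ->] := is_derive1E (is_derive_flat q x).
Qed.

(** The shift by -1 confines the support to [p + 1/m, q - 1/m], inside the open interval, and the
    slope m makes the functions converge to the indicator of ]p, q[. For m = 0 the function is
    zero. *)
Definition sbump (p q : R) (m : nat) (t : R) : R :=
  flat 1 (m%:R * t + (- (m%:R * p) - 1)) * flat 1 (- m%:R * t + (m%:R * q - 1)).

Lemma smooth1_sbump p q m : smooth1 (sbump p q m).
Proof. by apply: smooth1M; apply: smooth1_affine; exact: smooth1_flat. Qed.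

Lemma flat1_ge0 x : 0 <= flat 1 x.
Proof. by rewrite /flat; case: ifP => // _; rewrite hornerC mul1r expR_ge0. Qed.

Lemma flat1_le1 x : flat 1 x <= 1.
Proof.
rewrite /flat; case: ifPn => // x0; rewrite hornerC mul1r -expR0 ler_expR.
by rewrite oppr_le0 invr_ge0 ltW.
Qed.

Lemma sbump_norm p q m t : `|sbump p q m t| <= 1.
Proof.
by rewrite ger0_norm ?mulr_ge0 ?flat1_ge0// mulr_ile1 ?flat1_ge0 ?flat1_le1.
Qed.

Lemma sbump_neq0 p q m t : sbump p q m t != 0 -> (0 < m)%N /\ p + m%:R^-1 <= t <= q - m%:R^-1.
Proof.
rewrite /sbump mulf_eq0 negb_or {1 2}/flat; case: ifP => [h1|]; last by rewrite eqxx.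
case: ifP => [h2 _|]; last by rewrite eqxx andbF.
have m0 : (0 < m)%N by case: m h1 {h2} => //; rewrite !mul0r oppr0 !add0r ltr0N1.
have m0' : 0 < m%:R :> R by rewrite ltr0n.
split => //; apply/andP; split.
  rewrite -(ler_pM2l m0') mulrDr divff ?gt_eqF// ltW//.
  by move: h1; rewrite -opprD subr_gt0.
rewrite -(ler_pM2l m0') mulrBr divff ?gt_eqF// ltW//.
by move: h2; rewrite mulNr addrC subr_gt0.
Qed.

Lemma flat1_cvg (u : nat -> R) : u n @[n --> \oo] --> +oo -> flat 1 (u n) @[n --> \oo] --> (1 : R).
Proof.
move=> cu.
have : expR (- (u n)^-1) @[n --> \oo] --> (1 : R).
  rewrite -expR0; apply: continuous_cvg; first exact: continuous_expR.
  by rewrite -oppr0; apply: cvgN; apply/gtr0_cvgV0 => //; exact: (cvgryPgt _).1.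
apply: cvg_trans; apply: near_eq_cvg; near=> n.
have un0 : 0 < u n by near: n; exact: (cvgryPgt _).1.
by rewrite /flat un0 hornerC mul1r.
Unshelve. all: by end_near. Qed.

Lemma sbump_cvg p q t : sbump p q m t @[m --> \oo] --> (\1_(`]p, q[%classic) t : R).
Proof.
rewrite indicE; have [|] := boolP (t \in `]p, q[%classic); last first.
  move=> tpq; apply: cvg_near_cst; apply: nearW => m; apply/eqP; apply/negPn/negP.
  move=> /sbump_neq0[m0 /andP[h1 h2]]; move/negP: tpq; apply; rewrite inE/= in_itv/=.
  have mV : 0 < m%:R^-1 :> R by rewrite invr_gt0 ltr0n.
  by rewrite (lt_le_trans _ h1) ?ltrDl// (le_lt_trans h2)// ltrBlDr ltrDl.
rewrite inE/= in_itv/= => /andP[pt tq].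
have lin (c e : R) : 0 < c -> (n%:R * c - e : R) @[n --> \oo] --> +oo.
  move=> c0; apply/cvgryPge => A; near=> n; rewrite lerBrDr -ler_pdivrMr//.
  by near: n; exact: nbhs_infty_ger.
have tp : 0 < t - p by rewrite subr_gt0.
have qt : 0 < q - t by rewrite subr_gt0.
have := cvgM (flat1_cvg (lin _ 1 tp)) (flat1_cvg (lin _ 1 qt)); rewrite mulr1 => cm.
apply: cvg_trans (cm _); apply: near_eq_cvg; apply: nearW => n.
by rewrite /sbump /=; congr (flat 1 _ * flat 1 _); ring.
Unshelve. all: by end_near. Qed.

(** The endpoints lie outside the closed support, hence at positive distance from the points where
    [f] is nonzero. Two numbers p and q replace the closure and are easy to carry through sums,
    products and derivatives. *)
Lemma test_function1P (a b : R) f : test_function1 a b f <->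
  smooth1 f /\ exists p q, [/\ a < p, q < b & forall x, f x != 0 -> p <= x <= q].
Proof.
split => -[sf].
  set S := closure _ => hS; split => //.
  have cS : closed S by exact: closed_closure.
  have sep (c : R) : c \notin `]a, b[%classic -> exists2 e : R, 0 < e & forall x, f x != 0 -> e <= `|c - x|.
    move=> cab; have nSc : (~` S) c by move=> /hS /mem_set; exact/negP.
    have : nbhs c (~` S) by apply: open_nbhs_nbhs; split => //; exact: closed_openC.
    move=> /nbhs_ballP[e /= e0 he]; exists e => // x fx; rewrite leNgt; apply/negP => cx.
    by apply: (he x cx); exact: subset_closure.
  have [|e1 e10 h1] := sep a.
    by rewrite notin_setE/= in_itv/= ltxx.
  have [|e2 e20 h2] := sep b.
    by rewrite notin_setE/= in_itv/= ltxx andbF.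
  exists (a + e1), (b - e2); split; rewrite ?ltrDl ?ltrBlDr ?ltrDl// => x fx.
  have : S x by exact: subset_closure.
  move=> /hS; rewrite /= in_itv/= => /andP[ax xb].
  have := h1 x fx; rewrite ltr0_norm ?subr_lt0// opprB lerBrDl => ->/=.
  by have := h2 x fx; rewrite gtr0_norm ?subr_gt0// lerBrDr addrC -lerBrDr.
move=> [p [q [ap qb h]]]; split => //.
have : closed `[p, q]%classic by exact: interval_closed.
rewrite closure_id => clE; apply: (@subset_trans _ `[p, q]).
  by rewrite [X in _ `<=` X]clE; apply: closure_subset => x /= /h; rewrite in_itv.
by move=> x /=; rewrite !in_itv/= => /andP[px xq]; rewrite (lt_le_trans ap px) (le_lt_trans xq qb).
Qed.

Lemma test_sbump (a b p q : R) m : a <= p -> q <= b -> test_function1 a b (sbump p q m).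
Proof.
move=> ap qb; apply/test_function1P; split; first exact: smooth1_sbump.
have [->|m0] := posnP m.
  exists (a + 1), (b - 1); split; rewrite ?ltrDl ?ltrBlDr ?ltrDl// => x.
  by move=> /sbump_neq0[].
have mV : 0 < m%:R^-1 :> R by rewrite invr_gt0 ltr0n.
exists (p + m%:R^-1), (q - m%:R^-1); split; last by move=> x /sbump_neq0[].
  by rewrite (le_lt_trans ap)// ltrDl.
by rewrite (lt_le_trans _ qb)// ltrBlDr ltrDl.
Qed.

Lemma test_derive1 (a b : R) f : test_function1 a b f -> test_function1 a b (derive1 f).
Proof.
move=> /test_function1P[sf [p [q [ap qb h]]]]; apply/test_function1P; split.
  exact: smooth1_derive1.
exists p, q; split => // x; apply: contraNT => xpq; apply/eqP.
suff : \forall y \near x, (fun=> 0) y = f y.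
  by move=> e; have [_ ->] := is_derive1E (near_eq_is_derive e (is_derive_cst _ _ _)).
have : (~` `[p, q]%classic) x by rewrite /= in_itv/=; exact/negP.
have op : open (~` `[p, q]%classic) by apply: closed_openC; exact: interval_closed.
move=> xo; have : nbhs x (~` `[p, q]%classic) by apply: open_nbhs_nbhs.
apply: filterS => y /= ny; apply/esym/eqP; apply: contrapT => /negP fy; apply: ny.
by rewrite in_itv/= h.
Qed.

Lemma test_derive1n (a b : R) f k : test_function1 a b f -> test_function1 a b (derive1n k f).
Proof.
by move=> tf; elim: k => [//|k IH]; rewrite (derive1nS f k); exact: test_derive1.
Qed.

Lemma test_bounded (a b : R) f : test_function1 a b f -> exists2 M : R, 0 <= M & forall x, `|f x| <= M.
Proof.
move=> /test_function1P[sf [p [q [ap qb h]]]].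
have : compact (f @` `[p, q]).
  apply: continuous_compact; last exact: segment_compact.
  by apply: continuous_subspaceT; exact: smooth1_continuous.
move=> /compact_bounded[M [_ hM]]; exists (`|M| + 1) => [|x]; first by rewrite addr_ge0.
have [->|fx] := eqVneq (f x) 0; first by rewrite normr0 addr_ge0.
apply: hM; first by rewrite (le_lt_trans (ler_norm _))// ltrDl.
by exists x => //=; rewrite in_itv/=; exact: h.
Qed.

Lemma test0 (a b : R) f x : test_function1 a b f -> ~~ (a < x < b) -> f x = 0.
Proof.
move=> /test_function1P[sf [p [q [ap qb h]]]]; apply: contraNeq => /h/andP[px xq].
by rewrite (lt_le_trans ap px) (le_lt_trans xq qb).
Qed.

End smooth_real_functions.

(** Dynkin's argument: the sets over which [g] integrates to 0 are stable under proper differences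
    and, by dominated convergence, under increasing unions, so they include the sigma-algebra
    generated by [G]. The total integral is a separate hypothesis because [G] need not contain the
    whole space. *)
Lemma ae_eq0_pisystem (d : measure_display) (T : measurableType d) (R : realType)
    (mu : {measure set T -> \bar R}) (G : set (set T)) (g : T -> R) :
  measurable = <<s G >> -> setI_closed G ->
  mu.-integrable setT (EFin \o g) -> \int[mu]_x g x = 0 ->
  (forall A, G A -> \int[mu]_(x in A) g x = 0) ->
  ae_eq mu setT g (cst 0).
Proof.
move=> mG GI rg g0 gG.
have rgA A : measurable A -> mu.-integrable A (EFin \o g).
  by move=> mA; apply: integrableS rg.
pose H := [set A | measurable A /\ \int[mu]_(x in A) g x = 0].
have lH : lambda_system setT H.
  split; [by []|by rewrite /H/=; split|..].
  - move=> A B BA [mA A0] [mB B0]; split; first exact: measurableD.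
    have := @Rintegral_setU _ _ _ mu B (A `\` B) g.
    rewrite setDUK// B0 add0r A0 => -> //; first exact: measurableD.
      exact: rgA.
    by apply/disj_setPS => x [Bx [_ /(_ Bx)]].
  - move=> F ndF HF; have mF k : measurable (F k) by have [] := HF k.
    have mU : measurable (\bigcup_i F i) by exact: bigcupT_measurable.
    split => //.
    rewrite Rintegral_mkcond.
    have := @dominated_convergence _ _ _ mu setT measurableT
      (fun n => EFin \o (g \_ (F n))) (EFin \o (g \_ (\bigcup_i F i)))
      (fun x => `|(g x)%:E|%E).
    case.
    + move=> n; apply/measurable_EFinP/(measurable_restrictT _ _).1 => //.
      exact: rint_measurable (rgA _ (mF n)).
    + apply/measurable_EFinP/(measurable_restrictT _ _).1 => //.
      exact: rint_measurable (rgA _ mU).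
    + apply: aeW => x _; apply: cvg_near_cst.
      have [[k _ Fkx]|nx] := pselect ((\bigcup_i F i) x).
        near=> n; have kn : (k <= n)%N by near: n; exact: nbhs_infty_ge.
        have Fn : F n x by have /subsetPset := ndF k n kn; exact.
        have Un : (\bigcup_i F i) x by exists k.
        by rewrite /= !patchE (mem_set Fn) (mem_set Un).
      apply: nearW => n; have nF : ~ F n x by move=> Fnx; apply: nx; exists n.
      by rewrite /= !patchE (memNset nF) (memNset nx).
    + exact: integrable_abse rg.
    + apply: aeW => x n _; rewrite /= lee_fin patchE; case: ifP => // _.
      by rewrite normr0.
    move=> rU _ cv.
    have : (fun n => \int[mu]_(x in setT) ((EFin \o (g \_ (F n))) x))%E = (fun=> 0%E).
      apply/funext => n; have [_] := HF n; rewrite Rintegral_mkcond => h.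
      by rewrite -[LHS]fineK ?[fine _]h//; apply: integrable_fin_num => //;
         rewrite -restrict_EFin; apply/(integrable_mkcond _ (mF n)); exact: rgA.
    move=> h; move: cv; rewrite h => cv.
    by rewrite /Rintegral (cvg_unique _ cv (cvg_cst _)).
have HT A : measurable A -> H A.
  rewrite mG => GA; apply: (lambda_system_subset GI lH) GA => //.
  by move=> B GB; split; [rewrite mG; exact: sub_sigma_algebra|exact: gG].
have : ae_eq mu setT (EFin \o g) (cst 0%E).
  apply: (integral_ae_eq measurableT rg) => // E _ mE.
  rewrite integral0 -[LHS]fineK; last by apply: integrable_fin_num => //; exact: rgA.
  by have [_] := HT E mE; rewrite /Rintegral => ->.
by apply: filterS => x /(_ Logic.I) /= [->].
Unshelve. all: by end_near. Qed.

(** * The fundamental lemma in one variable *)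

Section fundamental_lemma.
Context (R : realType).
Local Notation leb := (@lebesgue_measure R).
Implicit Types (a b : R) (g : R -> R).

(** Rational endpoints keep the family countable; this is what later allows one null set of lines to
    serve for all the bump functions built on these rays. *)
Let raysG : set (set (measurableTypeR R)) :=
  [set A | A = setT \/ exists q : rat, A = `]ratr q, +oo[%classic].

Let setI_closed_raysG : setI_closed raysG.
Proof.
move=> A B [->|[p ->]]; first by rewrite setTI.
move=> [->|[q ->]]; first by rewrite setIT; right; exists p.
right; exists (Num.max p q); apply/seteqP; split => x /=; rewrite !in_itv/= !andbT.
  by move=> [? ?]; rewrite /Num.max; case: ifP.
move=> hx; split; apply: (le_lt_trans _ hx); rewrite ler_rat le_max lexx ?orbT//.
Qed.

Let measurable_raysG : @measurable _ (measurableTypeR R) = <<s raysG >>.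
Proof.
apply/seteqP; split.
  rewrite RGenOInfty.measurableE; apply: smallest_sub; first exact: smallest_sigma_algebra.
  move=> _ [x ->].
  pose F (q : rat) : set R := if x < ratr q then `]ratr q, +oo[%classic else set0.
  rewrite (_ : `]x, +oo[%classic = \bigcup_q F q).
    apply: (@bigcupT_measurable_rat _ (g_sigma_algebraType raysG)) => q.
    rewrite /F; case: ifP => _; last exact: measurable0.
    by apply: sub_sigma_algebra; right; exists q.
  apply/seteqP; split => y /=; rewrite in_itv/= andbT.
    move=> /rat_in_itvoo[q]; rewrite in_itv/= => /andP[xq qy].
    by exists q => //; rewrite /F xq /= in_itv/= qy.
  move=> [q _]; rewrite /F; case: ifP => // xq; rewrite /= in_itv/= andbT.
  exact: lt_trans.
apply: smallest_sub; first exact: sigma_algebra_measurable.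
by move=> A [->|[q ->]] //; exact: measurable_itv.
Qed.

(** Left endpoint of the trace on ]a, b[ of a ray of [raysG]; [None] stands for the whole line. *)
Definition lo a (o : option rat) : R := if o is Some q then Num.max a (ratr q) else a.

Lemma lo_ge a o : a <= lo a o.
Proof. by case: o => [q|] //=; rewrite le_max lexx. Qed.

Lemma integral_bump_cvg a b p q g : leb.-integrable `[a, b] (EFin \o g) ->
  a <= p -> q <= b ->
  \int[leb]_(x in `[a, b]) (g x * sbump p q m x) @[m --> \oo] -->
  \int[leb]_(x in `]p, q[) g x.
Proof.
move=> rg ap qb; have mab : measurable (`[a, b]%classic : set (measurableTypeR R)) by exact: measurable_itv.
have mg := rint_measurable rg.
have rpq : leb.-integrable `]p, q[ (EFin \o g).
  apply: integrableS rg => //.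
  by move=> x /=; rewrite !in_itv/= => /andP[h1 h2]; rewrite (le_trans ap (ltW h1)) (le_trans (ltW h2) qb).
have := @dominated_convergence _ _ _ leb `[a, b]%classic mab
   (fun n => EFin \o (fun x => g x * sbump p q n x)) (EFin \o (fun x => g x * \1_(`]p, q[%classic) x))
      (fun x => `|(g x)%:E|%E).
case.
- move=> n; apply/measurable_EFinP; apply: measurable_funM => //.
  by apply: smooth1_measurable => //; exact: smooth1_sbump.
- apply/measurable_EFinP; apply: measurable_funM => //.
- apply: aeW => x _; apply: cvg_EFin; first exact: nearW.
  by apply: cvgM; [exact: cvg_cst|exact: sbump_cvg].
- exact: integrable_abse rg.
- apply: aeW => x n _; rewrite /= lee_fin normrM ler_piMr//; exact: sbump_norm.
move=> rl _ cv.
have -> : \int[leb]_(x in `]p, q[) g x = \int[leb]_(x in `[a, b]) (g x * \1_(`]p, q[%classic) x).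
  rewrite (_ : `]p, q[%classic = `[a, b]%classic `&` `]p, q[%classic); last first.
    apply/esym/setIidPr => x /=; rewrite !in_itv/= => /andP[h1 h2].
    by rewrite (le_trans ap (ltW h1)) (le_trans (ltW h2) qb).
  rewrite Rintegral_mkcondr; apply: Rint_eq => x abx; rewrite patchE indicE.
  by rewrite in_setI [x \in `[a, b]%classic]mem_set//=; case: ifP; rewrite ?mulr1 ?mulr0.
apply: fine_cvg; rewrite fineK; first exact: cv.
exact: integrable_fin_num.
Qed.

(** Countably many tests suffice: as m grows, the bumps give the integrals of [g] over the intervals
    ]lo a o, b[, and the corresponding rays form a pi-system generating the Borel sets. *)
Lemma fundamental1 a b g : leb.-integrable `[a, b] (EFin \o g) ->
  (forall o m, \int[leb]_(x in `[a, b]) (g x * sbump (lo a o) b m x) = 0) ->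
  ae_eq leb `[a, b]%classic g (cst 0).
Proof.
move=> rg h.
have h1 o : \int[leb]_(x in `]lo a o, b[) g x = 0.
  have := integral_bump_cvg rg (lo_ge a o) (lexx b).
  rewrite (_ : (fun m => _) = (fun=> 0)) => [cv|]; last by apply/funext => m; exact: h.
  by rewrite -(cvg_unique _ cv (cvg_cst _)).
have rab : leb.-integrable `]a, b[ (EFin \o g).
  by apply: integrableS rg => //; exact: subset_itv_oo_cc.
have mab : measurable (`]a, b[%classic : set (measurableTypeR R)) by exact: measurable_itv.
have : ae_eq leb setT (g \_ `]a, b[) (cst 0).
  apply: (ae_eq0_pisystem measurable_raysG setI_closed_raysG).
  - by rewrite -restrict_EFin; apply/(integrable_mkcond _ mab).
  - by rewrite -Rintegral_mkcond; exact: (h1 None).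
  - move=> A [->|[q ->]]; first by rewrite -Rintegral_mkcond; exact: (h1 None).
    rewrite -Rintegral_mkcondr -[RHS](h1 (Some q)); congr (Rintegral _ _ _).
    apply/seteqP; split => x /=; rewrite !in_itv/= andbT gt_max.
      by move=> [-> /andP[-> ->]].
    by move=> /andP[/andP[-> ->] ->].
(* The pi-system argument concerns the open interval; the two endpoints of [a, b] are null. *)
have h3 (c : R) : {ae leb, forall x, x != c}.
  exists [set c]; split; [exact: measurable_set1|exact: lebesgue_measure_set1|].
  by move=> x /= /negP/negPn/eqP.
move=> h2; apply: (@filterS3 _ _ (ae_filter_ringOfSetsType leb) _ _ _ _ _ h2 (h3 a) (h3 b)).
move=> x + xa xb xab; move=> /(_ Logic.I); rewrite patchE mem_set//=.
by move: xab; rewrite /= !in_itv/= !lt_neqAle xb eq_sym xa.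
Qed.

Lemma fundamental1_eq a b g h : leb.-integrable `[a, b] (EFin \o g) ->
  leb.-integrable `[a, b] (EFin \o h) ->
  (forall o m, \int[leb]_(x in `[a, b]) (g x * sbump (lo a o) b m x) =
               \int[leb]_(x in `[a, b]) (h x * sbump (lo a o) b m x)) ->
  ae_eq leb `[a, b]%classic g h.
Proof.
move=> rg rh gh; apply: ae_eq_sub0; apply: fundamental1; first exact: rintB.
move=> o m; set f := sbump _ _ _.
have rM k : leb.-integrable `[a, b] (EFin \o k) -> leb.-integrable `[a, b] (EFin \o (fun x => k x * f x)).
  move=> rk; apply: (rintM (M := 1) _ rk) => //; first by apply: smooth1_measurable => //; exact: smooth1_sbump.
  by move=> x _; exact: sbump_norm.
rewrite (Rint_eq leb (g := fun x => g x * f x - h x * f x)); last first.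
  by move=> x _; rewrite mulrBl.
by rewrite RintegralB ?gh ?subrr//; exact: rM.
Qed.

Lemma continuous_ae_eq a b g h : a < b ->
  {within `[a, b], continuous g} -> {within `[a, b], continuous h} ->
  ae_eq leb `[a, b]%classic g h -> forall x, a <= x <= b -> g x = h x.
Proof.
move=> ab cg ch gh x0 x0ab; apply/eqP; rewrite -subr_eq0; apply/negPn/negP => ne0.
have cgh : {within `[a, b], continuous (fun x => g x - h x)}.
  by move=> x; apply: cvgB; [exact: cg|exact: ch].
have : \forall x \near within `[a, b] (nbhs x0), g x - h x != 0.
  have /subspace_continuousP/(_ x0) := cgh.
  rewrite /= in_itv/= => /(_ x0ab) cv.
  exact: (cvgr_neq0 _ cv ne0).
rewrite /within/= => /nbhs_ballP[e /= e0 he].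
(* The interval around x0 is clipped to [a, b], since x0 may be an endpoint; it keeps a positive
   length because a < b. *)
pose l := Num.max a (x0 - e); pose r := Num.min b (x0 + e).
have /andP[ax xb] := x0ab.
have lr : l < r.
  rewrite /l /r gt_max !lt_min ab/= (le_lt_trans ax) ?ltrDl//= (lt_le_trans _ xb) ?ltrBlDr ?ltrDl//=.
  by rewrite -addrA ltrDl addr_gt0.
have [Z [mZ Z0 hZ]] := gh.
have : (leb `]l, r[ <= leb Z)%E.
  apply: (le_measure leb); rewrite ?inE//.
  move=> x /=; rewrite in_itv/= gt_max lt_min => /andP[/andP[h1 h2] /andP[h3 h4]].
  apply: hZ => /= /(_ _)/eqP; rewrite !in_itv/= (ltW h1) (ltW h3) => /(_ isT); rewrite -subr_eq0.
  apply/negP; apply: he; last by rewrite in_itv/= (ltW h1) (ltW h3).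
  by rewrite /ball/= ltr_norml; apply/andP; split; rewrite ?ltrBrDr ?ltrBlDr; lra.
by rewrite Z0 lebesgue_measure_itv/= lte_fin lr leNgt -EFinB lte_fin subr_gt0 lr.
Qed.

Lemma rint_test a b g f : leb.-integrable `[a, b] (EFin \o g) -> test_function1 a b f ->
  leb.-integrable `[a, b] (EFin \o (fun x => g x * f x)).
Proof.
move=> rg tf; have [M M0 fM] := test_bounded tf.
apply: rintM rg _ (fun x _ => fM x) => //.
by apply: smooth1_measurable => //; case: tf.
Qed.

Lemma within_continuous_rint a b g : {within `[a, b], continuous g} ->
  leb.-integrable `[a, b] (EFin \o g).
Proof. by move=> cg; apply: continuous_compact_integrable => //; exact: segment_compact. Qed.

Lemma smooth1_within a b (g : R -> R) : smooth1 g -> {within `[a, b], continuous g}.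
Proof. by move=> sg; apply: continuous_subspaceT; exact: smooth1_continuous. Qed.

Lemma smooth1_LR a b (g : R -> R) : smooth1 g -> derivable_oo_LRcontinuous g a b.
Proof.
move=> sg; have cg := smooth1_continuous sg; split.
- by move=> x _; exact: (sg 0%N).
- by apply: cvg_at_right_filter; exact: cg.
- by apply: cvg_at_left_filter; exact: cg.
Qed.

Lemma smooth_by_parts a b (f g : R -> R) : a < b -> smooth1 f -> smooth1 g ->
  \int[leb]_(x in `[a, b]) (f x * derive1 g x) =
  f b * g b - f a * g a - \int[leb]_(x in `[a, b]) (derive1 f x * g x).
Proof.
move=> ab sf sg; apply: Rintegration_by_parts => //.
- by apply: smooth1_within; exact: smooth1_derive1.
- exact: smooth1_LR.
- by apply: smooth1_within; exact: smooth1_derive1.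
- exact: smooth1_LR.
Qed.

(** The primitive that vanishes to the left of the support vanishes to its right because the total
    integral is 0. *)
Lemma test_primitive a b f : a < b -> test_function1 a b f ->
  \int[leb]_(x in `[a, b]) f x = 0 ->
  exists2 F, test_function1 a b F & derive1 F = f.
Proof.
move=> ab tf f0; have /test_function1P[sf [p [q [ap qb h]]]] := tf.
(* Integrating from minus infinity and not from [a] gives a function differentiable on the whole
   line, as smoothness requires. *)
pose F x := \int[leb]_(t in `]-oo, x]) f t.
have rT (A : set R) : measurable A -> leb.-integrable A (EFin \o f).
  move=> mA; apply: (@integrableS _ _ _ _ setT) => //.
  have : leb.-integrable `[a, b] (EFin \o f).
    by apply: within_continuous_rint; exact: smooth1_within.
  have mab : measurable (`[a, b]%classic : set (measurableTypeR R)) by exact: measurable_itv.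
  move=> rab; have := (@integrable_mkcond _ (measurableTypeR R) R leb _ (EFin \o f) mab).1 rab.
  apply: eq_integrable => // x _; rewrite patchE/=; case: ifPn => //.
  rewrite notin_setE/= in_itv/= => /negP xab; apply/esym; congr EFin.
  apply: (test0 tf); apply: contra xab => /andP[h1 h2]; by rewrite !ltW.
have dF x : derivable F x 1 /\ derive1 F x = f x.
  apply: (@continuous_FTC1 _ _ _ _ (x + 1)); first by rewrite ltrDl.
  - exact: rT.
  - by rewrite ltNyr.
  - exact: smooth1_continuous.
have F' : derive1 F = f by apply/funext => x; have [] := dF x.
exists F => //; apply/test_function1P; split.
  move=> k x; case: k => [|k]; first by have [] := dF x.
  by rewrite derive1Sn F'; exact: sf.
exists p, q; split => // x; apply: contraNT; rewrite negb_and -!ltNge => xpq.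
apply/eqP; rewrite /F; case/orP: xpq => hx.
  rewrite (Rint_eq leb (g := fun=> 0)) ?Rintegral_cst ?mul0r// => y /=; rewrite in_itv/= => yx.
  apply/eqP; apply: contraTT (le_lt_trans yx hx) => /h/andP[py _]; by rewrite -leNgt.
rewrite -[RHS]f0 Rintegral_mkcond [RHS]Rintegral_mkcond; apply: Rint_eq => y _.
rewrite !patchE; have [->|fy] := eqVneq (f y) 0; first by do 2 case: ifP.
have /andP[py yq] := h _ fy; rewrite !mem_set//=; rewrite !in_itv/=.
  by rewrite (le_trans (ltW ap) py) (le_trans yq (ltW qb)).
by rewrite (le_trans yq (ltW hx)).
Qed.

(** The integrals of the bumps on ]a, b[ tend to b - a, so one of them is nonzero and can be
    normalised. *)
Lemma ex_unit_test a b : a < b ->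
  exists2 f, test_function1 a b f & \int[leb]_(x in `[a, b]) f x = 1.
Proof.
move=> ab.
have r1 : leb.-integrable `[a, b] (EFin \o (fun=> 1 : R)).
  by apply: within_continuous_rint; apply: smooth1_within; exact: smooth1_cst.
have := integral_bump_cvg r1 (lexx a) (lexx b).
rewrite Rintegral_cst; last exact: measurable_itv.
rewrite mul1r /= lebesgue_measure_itv/= lte_fin ab -EFinB/= => cv.
have : b - a != 0 by rewrite subr_eq0 gt_eqF.
move=> /(cvgr_neq0 _ cv) [m _ /(_ m (leqnn m))]/= nz.
move: nz; rewrite (Rint_eq leb (g := sbump a b m)); last by move=> x _; rewrite mul1r.
move=> nz; exists (fun x => (\int[leb]_(x in `[a, b]) sbump a b m x)^-1 * sbump a b m x).
  have /test_function1P[sb [p [q [ap qb h]]]] := test_sbump m (lexx a) (lexx b).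
  apply/test_function1P; split.
    by apply: smooth1M => //; exact: smooth1_cst.
  by exists p, q; split => // x; rewrite mulf_eq0 negb_or => /andP[_ /h].
rewrite RintegralZl ?mulVf//.
by apply: within_continuous_rint; apply: smooth1_within; exact: smooth1_sbump.
Qed.

(** With [e] of integral 1, the function f - (int f) e has mean 0, hence is the derivative of a test
    function. So g - c is orthogonal to every test function f, where c = int g e. *)
Lemma du_bois_reymond a b g : a < b -> {within `[a, b], continuous g} ->
  (forall f, test_function1 a b f -> \int[leb]_(x in `[a, b]) (g x * derive1 f x) = 0) ->
  forall x, a <= x <= b -> g x = g a.
Proof.
move=> ab cg hg; have rg := within_continuous_rint cg.
have [e te e1] := ex_unit_test ab.
pose c := \int[leb]_(x in `[a, b]) (g x * e x).
have mab : measurable (`[a, b]%classic : set (measurableTypeR R)) by exact: measurable_itv.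
have rc (k : R) : leb.-integrable `[a, b] (EFin \o (fun=> k)).
  by apply: within_continuous_rint; apply: smooth1_within; exact: smooth1_cst.
have rtest f : test_function1 a b f -> leb.-integrable `[a, b] (EFin \o f).
  by move=> tf; apply: rint_eq (rint_test (rc 1) tf) => // x _; rewrite mul1r.
have gc : ae_eq leb `[a, b]%classic (fun x => g x - c) (cst 0).
  apply: fundamental1; first by apply: rintB => //.
  move=> o m; set f := sbump _ _ _.
  have tf : test_function1 a b f by apply: test_sbump => //; exact: lo_ge.
  pose I := \int[leb]_(x in `[a, b]) f x.
  have tfe : test_function1 a b (fun x => f x + - I * e x).
    have /test_function1P[s1 [p1 [q1 [ap1 qb1 h1]]]] := tf.
    have /test_function1P[s2 [p2 [q2 [ap2 qb2 h2]]]] := te.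
    apply/test_function1P; split.
      by apply: smooth1D => //; apply: smooth1M => //; exact: smooth1_cst.
    exists (Num.min p1 p2), (Num.max q1 q2); split.
    - by rewrite lt_min ap1.
    - by rewrite gt_max qb1.
    - move=> x; have [->|/h1/andP[? ?] _] := eqVneq (f x) 0.
        rewrite add0r mulf_eq0 negb_or => /andP[_ /h2/andP[? ?]].
        by apply/andP; split; rewrite ?ge_min ?le_max; apply/orP; right.
      by apply/andP; split; rewrite ?ge_min ?le_max; apply/orP; left.
  have rf := rtest _ tf; have re := rtest _ te.
  have [|F tF F'] := test_primitive ab tfe.
    by rewrite RintegralD//; [rewrite RintegralZl// e1 mulr1 subrr|exact: rintZ].
  have := hg F tF; rewrite F'.
  rewrite (Rint_eq leb (g := fun x => g x * f x + - I * (g x * e x))); last first.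
    by move=> x _; ring.
  have rgf := rint_test rg tf; have rge := rint_test rg te.
  rewrite RintegralD//; last exact: rintZ.
  rewrite RintegralZl// -/c => h0.
  rewrite (Rint_eq leb (g := fun x => g x * f x + - c * f x)); last first.
    by move=> x _; rewrite mulrDl.
  rewrite RintegralD//; last exact: rintZ.
  by rewrite RintegralZl// -/I -[RHS]h0 !mulNr (mulrC c).
have gca : forall x, a <= x <= b -> g x = c.
  apply: continuous_ae_eq => //.
    by apply: smooth1_within; exact: smooth1_cst.
  by apply: filterS gc => x h /h /= /eqP; rewrite subr_eq0 => /eqP.
by move=> x xab; rewrite !gca// lexx ltW.
Qed.

End fundamental_lemma.

(** * The univariate operators *)

Section monomials.
Context (R : realType).

Definition mono (m : nat) (z : R) : R := z ^+ m / m`!%:R.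

(** The j-th derivative of [mono k], that is, the k-th coefficient of the j-th derivative of E_1. *)
Definition emono (j k : nat) (z : R) : R := if (j <= k)%N then mono (k - j) z else 0.

Lemma mono0 z : mono 0 z = 1. Proof. by rewrite /mono expr0 fact0 invr1 mulr1. Qed.

Lemma mono_at0 m : mono m 0 = (m == 0%N)%:R.
Proof. by case: m => [|m]; rewrite ?mono0// /mono expr0n mul0r. Qed.

Lemma fact_neq0 m : m`!%:R != 0 :> R.
Proof. by rewrite pnatr_eq0 -lt0n fact_gt0. Qed.

Lemma is_derive_mono m (z : R) : is_derive z 1 (mono m.+1) (mono m z).
Proof.
have hm k : mono k = horner ((k`!%:R)^-1 *: 'X^k).
  by apply/funext => y; rewrite hornerZ hornerXn /mono mulrC.
rewrite hm; have [d1 e1] := is_derive_poly ((m.+1)`!%:R^-1 *: 'X^(m.+1)) z.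
apply: DeriveDef; first exact: d1.
rewrite [LHS]e1 derivZ derivXn/= hornerZ hornerMn hornerXn /mono factS natrM -mulr_natl.
have h1 := fact_neq0 m; have h2 : m.+1%:R != 0 :> R by rewrite pnatr_eq0.
by rewrite mulr1 -[z ^+ m *+ m.+1]mulr_natl invfM mulrACA mulVf// mul1r mulrC.
Qed.

Lemma is_derive_emono j k (z : R) : is_derive z 1 (emono j k) (emono j.+1 k z).
Proof.
rewrite /emono; case: (ltngtP j k) => jk.
- have -> : (k - j = (k - j.+1).+1)%N by rewrite subnSK.
  exact: is_derive_mono.
- exact: is_derive_cst.
- rewrite jk subnn (_ : mono 0 = cst 1); first exact: is_derive_cst.
  by apply/funext => y; rewrite mono0.
Qed.

Lemma derive1_emono j k : derive1 (emono j k) = emono j.+1 k.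
Proof. by apply/funext => z; have [_ ->] := is_derive1E (is_derive_emono j k z). Qed.

Lemma smooth1_emono j k : smooth1 (emono j k).
Proof.
apply/smooth1P => n; elim: n j => [//|n IH] j; split.
  by move=> z; have [] := is_derive1E (is_derive_emono j k z).
by rewrite derive1_emono.
Qed.

Lemma smooth1_mono m : smooth1 (mono m).
Proof.
have -> : mono m = emono 0 m by apply/funext => z; rewrite /emono subn0.
exact: smooth1_emono.
Qed.

Lemma monoD m (x y : R) : mono m (x + y) = \sum_(i < m.+1) mono (m - i) x * mono i y.
Proof.
rewrite /mono exprDn mulr_suml; apply: eq_bigr => i _.
have im : (i <= m)%N by rewrite -ltnS.
rewrite -(bin_fact im) !natrM -mulr_natr.
have h1 := fact_neq0 i; have h2 := fact_neq0 (m - i).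
have h3 : 'C(m, i)%:R != 0 :> R by rewrite pnatr_eq0 -lt0n bin_gt0.
by field; rewrite h1 h2 h3.
Qed.

Lemma mono_norm m (z c : R) : `|z| <= c -> `|mono m z| <= c ^+ m.
Proof.
move=> zc; have c0 := le_trans (normr_ge0 z) zc.
rewrite /mono normrM normfV normrX [`|_%:R|]ger0_norm//.
rewrite ler_pdivrMr ?ltr0n ?fact_gt0//.
apply: (@le_trans _ _ (c ^+ m)); first by rewrite lerXn2r// nnegrE.
by rewrite ler_peMr ?exprn_ge0// ler1n fact_gt0.
Qed.

Lemma derive1n_E1 n d j : derive1n j (@E1 R n d) =
  (fun z => \mxcol_(k < d) ((emono j k z)%:M : 'M[R]_n)).
Proof.
elim: j => [|j IH].
  by apply/funext => z; apply: eq_mxcol => k; rewrite /emono subn0.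
rewrite derive1nS IH; apply/funext => z.
have dM p q : is_derive z (1 : R) (fun z => (\mxcol_(k < d) ((emono j k z)%:M : 'M[R]_n)) p q)
   ((\mxcol_(k < d) ((emono j.+1 k z)%:M : 'M[R]_n)) p q).
  set k := tagnat.sig1 p; set r := tagnat.sig2 p.
  have [dk ek] := @is_deriveZ R R R _ ((r == q)%:R) z 1 _ (is_derive_emono j k z).
  have -> : (fun z => (\mxcol_(k < d) ((emono j k z)%:M : 'M[R]_n)) p q) =
      (r == q)%:R \*: emono j k.
    apply/funext => y; transitivity ((r == q)%:R * emono j k y) => //.
    by rewrite !mxE -/k -/r mulr_natl.
  apply: DeriveDef; first exact: dk.
  rewrite [LHS]ek; transitivity ((r == q)%:R * emono j.+1 k z) => //.
  by rewrite !mxE -/k -/r mulr_natl.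
rewrite derive1E derive_mx; last by apply/derivable_mxP => p q; have [] := dM p q.
by apply/matrixP => p q; rewrite mxE; have [_ ->] := dM p q.
Qed.

End monomials.

Section kernel.
Context (R : realType) (n d : nat).
Variables (a b : R) (B C : 'I_d -> 'I_d -> 'M[R]_n).

Definition Kb k l : 'M[R]_n := submxblock (K a b B C) k l.

(** The kernel is degenerate, a finite sum of functions of s times functions of t: the second
    integral of the operator sees its argument only through finitely many moments. *)
Lemma kernelE j s t :
  (derive1n j (@E1 R n d) (s - a))^T *m K a b B C *m @Ed R n d (b - t) =
  \sum_(k < d) \sum_(l < d) (emono j k (s - a) * mono (d - 1 - l) (b - t)) *: Kb k l.
Proof.
rewrite derive1n_E1 tr_mxcol -(submxblockK (K a b B C)) mul_mxrow_mxblock /Ed mul_mxrow_mxcol.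
rewrite exchange_big/=; apply: eq_bigr => l _.
rewrite mulmx_suml; apply: eq_bigr => k _.
by rewrite tr_scalar_mx mul_scalar_mx -scalemxAl mul_mx_scalar scalerA.
Qed.

End kernel.

(** * Iterated integrals and their transposes *)

Section volterra.
Context (R : realType).
Local Notation leb := (@lebesgue_measure R).
Local Notation mR := (measurableTypeR R).
Implicit Types (a b : R) (f g : R -> R).

Lemma measurable_cc a b : measurable (`[a, b]%classic : set mR).
Proof. exact: measurable_itv. Qed.

Lemma leb_cc_fin a b : (leb `[a, b] < +oo)%E.
Proof. by rewrite lebesgue_measure_itv/=; case: ifP => // _; rewrite -EFinB ltry. Qed.

Lemma fine_leb_cc a b : a <= b -> fine (leb `[a, b]) = b - a.
Proof.
move=> ab; rewrite lebesgue_measure_itv/= lte_fin; case: ltP => // ba /=.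
by apply/esym/eqP; rewrite subr_eq0 eq_le ab ba.
Qed.

(** By Cauchy's formula, the (m + 1)-fold iterated integral of [f] from [a]. Its transpose [covol]
    is the iterated integral towards the right endpoint [b]. *)
Definition vol m a f s : R := \int[leb]_(t in `[a, s]) (mono m (s - t) * f t).

Definition covol m b g t : R := \int[leb]_(s in `[t, b]) (mono m (s - t) * g s).

Lemma rint_sub a b s t f : leb.-integrable `[a, b] (EFin \o f) -> a <= s -> t <= b ->
  leb.-integrable `[s, t] (EFin \o f).
Proof.
move=> rf sa tb; apply: integrableS rf; [exact: measurable_cc|exact: measurable_cc|].
by move=> x /=; rewrite !in_itv/= => /andP[sx xt]; rewrite (le_trans sa sx) (le_trans xt tb).
Qed.

Lemma rint_smooth a b f g : leb.-integrable `[a, b] (EFin \o f) -> smooth1 g ->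
  leb.-integrable `[a, b] (EFin \o (fun t => g t * f t)).
Proof.
move=> rf sg.
have [M hM] : exists M, forall x, `[a, b]%classic x -> `|g x| <= M.
  have : compact (g @` `[a, b]).
    apply: continuous_compact; last exact: segment_compact.
    exact: smooth1_within.
  move=> /compact_bounded[M [_ hM]]; exists (`|M| + 1) => x abx.
  by apply: hM; [rewrite (le_lt_trans (ler_norm _))// ltrDl|exists x].
apply: (rint_eq (measurable_cc a b) _ (rintM (measurable_cc a b) rf _ hM)).
  by move=> x _; rewrite mulrC.
by apply: smooth1_measurable => //; exact: measurable_cc.
Qed.

Lemma smooth1_mono_subr m (s : R) : smooth1 (fun t : R => mono m (s - t)).
Proof.
have -> : (fun t : R => mono m (s - t)) = (fun t => mono m (-1 * t + s)).
  by apply/funext => t; rewrite mulN1r addrC.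
exact/smooth1_affine/smooth1_mono.
Qed.

Lemma smooth1_mono_subl m (t : R) : smooth1 (fun s : R => mono m (s - t)).
Proof.
have -> : (fun s : R => mono m (s - t)) = (fun s => mono m (1 * s + - t)).
  by apply/funext => s; rewrite mul1r.
exact/smooth1_affine/smooth1_mono.
Qed.

(** Expanding the power of s - t separates s from the integrand, so continuity in s reduces to that
    of integrals with a variable upper bound. *)
Lemma volE m a b f s : leb.-integrable `[a, b] (EFin \o f) -> s <= b ->
  vol m a f s = \sum_(i < m.+1) mono (m - i) s *
    \int[leb]_(t in `[a, s]) (mono i (- t) * f t).
Proof.
move=> rf sb; have rs := rint_sub rf (lexx a) sb.
have ri i : leb.-integrable `[a, s] (EFin \o (fun t => mono i (- t) * f t)).
  have h := rint_smooth rs (@smooth1_mono_subr i 0).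
  by apply: rint_eq h; [exact: measurable_cc|move=> t _; rewrite sub0r].
rewrite /vol (Rint_eq leb (g := fun t => \sum_(i < m.+1) mono (m - i) s * (mono i (- t) * f t))); last first.
  by move=> t _; rewrite monoD mulr_suml; apply: eq_bigr => i _; rewrite mulrA.
rewrite (Rint_sum (measurable_cc a s)); last first.
  by move=> i; apply: rintZ => //; exact: measurable_cc.
by apply: eq_bigr => i _; rewrite RintegralZl//; exact: measurable_cc.
Qed.

Lemma within_continuous_sum (I : Type) (r : seq I) (D : set R) (F : I -> R -> R) :
  (forall i, {within D, continuous (F i)}) ->
  {within D, continuous (fun x => \sum_(i <- r) F i x)}.
Proof.
move=> cF; elim: r => [|i r IH].
  have -> : (fun x => \sum_(i <- [::]) F i x) = (fun=> 0).
    by apply/funext => x; rewrite big_nil.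
  by move=> x; exact: cvg_cst.
have -> : (fun x => \sum_(j <- i :: r) F j x) = (fun x => F i x + \sum_(j <- r) F j x).
  by apply/funext => x; rewrite big_cons.
by move=> x; apply: cvgD; [exact: cF|exact: IH].
Qed.

Lemma vol_continuous m a b f : a <= b -> leb.-integrable `[a, b] (EFin \o f) ->
  {within `[a, b], continuous (vol m a f)}.
Proof.
move=> ab rf.
apply: (@subspace_eq_continuous _ _ _ (fun s => \sum_(i < m.+1) mono (m - i) s *
    \int[leb]_(t in `[a, s]) (mono i (- t) * f t))).
  by move=> s; rewrite inE/= in_itv/= => /andP[_ sb]; exact: (esym (volE m rf sb)).
apply: within_continuous_sum => i x; apply: cvgM.
  by apply: smooth1_within; exact: smooth1_mono.
apply: (parameterized_integral_continuous ab).
have h := rint_smooth rf (@smooth1_mono_subr i 0).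
by apply: rint_eq h; [exact: measurable_cc|move=> t _; rewrite sub0r].
Qed.

(** The triangle t <= s is encoded by an indicator of s - t, so that both orders of integration take
    place on the same square and Fubini applies. *)
Lemma Rint_le_indic a b s h : s <= b ->
  \int[leb]_(t in `[a, b]) (\1_(`[0, +oo[%classic) (s - t) * h t) =
  \int[leb]_(t in `[a, s]) h t.
Proof.
move=> sb; rewrite [LHS]Rintegral_mkcond [RHS]Rintegral_mkcond; apply: Rint_eq => t _.
rewrite !patchE !mem_setE indicE mem_setE !in_itv/= andbT subr_ge0.
have [st|ts] := leP t s; last by rewrite andbF mul0r; case: ifP.
by rewrite mul1r (le_trans st sb) !andbT.
Qed.

Lemma Rint_ge_indic a b t h : a <= t ->
  \int[leb]_(s in `[a, b]) (\1_(`[0, +oo[%classic) (s - t) * h s) =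
  \int[leb]_(s in `[t, b]) h s.
Proof.
move=> at_; rewrite [LHS]Rintegral_mkcond [RHS]Rintegral_mkcond; apply: Rint_eq => s _.
rewrite !patchE !mem_setE indicE mem_setE !in_itv/= andbT subr_ge0.
have [ts|st] := leP t s; last by rewrite mul0r; case: ifP.
by rewrite mul1r (le_trans at_ ts).
Qed.

Section rectangle.
Context (a b : R).
Let I := `[a, b]%classic : set mR.

Lemma measurable_fun_fst (g : R -> R) : measurable_fun I g ->
  measurable_fun (I `*` I) (fun p : mR * mR => g p.1).
Proof.
move=> mg; have := @measurable_fun_preimage _ _ _ _ _ _ (@fst mR mR) I g measurable_fst (measurable_cc a b) mg.
by apply: measurable_funS => //; [rewrite -[X in measurable X]setTI; apply: measurable_fst => //; exact: measurable_cc|move=> p []].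
Qed.

Lemma measurable_fun_snd (g : R -> R) : measurable_fun I g ->
  measurable_fun (I `*` I) (fun p : mR * mR => g p.2).
Proof.
move=> mg; have := @measurable_fun_preimage _ _ _ _ _ _ (@snd mR mR) I g measurable_snd (measurable_cc a b) mg.
by apply: measurable_funS => //; [rewrite -[X in measurable X]setTI; apply: measurable_snd => //; exact: measurable_cc|move=> p []].
Qed.

Lemma measurable_fun_sub (g : R -> R) : measurable_fun setT g ->
  measurable_fun (I `*` I) (fun p : mR * mR => g (p.1 - p.2)).
Proof.
move=> mg; apply: (@measurableT_comp _ _ _ _ _ _ g) => //.
by apply: measurable_funB; [apply: (measurable_fun_fst (g := id))|apply: (measurable_fun_snd (g := id))].
Qed.

Section adjoint.
Variables (m : nat) (f g : R -> R) (M : R).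
Hypotheses (rf : leb.-integrable I (EFin \o f)) (mg : measurable_fun I g)
  (gM : forall x, I x -> `|g x| <= M).

Let F := fun p : mR * mR => f p.2 * (\1_(`[0, +oo[%classic) (p.1 - p.2) * mono m (p.1 - p.2) * g p.1).

Let mI : measurable I. Proof. exact: measurable_cc. Qed.

Lemma volterra_kernel_integrable : (leb \x leb)%E.-integrable (I `*` I) (EFin \o F).
Proof.
apply: (rintM (M := (b - a) ^+ m * M) _ (rint_snd mI mI (leb_cc_fin a b) rf)); first exact: measurableX.
  apply: measurable_funM; last exact: measurable_fun_fst.
  apply: measurable_funM; apply: measurable_fun_sub; first exact: measurable_indic.
  by apply: smooth1_measurable => //; exact: smooth1_mono.
move=> [s t] [/=]; rewrite /I/= !in_itv/= => sI tI.
have bam : 0 <= (b - a) ^+ m by rewrite exprn_ge0// subr_ge0; case/andP: sI => ?; exact: le_trans.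
rewrite normrM ler_pM//; last by apply: gM; rewrite /I/= in_itv/=.
rewrite normrM -[leRHS]mul1r ler_pM//; first by rewrite indicE; case: (_ \in _); rewrite ?normr1 ?normr0.
apply: mono_norm; rewrite ler_norml; apply/andP; split; lra.
Qed.

Lemma vol_adjoint :
  \int[leb]_(s in I) (vol m a f s * g s) = \int[leb]_(t in I) (f t * covol m b g t).
Proof.
rewrite (Rint_eq leb (g := fun s => \int[leb]_(t in I) F (s, t))); last first.
  move=> s; rewrite /I/= in_itv/= => /andP[as_ sb].
  have rs := rint_sub rf (lexx a) sb.
  rewrite -RintegralZr; [|exact: measurable_cc|exact: rint_smooth rs (@smooth1_mono_subr m s)].
  rewrite -(Rint_le_indic _ _ sb); apply: Rint_eq => t _; rewrite /F/=; ring.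
rewrite (Rfubini_swap mI mI volterra_kernel_integrable); apply: Rint_eq => t; rewrite /I/= in_itv/= => /andP[at_ tb].
have rt : leb.-integrable `[t, b] (EFin \o g).
  apply: rint_sub at_ (lexx b); apply: measurable_bounded_integrable => //; first exact: leb_cc_fin.
  exact: (bounded_in gM).
rewrite /covol -RintegralZl; [|exact: measurable_cc|exact: rint_smooth rt (@smooth1_mono_subl m t)].
rewrite -(Rint_ge_indic _ _ at_); apply: Rint_eq => s _; rewrite /F/=; ring.
Qed.

End adjoint.

Lemma rint_bounded g M : measurable_fun I g -> (forall x, I x -> `|g x| <= M) ->
  leb.-integrable I (EFin \o g).
Proof.
move=> mg gM; apply: measurable_bounded_integrable => //; [exact: measurable_cc|exact: leb_cc_fin|].
exact: (bounded_in gM).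
Qed.

Lemma covol_bound m g M t : measurable_fun I g -> (forall x, I x -> `|g x| <= M) -> I t ->
  `|covol m b g t| <= (b - a) ^+ m.+1 * M.
Proof.
move=> mg gM; rewrite /I/= in_itv/= => /andP[at_ tb].
have rt : leb.-integrable `[t, b] (EFin \o g) by exact: rint_sub (rint_bounded mg gM) at_ (lexx b).
have M0 : 0 <= M by apply: le_trans (normr_ge0 _) (gM b _); rewrite /I/= in_itv/= lexx (le_trans at_ tb).
have ab0 : 0 <= b - a by rewrite subr_ge0 (le_trans at_ tb).
have := @Rint_norm_le _ _ _ leb _ (measurable_cc t b) _ ((b - a) ^+ m * M)
  (rint_smooth rt (@smooth1_mono_subl m t)) (leb_cc_fin t b).
move=> h; apply: le_trans (h _) _.
  move=> x /=; rewrite in_itv/= => /andP[tx xb].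
  rewrite normrM ler_pM//; last by apply: gM; rewrite /I/= in_itv/= (le_trans at_ tx).
  apply: mono_norm; rewrite ler_norml; apply/andP; split; lra.
rewrite fine_leb_cc// exprSr mulrAC ler_wpM2r// ler_wpM2l ?exprn_ge0//; lra.
Qed.

Lemma covol_measurable m g M : measurable_fun I g -> (forall x, I x -> `|g x| <= M) ->
  measurable_fun I (covol m b g).
Proof.
move=> mg gM; have mI := measurable_cc a b.
have r1 : leb.-integrable I (EFin \o (fun=> 1 : R)).
  by apply: (@rint_bounded _ 1); [exact: measurable_cst|move=> x _; rewrite normr1].
pose F (p : mR * mR) : R := (\1_(`[0, +oo[%classic) (p.1 - p.2) * mono m (p.1 - p.2) * g p.1).
have rF : (leb \x leb)%E.-integrable (I `*` I) (EFin \o F).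
  have := volterra_kernel_integrable m r1 mg gM; apply: rint_eq; first exact: measurableX.
  by move=> p _; rewrite mul1r.
have := rint_measurable (rint_fubini2 mI mI rF).
apply: eq_measurable_fun => t; rewrite inE /I/= in_itv/= => /andP[at_ tb].
rewrite /covol -(Rint_ge_indic _ _ at_); by apply: Rint_eq => s _; rewrite /F -mulrA.
Qed.

Lemma vol_bound m f s : leb.-integrable I (EFin \o f) -> I s ->
  `|vol m a f s| <= (b - a) ^+ m * \int[leb]_(t in I) `|f t|.
Proof.
move=> rf; rewrite /I/= in_itv/= => /andP[as_ sb].
have rs := rint_sub rf (lexx a) sb.
have rv := rint_smooth rs (@smooth1_mono_subr m s).
apply: le_trans (le_normr_Rintegral (measurable_cc a s) rv) _.
have rn : leb.-integrable `[a, s] (EFin \o (fun t => `|f t|)) by exact: integrable_norm.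
have rnI : leb.-integrable `[a, b] (EFin \o (fun t => `|f t|)) by exact: integrable_norm.
apply: (@le_trans _ _ ((b - a) ^+ m * \int[leb]_(t in `[a, s]) `|f t|)).
  rewrite -RintegralZl//.
  apply: le_Rintegral; [exact: measurable_cc|exact: integrable_norm|apply: rintZ => //; exact: measurable_cc|].
  move=> t /=; rewrite in_itv/= => /andP[at_ ts]; rewrite normrM ler_wpM2r//.
  apply: mono_norm; rewrite ler_norml; apply/andP; split; lra.
apply: ler_wpM2l; first by rewrite exprn_ge0// subr_ge0 (le_trans as_ sb).
rewrite /Rintegral fine_le//.
- exact: (integrable_fin_num (measurable_cc a s) rn).
- exact: (integrable_fin_num (measurable_cc a b) rnI).
apply: ge0_subset_integral => //.
- exact: measurable_int _ rnI.
- by move=> x /=; rewrite !in_itv/= => /andP[-> xs]; rewrite (le_trans xs sb).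
Qed.

End rectangle.

(** Integration by parts: the boundary term at b vanishes with g, the one at t because [mono m.+1]
    vanishes at 0. The case t = b is separate, the interval being a point. *)
Lemma covol_derive m b g t : t <= b -> smooth1 g -> g b = 0 ->
  covol m.+1 b (derive1 g) t = - covol m b g t.
Proof.
rewrite le_eqVlt => /predU1P[->|tb] sg gb.
  by rewrite /covol set_itv1 !Rintegral_set1 oppr0.
rewrite /covol.
have := smooth_by_parts tb (@smooth1_mono_subl m.+1 t) sg.
rewrite gb mulr0 subrr mono_at0 mul0r subrr sub0r => ->.
congr (- _); apply: Rint_eq => s _; congr (_ * _).
have ds : is_derive (s : R) 1 (fun s : R => s - t) 1.
  have [d1 e1] := is_deriveB (is_derive_id (s : R) 1) (is_derive_cst t (s : R) 1).
  by apply: DeriveDef; [exact: d1|rewrite [LHS]e1 subr0].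
have := @is_derive1_comp R (mono m.+1) (fun s => s - t) s _ _ (is_derive_mono m (s - t)) ds.
by rewrite mulr1 => h; have [_ ->] := is_derive1E h.
Qed.

(** At order 0 the kernel is 1 and the boundary term at t survives; this is how the last of d
    integrations by parts gives back the function itself. *)
Lemma covol0_derive b g t : t <= b -> smooth1 g -> g b = 0 ->
  covol 0 b (derive1 g) t = - g t.
Proof.
rewrite le_eqVlt => /predU1P[->|tb] sg gb.
  by rewrite /covol set_itv1 !Rintegral_set1 gb oppr0.
rewrite /covol.
have := smooth_by_parts tb (@smooth1_cst R 1) sg.
rewrite gb mulr0 mul1r sub0r.
have -> : \int[leb]_(x in `[t, b]) (derive1 (fun=> 1 : R) x * g x) = 0.
  rewrite (Rint_eq leb (g := fun=> 0)) ?Rintegral_cst ?mul0r//.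
  by move=> x _; rewrite derive1_cst mul0r.
rewrite subr0 => <-; apply: Rint_eq => s _; by rewrite mono0.
Qed.

End volterra.

Lemma cvg_mx (R : realType) (m n : nat) (T : Type) (F : set_system T) {FF : Filter F}
    (f : T -> 'M[R]_(m, n)) (l : 'M[R]_(m, n)) :
  (forall i j, f x i j @[x --> F] --> l i j) -> f x @[x --> F] --> l.
Proof.
move=> h; apply/cvgrPdist_le => /= e e0; near=> x.
rewrite /Num.Def.normr/= mx_normrE (bigmax_le _ (ltW e0))//= => i _.
rewrite !mxE/=; move: i; near: x; apply: filter_forall => /= i.
exact: ((cvgrPdist_le _ _).1 (h i.1 i.2)).
Unshelve. all: by end_near. Qed.

Lemma cvg_mx_entry (R : realType) (m n : nat) (T : Type) (F : set_system T) {FF : Filter F}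
    (f : T -> 'M[R]_(m, n)) (l : 'M[R]_(m, n)) i j :
  f x @[x --> F] --> l -> f x i j @[x --> F] --> l i j.
Proof.
move=> h; apply: (@cvg_comp _ _ _ f (fun M : 'M[R]_(m, n) => M i j) F _ _ h).
exact: coord_continuous.
Qed.

Lemma ae_forall_ord (d : measure_display) (T : measurableType d) (R : realType)
    (mu : {measure set T -> \bar R}) n (P : 'I_n -> T -> Prop) :
  (forall i, {ae mu, forall x, P i x}) -> {ae mu, forall x, forall i, P i x}.
Proof. by move=> h; apply: filter_forall. Qed.

Lemma ae_eq_colP (d : measure_display) (T : measurableType d) (R : realType)
    (mu : {measure set T -> \bar R}) (D : set T) n (u v : T -> 'cV[R]_n) : ae_eq mu D u v <->
  forall c, ae_eq mu D (fun s => u s c 0) (fun s => v s c 0).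
Proof.
split => [h c|h].
  by apply: filterS h => s h Ds; rewrite h.
have := ae_forall_ord h; apply: filterS => s h' Ds.
by apply/matrixP => c k; rewrite ord1; exact: h'.
Qed.

Lemma sign_neq0 (R : realType) k : (-1) ^+ k != 0 :> R.
Proof. by rewrite expf_neq0// oppr_eq0 oner_eq0. Qed.

(** * The operators on one line, their transposes and their inversion *)

Section operator1.
Context (R : realType) (n d : nat).
Variables (a b : R) (B C : 'I_d -> 'I_d -> 'M[R]_n).
Hypothesis ab : a < b.
Local Notation leb := (@lebesgue_measure R).
Local Notation mR := (measurableTypeR R).
Local Notation I := (`[a, b]%classic : set mR).
Local Notation Kb := (Kb a b B C).
Implicit Types (w : R -> 'cV[R]_n) (f g : R -> R).

Definition L1 w := forall c, leb.-integrable I (EFin \o (fun t => w t c 0)).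

(** Written with the same formula as [opA], so that restriction to a line is an equality of
    functions ([opA_ins]). *)
Definition opA1 (j : nat) w : R -> 'cV[R]_n := fun s =>
  if (j < d)%N then
    \col_k (
      \int[leb]_(theta in `[a, s])
        ((s - theta) ^+ (d - 1 - j) / (d - 1 - j)`!%:R * w theta k 0)
    - \int[leb]_(theta in `[a, b])
        (((derive1n j (@E1 R n d) (s - a))^T *m K a b B C
           *m @Ed R n d (b - theta) *m w theta) k 0))
  else w s.

Definition eps (l : nat) (t : R) : R := mono (d - 1 - l) (b - t).

(** Derivatives at [b], of orders l < d, of the d-fold integral of [w] from [a]; the boundary
    conditions involve [w] only through them. *)
Definition mom w (l : 'I_d) : 'cV[R]_n :=
  \col_c \int[leb]_(t in I) (eps l t * w t c 0).

(** Up to sign, the derivatives at [a] of the function reconstructed from [w] ([opA1_at_a]). *)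
Definition kmom w (k : 'I_d) : 'cV[R]_n := \sum_(l < d) Kb k l *m mom w l.

Lemma smooth1_eps l : smooth1 (eps l).
Proof. exact: smooth1_mono_subr. Qed.

Lemma opA1E j w s c : (j < d)%N -> L1 w ->
  opA1 j w s c 0 = vol (d - 1 - j) a (fun t => w t c 0) s
    - \sum_(k < d) emono j k (s - a) * kmom w k c 0.
Proof.
move=> jd rw; rewrite /opA1 jd mxE /vol; congr (_ - _).
have mI := measurable_cc a b.
rewrite (Rint_eq leb (g := fun t => \sum_(k < d) \sum_(l < d) \sum_(c' < n)
    (emono j k (s - a) * Kb k l c c') * (eps l t * w t c' 0))); last first.
  move=> t _; rewrite kernelE mulmx_suml summxE; apply: eq_bigr => k _.
  rewrite mulmx_suml summxE; apply: eq_bigr => l _.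
  rewrite mxE; apply: eq_bigr => c' _; rewrite !mxE /eps; ring.
have r0 (l : 'I_d) c' : leb.-integrable I (EFin \o (fun t => eps l t * w t c' 0)).
  by apply: rint_smooth (rw c') _; exact: smooth1_eps.
have r1 x (l : 'I_d) c' : leb.-integrable I (EFin \o (fun t => x * (eps l t * w t c' 0))).
  exact: rintZ.
rewrite (Rint_sum mI); last by move=> k; apply: rint_sum => // l; exact: rint_sum.
apply: eq_bigr => k _; rewrite (Rint_sum mI); last by move=> l; exact: rint_sum.
rewrite /kmom summxE mulr_sumr; apply: eq_bigr => l _.
rewrite (Rint_sum mI)// mxE mulr_sumr; apply: eq_bigr => c' _.
by rewrite RintegralZl// [mom w l c' 0]mxE mulrA.
Qed.

(* The transpose of opA1 acting on scalar functions, as a matrix of functions. *)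
Definition adj (j : nat) f (t : R) : 'M[R]_n :=
  if (j < d)%N then
    (covol (d - 1 - j) b f t)%:M
    - \sum_(k < d) \sum_(l < d)
        (\int[leb]_(s in I) (emono j k (s - a) * f s) * eps l t) *: Kb k l
  else (f t)%:M.

Lemma smooth1_emono_sub j k : smooth1 (fun s : R => emono j k (s - a)).
Proof.
have -> : (fun s : R => emono j k (s - a)) = (fun s => emono j k (1 * s + - a)).
  by apply/funext => s; rewrite mul1r.
exact/smooth1_affine/smooth1_emono.
Qed.

(** The iterated integral is transposed by Fubini on a triangle, the finite-rank part by exchanging
    its two families of moments. Taking [f] bounded measurable lets the formula be applied again to
    a function that is already a transpose. *)
Lemma opA1_adjoint j w f (M : R) c : L1 w -> measurable_fun I f ->
  (forall x, I x -> `|f x| <= M) ->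
  \int[leb]_(s in I) (opA1 j w s c 0 * f s) =
  \int[leb]_(t in I) ((adj j f t *m w t) c 0).
Proof.
move=> rw mf fM; have mI := measurable_cc a b.
case: (ltnP j d) => jd; last first.
  apply: Rint_eq => s _; rewrite /opA1 /adj ltnNge jd/= mul_scalar_mx mxE; exact: mulrC.
have rf : leb.-integrable I (EFin \o f) by exact: rint_bounded mf fM.
have r0 (l : 'I_d) c' : leb.-integrable I (EFin \o (fun t => eps l t * w t c' 0)).
  by apply: rint_smooth (rw c') _; exact: smooth1_eps.
have rv : leb.-integrable I (EFin \o (fun s => vol (d - 1 - j) a (fun t => w t c 0) s * f s)).
  apply: (rintM mI _ mf fM); apply: within_continuous_rint.
  by apply: vol_continuous (rw c); exact: ltW.
have rem k : leb.-integrable I (EFin \o (fun s => emono j k (s - a) * f s)).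
  by apply: rint_smooth rf _; exact: smooth1_emono_sub.
rewrite (Rint_eq leb (g := fun s => vol (d - 1 - j) a (fun t => w t c 0) s * f s -
   \sum_(k < d) kmom w k c 0 * (emono j k (s - a) * f s))); last first.
  move=> s _; rewrite opA1E// mulrBl mulr_suml; congr (_ - _).
  by apply: eq_bigr => k _; ring.
have rek k : leb.-integrable I (EFin \o (fun s => kmom w k c 0 * (emono j k (s - a) * f s))).
  exact: rintZ.
rewrite RintegralB//; last exact: rint_sum.
rewrite (vol_adjoint _ (rw c) mf fM) (Rint_sum mI)//.
rewrite (Rint_eq leb (f := fun t => (adj j f t *m w t) c 0)
  (g := fun t => w t c 0 * covol (d - 1 - j) b f t -
   \sum_(k < d) \sum_(l < d) \sum_(c' < n)
   (\int[leb]_(s in I) (emono j k (s - a) * f s) * Kb k l c c') * (eps l t * w t c' 0))); last first.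
  move=> t _; rewrite /adj jd mulmxBl mxE mul_scalar_mx mxE [X in X + _]mulrC; congr (_ + _).
  rewrite mxE; congr (- _); rewrite mulmx_suml summxE; apply: eq_bigr => k _.
  rewrite mulmx_suml summxE; apply: eq_bigr => l _.
  rewrite mxE; apply: eq_bigr => c' _; rewrite !mxE; ring.
have rs (k : 'I_d) : leb.-integrable I (EFin \o (fun t => \sum_(l < d) \sum_(c' < n)
   (\int[leb]_(s in I) (emono j k (s - a) * f s) * Kb k l c c') * (eps l t * w t c' 0))).
  by apply: rint_sum => // l; apply: rint_sum => // c'; exact: rintZ.
rewrite RintegralB//; last 2 first.
- apply: (rintM mI (rw c) (covol_measurable _ mf fM)) => t It.
  exact: covol_bound mf fM It.
- exact: rint_sum.
congr (_ - _); rewrite (Rint_sum mI)//; apply: eq_bigr => k _.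
rewrite RintegralZl// /kmom summxE mulr_suml (Rint_sum mI); last first.
  by move=> l; apply: rint_sum => // c'; exact: rintZ.
apply: eq_bigr => l _; rewrite mxE mulr_suml (Rint_sum mI); last by move=> c'; exact: rintZ.
by apply: eq_bigr => c' _; rewrite RintegralZl// [mom w l c' 0]mxE; ring.
Qed.

Lemma adj_measurable j f (M : R) p q : measurable_fun I f -> (forall x, I x -> `|f x| <= M) ->
  measurable_fun I (fun t => adj j f t p q).
Proof.
move=> mf fM; have [jd|jd] := ltnP j d; last first.
  apply: (@eq_measurable_fun _ _ _ _ _ (fun t => (p == q)%:R * f t)).
    by move=> t _; rewrite /adj ltnNge jd !mxE mulr_natl.
  by apply: measurable_funM => //; exact: measurable_cst.
have mc := covol_measurable (d - 1 - j) mf fM.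
apply: (@eq_measurable_fun _ _ _ _ _ (fun t => (p == q)%:R * covol (d - 1 - j) b f t
   - \sum_(k < d) \sum_(l < d)
        (\int[leb]_(s in I) (emono j k (s - a) * f s) * Kb k l p q) * eps l t)).
  move=> t _; rewrite /adj jd !mxE mulr_natl; congr (_ - _); rewrite summxE; apply: eq_bigr => k _.
  rewrite summxE; apply: eq_bigr => l _; rewrite !mxE; ring.
apply: measurable_funB; first by apply: measurable_funM => //; exact: measurable_cst.
apply: measurable_sum => k; apply: measurable_sum => l; apply: measurable_funM.
  exact: measurable_cst.
by apply: smooth1_measurable; [exact: measurable_cc|exact: smooth1_eps].
Qed.

Lemma adj_bounded j (M : R) : exists2 M' : R, 0 <= M' & forall f, measurable_fun I f ->
  (forall x, I x -> `|f x| <= M) -> forall t p q, I t -> `|adj j f t p q| <= M'.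
Proof.
have mI := measurable_cc a b.
have [jd|jd] := ltnP j d; last first.
  exists `|M| => // f mf fM t p q It; rewrite /adj ltnNge jd/= !mxE.
  have := le_trans (fM t It) (ler_norm M).
  by case: (p == q); rewrite ?mulr1n ?mulr0n ?normr0.
have ab0 : 0 <= b - a by rewrite subr_ge0 ltW.
pose c := b - a.
pose S p q := \sum_(k < d) \sum_(l < d) (c ^+ (k - j) * `|M| * c * c ^+ (d - 1 - l)) * `|Kb k l p q|.
have S0 p q : 0 <= S p q.
  by apply: sumr_ge0 => k _; apply: sumr_ge0 => l _; rewrite !mulr_ge0 ?exprn_ge0.
exists (c ^+ (d - 1 - j).+1 * `|M| + \sum_p \sum_q S p q).
  rewrite addr_ge0 ?mulr_ge0 ?exprn_ge0//.
  by apply: sumr_ge0 => p _; apply: sumr_ge0.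
move=> f mf fM t p q It.
have fM' x : I x -> `|f x| <= `|M| by move=> Ix; apply: le_trans (fM x Ix) (ler_norm M).
have rf : leb.-integrable I (EFin \o f) by exact: rint_bounded mf fM'.
rewrite /adj jd [X in `|X|]mxE [X in _ + X]mxE.
apply: le_trans (ler_normB _ _) _; apply: lerD.
  have := covol_bound (d - 1 - j) mf fM' It.
  rewrite mxE; case: (p == q); rewrite ?mulr1n ?mulr0n ?normr0// => _.
  by rewrite mulr_ge0 ?exprn_ge0.
apply: (@le_trans _ _ (S p q)); last first.
  rewrite (bigD1 p)//= (bigD1 q)//= -!addrA lerDl addr_ge0//.
    by apply: sumr_ge0.
  by apply: sumr_ge0 => p' _; apply: sumr_ge0.
rewrite summxE; apply: le_trans (ler_norm_sum _ _ _) _; apply: ler_sum => k _.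
rewrite summxE; apply: le_trans (ler_norm_sum _ _ _) _; apply: ler_sum => l _.
rewrite mxE normrM ler_wpM2r// normrM ler_pM//.
  rewrite -mulrA -[X in _ * (_ * X)](fine_leb_cc (ltW ab)) mulrA.
  apply: Rint_norm_le => //; last 1 first.
  - move=> x Ix; rewrite normrM ler_pM//; last exact: fM'.
    rewrite /emono; case: ifP => _; last by rewrite normr0 exprn_ge0.
    apply: mono_norm; move: Ix; rewrite /= in_itv/= => /andP[? ?].
    by rewrite /c ler_norml; apply/andP; split; lra.
  - by apply: rint_smooth rf _; exact: smooth1_emono_sub.
  - exact: leb_cc_fin.
apply: mono_norm; move: It; rewrite /= in_itv/= => /andP[? ?].
by rewrite /c ler_norml; apply/andP; split; lra.
Qed.

Lemma rint_adj j w f (M : R) c : L1 w -> measurable_fun I f ->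
  (forall x, I x -> `|f x| <= M) ->
  leb.-integrable I (EFin \o (fun t => (adj j f t *m w t) c 0)).
Proof.
move=> rw mf fM; have mI := measurable_cc a b.
have [M' M'0 hM'] := adj_bounded j M.
have h c' : leb.-integrable I (EFin \o (fun t => w t c' 0 * adj j f t c c')).
  by apply: rintM (rw c') (adj_measurable j c c' mf fM) (fun t It => hM' f mf fM t c c' It).
apply: rint_eq (rint_sum mI (index_enum 'I_n) h) => // t _.
by rewrite mxE; apply: eq_bigr => c' _; rewrite mulrC.
Qed.

Lemma emono_by_parts i k f : test_function1 a b f ->
  \int[leb]_(s in I) (emono i k (s - a) * derive1 f s) =
  - \int[leb]_(s in I) (emono i.+1 k (s - a) * f s).
Proof.
move=> tf; have [sf _] := tf.
have fa : f a = 0 by apply: (test0 tf); rewrite ltxx.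
have fb : f b = 0 by apply: (test0 tf); rewrite ltxx andbF.
rewrite (smooth_by_parts ab (@smooth1_emono_sub i k) sf) fa fb !mulr0 subrr sub0r; congr (- _).
apply: Rint_eq => s _; congr (_ * _).
have ds : is_derive (s : R) 1 (fun s : R => s - a) 1.
  have [d1 e1] := is_deriveB (is_derive_id (s : R) 1) (is_derive_cst a (s : R) 1).
  by apply: DeriveDef; [exact: d1|rewrite [LHS]e1 subr0].
have := @is_derive1_comp R (emono i k) (fun s => s - a) s _ _ (is_derive_emono i k (s - a)) ds.
by rewrite mulr1 => h; have [_ ->] := is_derive1E h.
Qed.

Lemma emono_test i j k f : test_function1 a b f ->
  \int[leb]_(s in I) (emono i k (s - a) * derive1n j f s) =
  (-1) ^+ j * \int[leb]_(s in I) (emono (i + j) k (s - a) * f s).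
Proof.
move=> tf; elim: j i => [|j IH] i; first by rewrite addn0 expr0 mul1r.
rewrite (derive1nS f j) emono_by_parts; last exact: test_derive1n.
by rewrite IH addSnnS exprS mulN1r mulNr.
Qed.

Lemma covol_test m j f t : (j <= m)%N -> test_function1 a b f -> t <= b ->
  covol m b (derive1n j f) t = (-1) ^+ j * covol (m - j) b f t.
Proof.
move=> + tf tb; elim: j m => [|j IH] m jm; first by rewrite subn0 expr0 mul1r.
case: m jm => // m; rewrite ltnS => jm.
have tfj := test_derive1n j tf.
rewrite (derive1nS f j) covol_derive//; last by apply: (test0 tfj); rewrite ltxx andbF.
  by rewrite IH// subSS exprS mulN1r mulNr.
by case: tfj.
Qed.

Lemma covol_testS m f t : test_function1 a b f -> t <= b ->
  covol m b (derive1n m.+1 f) t = (-1) ^+ m.+1 * f t.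
Proof.
move=> tf tb; rewrite derive1Sn covol_test//; last exact: test_derive1.
rewrite subnn covol0_derive//; first by rewrite exprSr mulrN1 mulNr mulrN.
  by case: tf.
by apply: (test0 tf); rewrite ltxx andbF.
Qed.

(** By j integrations by parts the order of [covol] drops from d - 1 to d - 1 - j and [emono 0]
    becomes [emono j], each step costing a sign. For j = d the last step leaves f itself, and the
    finite-rank part disappears because its polynomials have degree less than d. *)
Lemma adj_derive j f t : (j <= d)%N -> test_function1 a b f -> I t ->
  adj 0 (derive1n j f) t = (-1) ^+ j *: adj j f t.
Proof.
move=> jd tf; rewrite /= in_itv/= => /andP[at_ tb].
have [d0|d0] := posnP d.
  by move: jd; rewrite d0 leqn0 => /eqP ->; rewrite expr0 scale1r.
rewrite {1}/adj d0 subn0; move: jd; rewrite leq_eqVlt => /predU1P[jd|jd].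
  rewrite /adj jd ltnn big1 => [|k _]; last first.
    rewrite big1 => // l _; rewrite (emono_test 0 d k tf) add0n.
    rewrite (Rint_eq leb (g := fun=> 0)) ?Rintegral_cst ?mul0r ?mulr0 ?mul0r ?scale0r//.
    by move=> s _; rewrite /emono leqNgt ltn_ord mul0r.
  rewrite subr0 scale_scalar_mx; congr (_%:M); have := covol_testS (d - 1) tf tb.
  by have -> : (d - 1).+1 = d by rewrite subn1 prednK.
rewrite /adj jd scalerBr scale_scalar_mx covol_test//; last by rewrite subn1 -ltnS prednK.
congr (_ - _); rewrite scaler_sumr; apply: eq_bigr => k _.
rewrite scaler_sumr; apply: eq_bigr => l _.
rewrite (emono_test 0 j k tf) add0n scalerA; congr (_ *: _); ring.
Qed.

Lemma L2_L1 w : L2 leb I w -> L1 w.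
Proof.
move=> L2w c; have [mw rw] := L2w c; have mI := measurable_cc a b.
have r1 : leb.-integrable I (EFin \o (fun=> 1 : R)).
  by apply: (@rint_bounded _ _ _ _ 1); [exact: measurable_cst|move=> x _; rewrite normr1].
apply: (rint_le mI mw (rintD mI r1 rw)) => x _ /=.
have := sqr_ge0 (`|w x c 0| - 1); rewrite sqrrB1 real_normK ?num_real//.
by have := normr_ge0 (w x c 0); have := sqr_ge0 (w x c 0); set y := w x c 0; lra.
Qed.

Lemma weak_opA1 j w : L1 w -> (j <= d)%N -> weak_deriv1 a b j (opA1 0 w) (opA1 j w).
Proof.
move=> rw jd f tf c.
have tfj := test_derive1n j tf.
have [M _ fM] := test_bounded tf; have [M' _ fM'] := test_bounded tfj.
have [sf _] := tf; have [sfj _] := tfj.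
rewrite (opA1_adjoint 0 c rw (smooth1_measurable (measurable_cc a b) sfj) (fun x _ => fM' x)).
rewrite (opA1_adjoint j c rw (smooth1_measurable (measurable_cc a b) sf) (fun x _ => fM x)).
rewrite -RintegralZl; last 2 first.
- exact: measurable_cc.
- apply: rint_eq (rint_adj j c rw (smooth1_measurable (measurable_cc a b) sf) (fun x _ => fM x)) => //.
apply: Rint_eq => t It; rewrite (adj_derive jd tf It) -scalemxAl mxE//.
Qed.

Lemma opA1_continuous j w c : (j < d)%N -> L1 w ->
  {within I, continuous (fun s => opA1 j w s c 0)}.
Proof.
move=> jd rw.
apply: (@subspace_eq_continuous _ _ _ (fun s => vol (d - 1 - j) a (fun t => w t c 0) s
    - \sum_(k < d) emono j k (s - a) * kmom w k c 0)).
  by move=> s _; exact: (esym (opA1E s c jd rw)).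
move=> x; apply: cvgB; first exact: (vol_continuous (ltW ab) (rw c)).
apply: within_continuous_sum => k y; apply: cvgM; last exact: cvg_cst.
by apply: (@smooth1_within R a b (fun s => emono j k (s - a))); exact: smooth1_emono_sub.
Qed.

Lemma L2_opA1 j w : L2 leb I w -> L2 leb I (opA1 j w).
Proof.
move=> L2w; have [jd|jd] := ltnP j d; last first.
  by have -> : opA1 j w = w by apply/funext => s; rewrite /opA1 ltnNge jd.
move=> c; have cc := @opA1_continuous j w c jd (L2_L1 L2w).
split; first exact: subspace_continuous_measurable_fun.
by apply: within_continuous_rint => x; apply: cvgM; exact: cc.
Qed.

Lemma sum_emono0 (k : 'I_d) (y : 'I_d -> R) : \sum_(l < d) emono k l 0 * y l = y k.
Proof.
rewrite (bigD1 k)//= big1 ?addr0.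
  by rewrite /emono leqnn subnn mono0 mul1r.
move=> l lk; rewrite /emono mono_at0; case: ifP => kl; last by rewrite mul0r.
rewrite subn_eq0; case: leqP => [lk'|]; last by rewrite mul0r.
by move/negP: lk; case; apply/eqP/val_inj/eqP; rewrite eqn_leq lk' kl.
Qed.

Lemma opA1_at_a j w : L1 w -> forall (jd : (j < d)%N),
  opA1 j w a = - kmom w (Ordinal jd).
Proof.
move=> rw jd; apply/matrixP => c z; rewrite (ord1 z) opA1E// mxE.
rewrite /vol set_itv1 Rintegral_set1 sub0r subrr; congr (- _).
exact: (sum_emono0 (Ordinal jd) (fun l => kmom w l c 0)).
Qed.

Lemma opA1_at_b j w : L1 w -> forall (jd : (j < d)%N),
  opA1 j w b = mom w (Ordinal jd) - \sum_(k < d) emono j k (b - a) *: kmom w k.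
Proof.
move=> rw jd; apply/matrixP => c z; rewrite (ord1 z) opA1E// !mxE; congr (_ - _).
by rewrite summxE; apply: eq_bigr => k _; rewrite mxE.
Qed.

Hypothesis adm : admissible a b B C.

(** Taylor's formula in matrix form: Q(z) carries the derivatives of a polynomial of degree less
    than d at one point to those at the point shifted by z. *)
Lemma Q_mul (y : 'I_d -> 'cV[R]_n) (z : R) : @Q R n d z *m \mxcol_k y k =
  \mxcol_j \sum_(k < d) emono j k z *: y k.
Proof.
rewrite mul_mxblock_mxrow; apply: eq_mxcol => j; apply: eq_bigr => k _.
rewrite /emono; case: ifP => _; last by rewrite mul0mx scale0r.
by rewrite mul_scalar_mx.
Qed.

Lemma boundary_form (x y : 'I_d -> 'cV[R]_n) :
  (forall j, \sum_(k < d) (B j k *m x k + C j k *m y k) = 0) <->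
  Ha B *m \mxcol_k x k + Hb C *m \mxcol_k y k = 0.
Proof.
rewrite /Ha /Hb !mul_mxblock_mxrow -mxcolD.
have -> : \mxcol_j (\sum_j0 B j j0 *m x j0 + \sum_j0 C j j0 *m y j0) =
   \mxcol_j \sum_(k < d) (B j k *m x k + C j k *m y k).
  by apply: eq_mxcol => j; rewrite big_split.
split => [h|h j].
  by rewrite -[RHS](mxcol0 (p_ := fun _ : 'I_d => n)); apply: eq_mxcol => j; rewrite h.
have /mxcolP/(_ j) := h; rewrite mxcolK submxcol0//.
Qed.

(** With m the column of moments, the derivatives at a are -K m and those at b are m - Q K m. The
    boundary form is therefore Hb m - (Ha + Hb Q) K m, which is 0 by the definition of K. *)
Lemma opA1_boundary w : L1 w ->
  forall j : 'I_d, \sum_(k < d) (B j k *m opA1 k w a + C j k *m opA1 k w b) = 0.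
Proof.
move=> rw; apply/(boundary_form (fun k : 'I_d => opA1 k w a) (fun k : 'I_d => opA1 k w b)).
have KE : K a b B C *m \mxcol_k mom w k = \mxcol_k kmom w k.
  by rewrite -[K a b B C]submxblockK mul_mxblock_mxrow.
have -> : \mxcol_(k < d) opA1 k w a = - (K a b B C *m \mxcol_k mom w k).
  rewrite KE -mxcolN; apply: eq_mxcol => -[k kd]; exact: opA1_at_a.
have -> : \mxcol_(k < d) opA1 k w b = \mxcol_k mom w k - Q n d (b - a) *m (K a b B C *m \mxcol_k mom w k).
  rewrite KE Q_mul -mxcolB; apply: eq_mxcol => -[k kd]; exact: opA1_at_b.
set X := K a b B C *m _.
rewrite mulmxN mulmxBr [Hb C *m (_ *m X)]mulmxA addrCA -opprD -mulmxDl.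
by rewrite /X /K -mulmxA mulKVmx// subrr.
Qed.

Lemma univ_domain_opA1 w : L2 leb I w -> univ_domain a b B C (opA1 0 w).
Proof.
move=> L2w; have rw := L2_L1 L2w; split.
  split; first exact: L2_opA1.
  move=> k kd; exists (opA1 k w); first exact: L2_opA1.
  exact: weak_opA1.
exists (fun k : 'I_d => opA1 k w); split; last exact: opA1_boundary.
move=> k; split; last by apply: weak_opA1 => //; exact: ltnW.
move=> x; apply: cvg_mx => c z; rewrite (ord1 z).
exact: (@opA1_continuous k w c (ltn_ord k) rw).
Qed.

Lemma weak_deriv1_step k (u p q : R -> 'cV[R]_n) f c : weak_deriv1 a b k u p -> weak_deriv1 a b k.+1 u q ->
  test_function1 a b f ->
  \int[leb]_(x in I) (p x c 0 * derive1 f x) = - \int[leb]_(x in I) (q x c 0 * f x).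
Proof.
move=> hp hq tf; have := hp _ (test_derive1 tf) c; rewrite -derive1Sn (hq _ tf c).
rewrite exprS mulN1r mulNr => h; apply/(mulfI (sign_neq0 R k)) => /=.
by rewrite mulrN h.
Qed.

Lemma weak_deriv1_unique k u p q : L1 p -> L1 q -> weak_deriv1 a b k u p ->
  weak_deriv1 a b k u q -> ae_eq leb I p q.
Proof.
move=> rp rq hp hq; apply/ae_eq_colP => c; apply: fundamental1_eq => // o m.
set f := sbump _ _ _.
have tf : test_function1 a b f by apply: test_sbump => //; exact: lo_ge.
by apply/(mulfI (sign_neq0 R k)); rewrite -hp// -hq.
Qed.

(** The differences Z_k between the k-th derivative of u and A_k w form a chain of weak derivatives
    ending with Z_d = 0, so they are polynomials determined by their values at a. They satisfy the
    boundary conditions, and admissibility forces these values to vanish. *)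
Lemma opA1_inverse u w : univ_domain a b B C u -> L2 leb I w -> weak_deriv1 a b d u w ->
  ae_eq leb I u (opA1 0 w).
Proof.
move=> [[L2u _] [g [hg bc]]] L2w duw.
have rw := L2_L1 L2w; have ru := L2_L1 L2u; have mI := measurable_cc a b.
have u0 : weak_deriv1 a b 0 u u by move=> f tf c; rewrite expr0 mul1r.
(* For d = 0 there is no continuous representative to work with, and the claim is the uniqueness of
   the weak derivative of order 0. *)
have [d0|d0] := posnP d.
  rewrite d0 in duw.
  have -> : opA1 0 w = w.
    by apply/funext => s; rewrite /opA1; case: ifP => // h; exfalso; rewrite d0 in h.
  exact: weak_deriv1_unique u0 duw.
(* The continuous representatives, completed by w at order d so that the chain of derivatives has no
   special last step. *)
pose gn (k : nat) : R -> 'cV[R]_n := if insub k is Some i then g i else w.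
have gnE (k : 'I_d) : gn k = g k by rewrite /gn valK.
have gnd k : (d <= k)%N -> gn k = w by move=> dk; rewrite /gn insubN// -leqNgt.
have gnw k : (k <= d)%N -> weak_deriv1 a b k u (gn k).
  rewrite leq_eqVlt => /predU1P[->|kd]; first by rewrite gnd.
  by rewrite -[k]/(val (Ordinal kd)) gnE; have [_ hk] := hg (Ordinal kd); exact: hk.
have gnc k c : (k < d)%N -> {within I, continuous (fun s => gn k s c 0)}.
  move=> kd; rewrite -[k]/(val (Ordinal kd)) gnE; have [cg _] := hg (Ordinal kd).
  by move=> x; apply: cvg_mx_entry; exact: cg.
pose Z k s := gn k s - opA1 k w s.
have Zc k c : (k < d)%N -> {within I, continuous (fun s => Z k s c 0)}.
  move=> kd; have -> : (fun s => Z k s c 0) = (fun s => gn k s c 0 - opA1 k w s c 0).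
    by apply/funext => s; rewrite !mxE.
  by move=> x; apply: cvgB; [exact: gnc|exact: opA1_continuous].
have rgn k c : (k <= d)%N -> leb.-integrable I (EFin \o (fun s => gn k s c 0)).
  rewrite leq_eqVlt => /predU1P[->|kd]; first by rewrite gnd.
  by apply: within_continuous_rint; exact: gnc.
have rA k c : (k <= d)%N -> leb.-integrable I (EFin \o (fun s => opA1 k w s c 0)).
  by move=> kd; exact: (L2_L1 (L2_opA1 k L2w)).
have Zw k c f : (k < d)%N -> test_function1 a b f ->
    \int[leb]_(x in I) (Z k x c 0 * derive1 f x) = - \int[leb]_(x in I) (Z k.+1 x c 0 * f x).
  move=> kd tf; have tf' := test_derive1 tf.
  rewrite (Rint_eq leb (g := fun x => gn k x c 0 * derive1 f x - opA1 k w x c 0 * derive1 f x)); last first.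
    by move=> x _; rewrite !mxE mulrBl.
  rewrite (Rint_eq leb (f := fun x => Z k.+1 x c 0 * f x)
      (g := fun x => gn k.+1 x c 0 * f x - opA1 k.+1 w x c 0 * f x)); last first.
    by move=> x _; rewrite !mxE mulrBl.
  have kd' := ltnW kd.
  have rgt i h : (i <= d)%N -> test_function1 a b h ->
      leb.-integrable I (EFin \o (fun x => gn i x c 0 * h x)).
    by move=> id th; exact: (rint_test (rgn i c id) th).
  have rAt i h : (i <= d)%N -> test_function1 a b h ->
      leb.-integrable I (EFin \o (fun x => opA1 i w x c 0 * h x)).
    by move=> id th; exact: (rint_test (rA i c id) th).
  rewrite !RintegralB//; try exact: rgt; try exact: rAt.
  rewrite (weak_deriv1_step c (gnw k kd') (gnw _ kd) tf).
  by rewrite (weak_deriv1_step c (weak_opA1 rw kd') (weak_opA1 rw kd) tf) opprB opprK addrC.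
have Zd s : Z d s = 0 by rewrite /Z gnd// /opA1 ltnn subrr.
(* Downward induction on k = d - m, starting from Z_d = 0. *)
have ZE m : forall k, (k + m = d)%N -> forall s, I s ->
    Z k s = \sum_(l < d) emono k l (s - a) *: Z l a.
  elim: m => [|m IH] k kmd s Is.
    rewrite addn0 in kmd; rewrite kmd Zd big1// => l _.
    by rewrite /emono leqNgt ltn_ord scale0r.
  have kd : (k < d)%N by rewrite -kmd -[X in (X < _)%N]addn0 ltn_add2l.
  have {}IH := IH k.+1; rewrite addSnnS in IH; have {}IH := IH kmd.
  apply/matrixP => c z; rewrite (ord1 z) summxE.
  under eq_bigr do rewrite mxE.
  (* Difference between Z_k and its Taylor polynomial at a: its weak derivative vanishes by the
     induction hypothesis, so it is constant, and it is 0 at a. *)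
  pose h (s : R) := Z k s c 0 - \sum_(l < d) emono k l (s - a) * Z l a c 0.
  have hc : {within I, continuous h}.
    move=> x; apply: cvgB; first exact: Zc.
    apply: within_continuous_sum => l y; apply: cvgM; last exact: cvg_cst.
    by apply: (@smooth1_within R a b (fun s => emono k l (s - a))); exact: smooth1_emono_sub.
  have ha : h a = 0.
    rewrite /h subrr (sum_emono0 (Ordinal kd) (fun l => Z l a c 0)) subrr//.
  have rZ k' : (k' <= d)%N -> leb.-integrable I (EFin \o (fun s => Z k' s c 0)).
    move=> kd'; apply: (rint_eq mI _ (rintB mI (rgn k' c kd') (rA k' c kd'))).
    by move=> x _; rewrite !mxE.
  have rem i l : leb.-integrable I (EFin \o (fun s => emono i l (s - a))).
    by apply: within_continuous_rint; apply: smooth1_within; exact: smooth1_emono_sub.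
  suff hs : h s = h a by move: hs; rewrite ha /h => /eqP; rewrite subr_eq0 => /eqP.
  apply: (du_bois_reymond ab hc) => [f tf|]; last by move: Is; rewrite /= in_itv.
  have tf' := test_derive1 tf.
  rewrite (Rint_eq leb (g := fun x => Z k x c 0 * derive1 f x -
     \sum_(l < d) Z l a c 0 * (emono k l (x - a) * derive1 f x))); last first.
    move=> x _; rewrite /h mulrBl mulr_suml; congr (_ - _).
    by apply: eq_bigr => l _; ring.
  have rzl (l : 'I_d) : leb.-integrable I (EFin \o (fun x => Z l a c 0 * (emono k l (x - a) * derive1 f x))).
    by apply: rintZ => //; exact: rint_test.
  rewrite RintegralB//; [|by apply: rint_test => //; exact/rZ/ltnW|exact: rint_sum].
  rewrite Zw// (Rint_sum mI)//.
  rewrite (eq_bigr (fun l : 'I_d => - (Z l a c 0 * \int[leb]_(x in I) (emono k.+1 l (x - a) * f x)))); last first.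
    move=> l _; rewrite RintegralZl//; last exact: rint_test.
    by rewrite emono_by_parts// mulrN.
  rewrite sumrN opprK.
  rewrite (Rint_eq leb (g := fun x => \sum_(l < d) Z l a c 0 * (emono k.+1 l (x - a) * f x))); last first.
    move=> x Ix; rewrite IH// summxE mulr_suml; apply: eq_bigr => l _; rewrite mxE; ring.
  rewrite (Rint_sum mI); last by move=> l; apply: rintZ => //; exact: rint_test.
  rewrite addrC; apply/eqP; rewrite subr_eq0; apply/eqP; apply: eq_bigr => l _.
  by rewrite RintegralZl//; exact: rint_test.
have Ia : I a by rewrite /= in_itv/= lexx ltW.
have Ib : I b by rewrite /= in_itv/= lexx ltW.
(* The derivatives at b are Q times those at a, so the boundary conditions become (Ha + Hb Q) Z(a) =
   0 with an invertible matrix. *)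
have Z0 : forall l : 'I_d, Z l a = 0.
  have : Ha B *m \mxcol_(k < d) Z k a + Hb C *m \mxcol_(k < d) Z k b = 0.
    apply/boundary_form => j.
    rewrite (eq_bigr (fun k : 'I_d => (B j k *m g k a + C j k *m g k b) -
        (B j k *m opA1 k w a + C j k *m opA1 k w b))); last first.
      by move=> k _; rewrite /Z gnE !mulmxBr opprD addrACA.
    by rewrite sumrB bc opA1_boundary// subrr.
  have -> : \mxcol_(k < d) Z k b = Q n d (b - a) *m \mxcol_(k < d) Z k a.
    rewrite Q_mul; apply: eq_mxcol => k; apply: (ZE (d - k)%N) => //.
    by rewrite subnKC// ltnW.
  rewrite mulmxA -mulmxDl => h0 l.
  have : \mxcol_(k < d) Z k a = 0 by rewrite -(mulKmx adm (\mxcol_(k < d) Z k a)) h0 mulmx0.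
  by move=> /mxcolP/(_ l); rewrite mxcolK submxcol0.
have g0E s : I s -> gn 0 s = opA1 0 w s.
  move=> Is; apply/eqP; rewrite -subr_eq0; apply/eqP; rewrite -/(Z 0 s) (ZE d)// big1// => l _.
  by rewrite Z0 scaler0.
have : ae_eq leb I u (gn 0).
  apply: weak_deriv1_unique u0 (gnw 0%N _) => //; first by move=> c; exact: rgn.
by apply: filterS => s h Is; rewrite h// g0E.
Qed.

End operator1.

(** * Products of univariate functions *)

Section product_functions.
Context (R : realType).
Local Notation leb := (@lebesgue_measure R).
Local Notation mR := (measurableTypeR R).

Lemma lebn_box_fin N (a b : 'I_N -> R) : (lebn R N (box a b) < +oo)%E.
Proof.
elim: N a b => [|N IH] a b.
  by rewrite /= diracE ltry.
have := lebn_ins ord0 (measurable_box a b); rewrite insp_box => ->.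
rewrite product_measure1E; [|exact: measurable_cc|exact: measurable_box].
by apply: lte_mul_pinfty; [|rewrite ge0_fin_numE//; exact: leb_cc_fin|exact: IH].
Qed.

(** The class of factors that the transposes of the operators preserve ([bmeas_adj]), contrary to
    test functions, whose compact support they destroy. *)
Definition bmeas (a b : R) (f : R -> R) :=
  measurable_fun (`[a, b]%classic : set mR) f /\
  exists2 M : R, 0 <= M & forall x, a <= x <= b -> `|f x| <= M.

Lemma bmeas_cst a b c : bmeas a b (fun=> c).
Proof. by split; [exact: measurable_cst|exists `|c|]. Qed.

Lemma bmeas_test a b f : test_function1 a b f -> bmeas a b f.
Proof.
move=> tf; split.
  by apply: smooth1_measurable; [exact: measurable_cc|case: tf].
by have [M M0 fM] := test_bounded tf; exists M.
Qed.

Lemma bmeas_indic a b (A : set mR) : measurable A -> bmeas a b (\1_A).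
Proof.
move=> mA; split; first exact: measurable_indic.
by exists 1 => // x _; rewrite indicE; case: (_ \in _); rewrite ?normr1 ?normr0.
Qed.

Context (N : nat) (a b : 'I_N -> R).
Implicit Types (f : 'I_N -> R -> R) (h : pt R N -> R).
Local Notation Omega := (box a b : set (pt R N)).
Local Notation mu := (lebn R N).

Definition prodf M (f : 'I_M -> R -> R) (s : pt R M) : R := \prod_i f i (crd s i).

Definition upf f (i : 'I_N) (g : R -> R) : 'I_N -> R -> R :=
  fun j => if j == i then g else f j.

Lemma upf_same f i g : upf f i g i = g. Proof. by rewrite /upf eqxx. Qed.

Lemma upf_neq f i j g : j != i -> upf f i g j = f j.
Proof. by rewrite /upf => /negbTE ->. Qed.

Lemma upf_upf f i g g' : upf (upf f i g) i g' = upf f i g'.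
Proof. by apply/funext => j; rewrite /upf; case: eqP. Qed.

Lemma upf_id f i : upf f i (f i) = f.
Proof. by apply/funext => j; rewrite /upf; case: ifP => // /eqP ->. Qed.

Lemma prodf_upf f i g s : prodf (upf f i g) s = g (crd s i) * prodf (upf f i (fun=> 1)) s.
Proof.
rewrite /prodf (bigD1 i)//= upf_same [in RHS](bigD1 i)//= upf_same mul1r; congr (_ * _).
by apply: eq_bigr => j ji; rewrite !upf_neq.
Qed.

Lemma prodf_ins f i t (x : pt R N.-1) :
  prodf f (ins i t x) = f i t * prodf (fun k => f (lift i k)) x.
Proof.
rewrite /prodf (bigD1_ord i)//= crd_ins; congr (_ * _).
by apply: eq_bigr => k _; rewrite crd_ins_lift.
Qed.

Definition bmeasN f := forall i, bmeas (a i) (b i) (f i).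

Lemma bmeasN_upf f i g : bmeasN f -> bmeas (a i) (b i) g -> bmeasN (upf f i g).
Proof. by move=> bf bg j; rewrite /upf; case: ifP => // /eqP ->. Qed.

Lemma measurable_crd_comp i (g : R -> R) :
  measurable_fun (`[a i, b i]%classic : set mR) g ->
  measurable_fun Omega (fun s => g (crd s i)).
Proof.
move=> mg; have := measurable_fun_preimage (@measurable_crd R N i) (measurable_cc (a i) (b i)) mg.
apply: measurable_funS => //.
- rewrite -[X in measurable X]setTI; apply: measurable_crd => //; exact: measurable_cc.
- by move=> s /(_ i); rewrite /= in_itv.
Qed.

Lemma prodf_measurable f : bmeasN f -> measurable_fun Omega (prodf f).
Proof.
move=> bf; apply: measurable_prod => i _; apply: measurable_crd_comp.
by have [] := bf i.
Qed.

Lemma prodf_bounded f : bmeasN f -> exists2 M : R, 0 <= M & forall s, Omega s -> `|prodf f s| <= M.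
Proof.
move=> bf.
have /choice[M hM] : forall i, exists M : R, 0 <= M /\ forall x, a i <= x <= b i -> `|f i x| <= M.
  by move=> i; have [_ [M M0 h]] := bf i; exists M.
exists (\prod_i M i); first by apply: prodr_ge0 => i _; have [] := hM i.
move=> s Os; rewrite /prodf normr_prod; apply: ler_prod => i _; rewrite normr_ge0/=.
by have [_] := hM i; apply; exact: Os.
Qed.

Lemma rint_prodf h f : mu.-integrable Omega (EFin \o h) -> bmeasN f ->
  mu.-integrable Omega (EFin \o (fun s => h s * prodf f s)).
Proof.
move=> rh bf; have [M M0 fM] := prodf_bounded bf.
by apply: (rintM (measurable_box a b) rh _ fM); exact: prodf_measurable.
Qed.

End product_functions.

(** * Varying one factor of a product *)

Section slot.
Context (R : realType) (N : nat) (a b : 'I_N -> R) (i : 'I_N).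
Local Notation leb := (@lebesgue_measure R).
Local Notation mR := (measurableTypeR R).
Local Notation Omega := (box a b : set (pt R N)).
Local Notation box' := (box (a \o lift i) (b \o lift i) : set (pt R N.-1)).
Local Notation mu := (lebn R N).
Local Notation I := (`[a i, b i]%classic : set mR).

Lemma ae_integrable_transverse (f : pt R N -> R) : mu.-integrable Omega (EFin \o f) ->
  {ae leb, forall t, I t -> (lebn R N.-1).-integrable box' (EFin \o (fun x => f (ins i t x)))}.
Proof.
move=> rf.
have := integrable_ins i (measurable_box a b) rf; rewrite insp_box => rfi.
exact: (ae_slice_integrable1 (measurable_cc _ _) (measurable_box _ _) rfi).
Qed.

Lemma Rint_slot (h : pt R N -> R) (g : R -> R) : mu.-integrable Omega (EFin \o h) ->
  bmeas (a i) (b i) g ->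
  \int[mu]_(s in Omega) (h s * g (crd s i)) =
  \int[leb]_(t in I) ((\int[lebn R N.-1]_(x in box') h (ins i t x)) * g t).
Proof.
move=> rh [mg [M M0 gM]].
have rhg : mu.-integrable Omega (EFin \o (fun s => h s * g (crd s i))).
  apply: (rintM (measurable_box a b) rh (measurable_crd_comp mg) (M := M)) => s Os.
  exact/gM/Os.
rewrite (Rint_transverse i rhg); apply: Rint_ae.
- exact: measurable_cc.
- exact: rint_measurable (rint_transverse i rhg).
- apply: measurable_funM => //; exact: rint_measurable (rint_transverse i rh).
apply: filterS (ae_integrable_transverse rh) => t ht It.
rewrite -RintegralZr//; last 2 first.
- exact: measurable_box.
- exact: ht.
by apply: Rint_eq => x _; rewrite crd_ins.
Qed.

(** With the other factors frozen and the other variables integrated out, a function of s_i alone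
    remains. It is orthogonal to all test functions, hence 0 almost everywhere, and so is orthogonal
    to g. *)
Lemma slot_extension (h : pt R N -> R) (f : 'I_N -> R -> R) (g : R -> R) : (a i < b i)%R ->
  mu.-integrable Omega (EFin \o h) -> bmeasN a b f -> bmeas (a i) (b i) g ->
  (forall p, test_function1 (a i) (b i) p ->
    \int[mu]_(s in Omega) (h s * prodf (upf f i p) s) = 0) ->
  \int[mu]_(s in Omega) (h s * prodf (upf f i g) s) = 0.
Proof.
move=> abi rh bf bg hp.
pose h1 s := h s * prodf (upf f i (fun=> 1)) s.
have rh1 : mu.-integrable Omega (EFin \o h1).
  by apply: rint_prodf => //; apply: bmeasN_upf => //; exact: bmeas_cst.
have hE p : bmeas (a i) (b i) p -> \int[mu]_(s in Omega) (h s * prodf (upf f i p) s) =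
    \int[leb]_(t in I) ((\int[lebn R N.-1]_(x in box') h1 (ins i t x)) * p t).
  move=> bp; rewrite -Rint_slot//; apply: Rint_eq => s _; rewrite prodf_upf /h1; ring.
have rU := rint_transverse i rh1.
have U0 : ae_eq leb I (fun t => \int[lebn R N.-1]_(x in box') h1 (ins i t x)) (cst 0).
  apply: fundamental1 => // o m.
  have tf : test_function1 (a i) (b i) (sbump (lo (a i) o) (b i) m).
    by apply: test_sbump => //; exact: lo_ge.
  by rewrite -hE ?hp//; exact: bmeas_test.
rewrite hE// (Rint_ae (measurable_cc _ _) _ _ (g := fun=> 0)).
- by rewrite Rintegral_cst ?mul0r//; exact: measurable_cc.
- by apply: measurable_funM; [exact: rint_measurable rU|case: bg].
- exact: measurable_cst.
- by apply: filterS U0 => t ht It; rewrite ht// mul0r.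
Qed.

End slot.

(** * Products determine an integrable function *)

Section uniqueness.
Context (R : realType) (N : nat) (a b : 'I_N -> R).
Hypothesis ltab : forall i, a i < b i.
Local Notation leb := (@lebesgue_measure R).
Local Notation mR := (measurableTypeR R).
Local Notation Omega := (box a b : set (pt R N)).
Local Notation mu := (lebn R N).

(** Factors are relaxed one at a time: the induction is on a list [r] of slots outside of which the
    factors must be test functions, and [slot_extension] treats the head of the list. *)
Lemma test_to_bmeas (h : pt R N -> R) : mu.-integrable Omega (EFin \o h) ->
  (forall p, (forall i, test_function1 (a i) (b i) (p i)) ->
    \int[mu]_(s in Omega) (h s * prodf p s) = 0) ->
  forall f, bmeasN a b f -> \int[mu]_(s in Omega) (h s * prodf f s) = 0.
Proof.
move=> rh h0.
suff H (r : seq 'I_N) : forall f, bmeasN a b f ->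
    (forall i, i \notin r -> test_function1 (a i) (b i) (f i)) ->
    \int[mu]_(s in Omega) (h s * prodf f s) = 0.
  by move=> f bf; apply: (H (enum 'I_N)) => // i; rewrite mem_enum.
elim: r => [|i r IH] f bf tf; first by apply: h0 => i; exact: tf.
rewrite -(upf_id f i); apply: slot_extension => // p tp.
apply: IH; first by apply: bmeasN_upf => //; exact: bmeas_test.
move=> j jr; rewrite /upf; case: eqP => [->//|/eqP ji].
by apply: tf; rewrite in_cons negb_or ji.
Qed.

Let boxesG : set (set (pt R N)) :=
  [set A | exists2 B : 'I_N -> set mR, (forall i, measurable (B i)) &
     A = [set s | forall i, B i (crd s i)]].

Let measurable_boxesG : @measurable _ (pt R N) = <<s boxesG >>.
Proof.
apply/seteqP; split.
  apply: smallest_sub; first exact: smallest_sigma_algebra.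
  move=> A; rewrite -bigcup_seq => -[i _ [B mB <-]]; apply: sub_sigma_algebra.
  exists (fun j => if j == i then B else setT); first by move=> j; case: ifP.
  rewrite setTI; apply/seteqP; split => s /=.
    by move=> Bs j; case: eqP => [->|].
  by move=> /(_ i); rewrite eqxx.
apply: smallest_sub; first exact: sigma_algebra_measurable.
move=> _ [B mB ->].
rewrite (_ : [set s | _] = \bigcap_(i in [set: 'I_N]) ((fun s : pt R N => crd s i) @^-1` B i)).
  apply: fin_bigcap_measurable => // k _; rewrite -[X in measurable X]setTI.
  by apply: measurable_crd => //; exact: mB.
by apply/seteqP; split => s h k; [move=> _; exact: h|exact: (h k Logic.I)].
Qed.

Let setI_closed_boxesG : setI_closed boxesG.
Proof.
move=> _ _ [B mB ->] [C mC ->]; exists (fun i => B i `&` C i).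
  by move=> i; exact: measurableI.
apply/seteqP; split => s /=; first by move=> [h1 h2] i; split; [exact: h1|exact: h2].
by move=> h; split => i; have [] := h i.
Qed.

(** Indicators of measurable boxes are products of bounded measurable functions, and these boxes
    form a pi-system generating the sigma-algebra of R^N. *)
Lemma bmeas_ae0 (h : pt R N -> R) : mu.-integrable Omega (EFin \o h) ->
  (forall f, bmeasN a b f -> \int[mu]_(s in Omega) (h s * prodf f s) = 0) ->
  ae_eq mu Omega h (cst 0).
Proof.
move=> rh h0; have mO := measurable_box a b.
have hB (B : 'I_N -> set mR) : (forall i, measurable (B i)) ->
    \int[mu]_(s in [set s | forall i, B i (crd s i)]) ((h \_ Omega) s) = 0.
  move=> mB; rewrite -Rintegral_mkcondr setIC Rintegral_mkcondr.
  rewrite -[RHS](h0 (fun i => \1_(B i))); last by move=> i; exact: bmeas_indic.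
  apply: Rint_eq => s _; rewrite patchE /prodf; case: ifPn.
    rewrite inE/= => Bs; rewrite big1 ?mulr1// => i _.
    by rewrite indicE mem_set//; exact: Bs.
  rewrite notin_setE/= -existsNE => -[i Bi].
  by rewrite (bigD1 i)//= indicE memNset// mul0r mulr0.
have : ae_eq mu setT (h \_ Omega) (cst 0).
  apply: (ae_eq0_pisystem measurable_boxesG setI_closed_boxesG).
  - by rewrite -restrict_EFin; apply/(integrable_mkcond _ mO).
  - rewrite -[RHS](hB (fun=> setT)) => [|i]; last exact: measurableT.
    by congr (Rintegral _ _ _); apply/seteqP; split.
  - by move=> _ [B mB ->]; exact: hB.
by apply: filterS => s hs Os; move: (hs Logic.I); rewrite patchE mem_set.
Qed.

Lemma test_ae0 (h : pt R N -> R) : mu.-integrable Omega (EFin \o h) ->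
  (forall p, (forall i, test_function1 (a i) (b i) (p i)) ->
    \int[mu]_(s in Omega) (h s * prodf p s) = 0) ->
  ae_eq mu Omega h (cst 0).
Proof. by move=> rh h0; apply: bmeas_ae0 => // f bf; exact: test_to_bmeas. Qed.

Lemma rint_ae_eq (h g : pt R N -> R) (T : set ('I_N -> R -> R)) :
  mu.-integrable Omega (EFin \o h) -> mu.-integrable Omega (EFin \o g) ->
  T `<=` bmeasN a b ->
  (forall k, mu.-integrable Omega (EFin \o k) ->
    (forall f, T f -> \int[mu]_(s in Omega) (k s * prodf f s) = 0) -> ae_eq mu Omega k (cst 0)) ->
  (forall f, T f -> \int[mu]_(s in Omega) (h s * prodf f s) =
                    \int[mu]_(s in Omega) (g s * prodf f s)) ->
  ae_eq mu Omega h g.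
Proof.
move=> rh rg bT T0 hg; have mO := measurable_box a b.
apply: ae_eq_sub0; apply: T0; first exact: rintB.
move=> f Tf; have bf := bT _ Tf.
rewrite (Rint_eq mu (g := fun s => h s * prodf f s - g s * prodf f s)).
  by rewrite RintegralB ?hg ?subrr//; exact: rint_prodf.
by move=> s _; rewrite mulrBl.
Qed.

Lemma bmeas_ae_eq (h g : pt R N -> R) :
  mu.-integrable Omega (EFin \o h) -> mu.-integrable Omega (EFin \o g) ->
  (forall f, bmeasN a b f -> \int[mu]_(s in Omega) (h s * prodf f s) =
                             \int[mu]_(s in Omega) (g s * prodf f s)) ->
  ae_eq mu Omega h g.
Proof. by move=> rh rg; apply: rint_ae_eq => //; exact: bmeas_ae0. Qed.

Lemma test_ae_eq (h g : pt R N -> R) :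
  mu.-integrable Omega (EFin \o h) -> mu.-integrable Omega (EFin \o g) ->
  (forall p, (forall i, test_function1 (a i) (b i) (p i)) ->
    \int[mu]_(s in Omega) (h s * prodf p s) = \int[mu]_(s in Omega) (g s * prodf p s)) ->
  ae_eq mu Omega h g.
Proof.
move=> rh rg hg; apply: (@rint_ae_eq h g [set p | forall i, test_function1 (a i) (b i) (p i)]) => //.
  by move=> p tp i; apply: bmeas_test; exact: tp.
exact: test_ae0.
Qed.

End uniqueness.

Lemma rint_le_ae (d : measure_display) (T : measurableType d) (R : realType)
    (mu : {measure set T -> \bar R}) (D : set T) (f g : T -> R) : measurable D ->
  measurable_fun D f -> mu.-integrable D (EFin \o g) ->
  {ae mu, forall x, D x -> `|f x| <= g x} -> mu.-integrable D (EFin \o f).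
Proof.
move=> mD mf rg fg; apply/integrableP; split; first exact/measurable_EFinP.
have /integrableP[mg hg] := rg; apply: le_lt_trans hg.
apply: ae_ge0_le_integral => //.
- by apply: measurableT_comp => //; exact/measurable_EFinP.
- exact: measurableT_comp.
- by apply: filterS fg => x h Dx /=; rewrite lee_fin (le_trans (h Dx))// ler_norm.
Qed.

Lemma le_Rint_ae (d : measure_display) (T : measurableType d) (R : realType)
    (mu : {measure set T -> \bar R}) (D : set T) (f g : T -> R) : measurable D ->
  mu.-integrable D (EFin \o f) -> mu.-integrable D (EFin \o g) ->
  (forall x, D x -> 0 <= f x) ->
  {ae mu, forall x, D x -> f x <= g x} -> \int[mu]_(x in D) f x <= \int[mu]_(x in D) g x.
Proof.
move=> mD rf rg f0 fg.
rewrite -lee_fin /Rintegral fineK; last exact: integrable_fin_num.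
have gabs : \int[mu]_(x in D) g x = \int[mu]_(x in D) `|g x|.
  apply: Rint_ae => //; first exact: rint_measurable rg.
    by apply: measurableT_comp => //; exact: rint_measurable rg.
  by apply: filterS fg => x h Dx; rewrite ger0_norm// (le_trans (f0 x Dx))// h.
rewrite -/(Rintegral mu D g) gabs /Rintegral fineK; last first.
  by apply: integrable_fin_num => //; exact: integrable_norm.
have /integrableP[mf _] := rf; have /integrableP[mg _] := rg.
apply: ae_ge0_le_integral => //.
- by apply/measurable_EFinP; apply: measurableT_comp => //; exact: rint_measurable rg.
- by apply: filterS fg => x h Dx; rewrite lee_fin (le_trans (h Dx))// ler_norm.
Qed.

(** * Functions that are constant along one direction *)

Section lines.
Context (R : realType) (N : nat) (a b : 'I_N -> R) (i : 'I_N).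
Local Notation leb := (@lebesgue_measure R).
Local Notation mR := (measurableTypeR R).
Local Notation Omega := (box a b : set (pt R N)).
Local Notation box' := (box (a \o lift i) (b \o lift i) : set (pt R N.-1)).
Local Notation mu := (lebn R N).
Local Notation I := (`[a i, b i]%classic : set mR).

Lemma measurable_outs : measurable_fun setT (@outs R N i).
Proof.
apply/measurable_fun_tnthP => k.
rewrite (_ : _ \o _ = (fun s : pt R N => tnth s (lift i k))).
  exact: measurable_tnth.
by apply/funext => s /=; rewrite tnth_mktuple.
Qed.

Lemma box_outs s : Omega s -> box' (outs i s).
Proof.
by move=> Os; have /box_insP[] : Omega (ins i (crd s i) (outs i s)) by rewrite ins_outs.
Qed.

Lemma ae_outs (P : pt R N.-1 -> Prop) : {ae lebn R N.-1, forall x, box' x -> P x} ->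
  {ae mu, forall s, Omega s -> P (outs i s)}.
Proof.
move=> [Z [mZ Z0 PZ]]; exists (@outs R N i @^-1` Z).
have mZ' : measurable (@outs R N i @^-1` Z).
  by rewrite -[X in measurable X]setTI; exact: measurable_outs.
split => //.
  transitivity ((leb \x lebn R N.-1)%E (@insp R N i @^-1` (@outs R N i @^-1` Z))); first exact: lebn_ins.
  (* The preimage is R times a null set; its measure is infinity times 0, which is 0. *)
  rewrite (_ : _ @^-1` _ = setT `*` Z); first by rewrite product_measure1E// [X in (_ * X)%E]Z0 mule0.
  by apply/seteqP; split => -[t x] /=; rewrite outs_ins// => -[].
move=> s /= ns; apply: PZ => /= h; apply: ns => Os; apply: h.
exact: box_outs.
Qed.

Lemma rint_outs (q : pt R N.-1 -> R) : (lebn R N.-1).-integrable box' (EFin \o q) ->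
  mu.-integrable Omega (EFin \o (fun s => q (outs i s))) /\
  \int[mu]_(s in Omega) q (outs i s) = fine (leb I) * \int[lebn R N.-1]_(x in box') q x.
Proof.
move=> rq; have mO := measurable_box a b.
have mb' : measurable box' by exact: measurable_box.
have mI : measurable I by exact: measurable_cc.
have rp : (leb \x lebn R N.-1)%E.-integrable (I `*` box') (EFin \o (fun p : mR * pt R N.-1 => q p.2)).
  by apply: rint_snd => //; exact: leb_cc_fin.
have mq : measurable_fun Omega (fun s => q (outs i s)).
  have := measurable_fun_preimage measurable_outs mb' (rint_measurable rq).
  apply: measurable_funS; first by rewrite -[X in measurable X]setTI; exact: measurable_outs.
  by move=> s Os; exact: box_outs.
split.
  apply/integrableP; split; first exact/measurable_EFinP.
  rewrite (ge0_integral_ins i mO)//; last first.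
    by apply: measurableT_comp => //; exact/measurable_EFinP.
  rewrite insp_box; have /integrableP[_] := rp; congr (_ < _)%E.
  by apply: eq_integral => -[t x] _; rewrite /= /insp/= outs_ins.
rewrite (Rintegral_ins i mO mq) insp_box.
rewrite (Rint_eq _ (g := fun p : mR * pt R N.-1 => q p.2)); last first.
  by move=> [t x] _; rewrite /insp/= outs_ins.
rewrite (Rfubini2 mI mb' rp) -RintegralZl//; apply: Rint_eq => x _ /=.
by rewrite Rintegral_cst// mulrC.
Qed.

End lines.

Lemma sqr_sum_le (R : realFieldType) n (x : 'I_n -> R) :
  (\sum_l x l) ^+ 2 <= n%:R * \sum_l x l ^+ 2.
Proof.
rewrite expr2 mulr_suml.
apply: (@le_trans _ _ (\sum_k \sum_l (x k ^+ 2 + x l ^+ 2) / 2)).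
  apply: ler_sum => k _; rewrite mulr_sumr; apply: ler_sum => l _.
  have := sqr_ge0 (x k - x l); rewrite sqrrB; set u := x k; set v := x l => h.
  by rewrite ler_pdivlMr//; lra.
under eq_bigr do rewrite -mulr_suml big_split/= sumr_const card_ord.
rewrite -mulr_suml big_split/= sumr_const card_ord sumrMnl.
set S := \sum_i _; rewrite -(mulr_natl S); set m := _ * S; lra.
Qed.

(** * Bounds for the operators on one line *)

Section bound1.
Context (R : realType) (n d : nat).
Variables (a b : R) (B C : 'I_d -> 'I_d -> 'M[R]_n).
Hypothesis ab : a < b.
Local Notation leb := (@lebesgue_measure R).
Local Notation mR := (measurableTypeR R).
Local Notation I := (`[a, b]%classic : set mR).

(** Cauchy-Schwarz against the constant 1, derived from the nonnegativity of the variance of |f|;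
    [m] is the mean of |f|. *)
Lemma sqr_Rint_norm_le (f : R -> R) : leb.-integrable I (EFin \o f) ->
  leb.-integrable I (EFin \o (fun t => f t ^+ 2)) ->
  (\int[leb]_(t in I) `|f t|) ^+ 2 <= (b - a) * \int[leb]_(t in I) (f t ^+ 2).
Proof.
move=> rf rf2; have mI := measurable_cc a b.
have ba : 0 < b - a by rewrite subr_gt0.
have rn : leb.-integrable I (EFin \o (fun t => `|f t|)) by exact: integrable_norm.
set A := \int[leb]_(t in I) `|f t|; pose m := A / (b - a).
have rc : leb.-integrable I (EFin \o (fun=> m ^+ 2)).
  by apply: (@rint_bounded _ _ _ _ `|m ^+ 2|); [exact: measurable_cst|].
have : 0 <= \int[leb]_(t in I) ((`|f t| - m) ^+ 2).
  by apply: Rintegral_ge0 => t _; exact: sqr_ge0.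
move=> h0; have := h0; rewrite (Rint_eq leb (g := fun t => f t ^+ 2 - (2 * m) * `|f t| + m ^+ 2)); last first.
  move=> t _; rewrite sqrrB real_normK ?num_real//; ring.
have rm : leb.-integrable I (EFin \o (fun t => (2 * m) * `|f t|)) by exact: rintZ.
rewrite RintegralD//; last exact: rintB.
rewrite RintegralB// RintegralZl// Rintegral_cst// [fine _](fine_leb_cc (ltW ab)).
rewrite -/A; have Am : A = m * (b - a) by rewrite /m divfK// gt_eqF.
rewrite Am; set S := Rintegral _ _ _ => h.
have : 0 <= S - m ^+ 2 * (b - a) by lra.
rewrite -(pmulr_rge0 _ ba) mulrBr => h2; nra.
Qed.

Lemma opA1_bound j : (j < d)%N -> exists2 K0 : R, 0 <= K0 &
  forall w, L1 a b w -> forall s, I s -> forall c,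
   `|opA1 a b B C j w s c 0| <= K0 * \sum_l \int[leb]_(t in I) `|w t l 0|.
Proof.
move=> jd; have mI := measurable_cc a b; pose e := b - a.
have e0 : 0 <= e by rewrite subr_ge0 ltW.
pose T c := \sum_(k < d) e ^+ (k - j) * \sum_(l < d) \sum_(c' < n) `|Kb a b B C k l c c'| * e ^+ (d - 1 - l).
have T0 c : 0 <= T c.
  apply: sumr_ge0 => k _; apply: mulr_ge0; first exact: exprn_ge0.
  by apply: sumr_ge0 => l _; apply: sumr_ge0 => c' _; rewrite mulr_ge0// exprn_ge0.
exists (e ^+ (d - 1 - j) + \sum_c T c).
  by rewrite addr_ge0 ?exprn_ge0// sumr_ge0.
move=> w rw s Is c.
have rn l : leb.-integrable I (EFin \o (fun t => `|w t l 0|)) by exact: integrable_norm (rw l).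
pose S := \sum_l \int[leb]_(t in I) `|w t l 0|.
have S0 : 0 <= S by apply: sumr_ge0 => l _; apply: Rintegral_ge0.
have wS l : \int[leb]_(t in I) `|w t l 0| <= S.
  rewrite /S (bigD1 l)//= lerDl; apply: sumr_ge0 => l' _; exact: Rintegral_ge0.
rewrite opA1E// mulrDl; apply: le_trans (ler_normB _ _) _; apply: lerD.
  apply: le_trans (vol_bound _ (rw c) Is) _; by rewrite ler_wpM2l ?exprn_ge0// wS.
apply: (@le_trans _ _ (T c * S)); last first.
  by rewrite ler_wpM2r// (bigD1 c)//= lerDl; apply: sumr_ge0.
rewrite /T mulr_suml; apply: le_trans (ler_norm_sum _ _ _) _; apply: ler_sum => k _.
rewrite normrM -mulrA ler_pM//.
  rewrite /emono; case: ifP => _; last by rewrite normr0 exprn_ge0.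
  apply: mono_norm; move: Is; rewrite /= in_itv/= => /andP[? ?].
  by rewrite /e ler_norml; apply/andP; split; lra.
rewrite /kmom summxE mulr_suml; apply: le_trans (ler_norm_sum _ _ _) _; apply: ler_sum => l _.
rewrite mxE mulr_suml; apply: le_trans (ler_norm_sum _ _ _) _; apply: ler_sum => c' _.
rewrite normrM -mulrA ler_wpM2l// [mom _ _ _ _ _ _]mxE.
apply: (@le_trans _ _ (e ^+ (d - 1 - l) * \int[leb]_(t in I) `|w t c' 0|)); last first.
  by rewrite ler_wpM2l ?exprn_ge0.
have re : leb.-integrable I (EFin \o (fun t => eps d b l t * w t c' 0)).
  by apply: rint_smooth (rw c') _; exact: smooth1_eps.
apply: le_trans (le_normr_Rintegral mI re) _; rewrite -RintegralZl//.
apply: le_Rintegral => //; first exact: integrable_norm; first exact: rintZ.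
move=> t It; rewrite normrM ler_wpM2r//; apply: mono_norm; move: It; rewrite /= in_itv/= => /andP[? ?].
by rewrite /e ler_norml; apply/andP; split; lra.
Qed.

(** For j < d the operator integrates, so its pointwise values are controlled by the square integral
    along the line. The bound is constant in s, which makes it easy to integrate over the box. *)
Lemma opA1_sqr_bound j : (j < d)%N -> exists2 K0 : R, 0 <= K0 &
  forall w, L2 leb I w -> forall s, I s -> forall c,
   (opA1 a b B C j w s c 0) ^+ 2 <= K0 * \int[leb]_(t in I) (\sum_l (w t l 0) ^+ 2).
Proof.
move=> jd; have [K0 K00 hK] := opA1_bound jd; have mI := measurable_cc a b.
(* The factor n comes from squaring a sum of n components, the length from Cauchy-Schwarz. *)
exists (K0 ^+ 2 * (n%:R * (b - a))).
  by rewrite mulr_ge0 ?sqr_ge0// mulr_ge0// subr_ge0 ltW.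
move=> w L2w s Is c; have rw := L2_L1 L2w.
rewrite -real_normK ?num_real//.
apply: (@le_trans _ _ ((K0 * \sum_l \int[leb]_(t in I) `|w t l 0|) ^+ 2)).
  rewrite lerXn2r ?nnegrE//; last exact: hK.
  by rewrite mulr_ge0//; apply: sumr_ge0 => l _; apply: Rintegral_ge0.
rewrite exprMn -mulrA ler_wpM2l ?sqr_ge0//.
apply: le_trans (sqr_sum_le _) _; rewrite -mulrA ler_wpM2l//.
rewrite (Rint_sum mI); last by move=> l; have [] := L2w l.
rewrite mulr_sumr; apply: ler_sum => l _; apply: sqr_Rint_norm_le.
  exact: rw.
by have [] := L2w l.
Qed.

End bound1.

(** * The multivariate operators *)

Section L2_facts.
Context (d : measure_display) (T : measurableType d) (R : realType) (n : nat).
Variables (mu : {measure set T -> \bar R}) (D : set T).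
Hypothesis mD : measurable D.
Implicit Types u v : T -> 'cV[R]_n.

Lemma L2_lin (x : R) u v : L2 mu D u -> L2 mu D v -> L2 mu D (x *: u + v).
Proof.
move=> hu hv c; have [mu_ su] := hu c; have [mv sv] := hv c.
have mz : measurable_fun D (fun s => (x *: u + v) s c 0).
  rewrite (_ : (fun s => _) = (fun s => x * u s c 0 + v s c 0)); last first.
    by apply/funext => s; rewrite !mxE.
  by apply: measurable_funD => //; exact: measurable_funM.
split => //.
apply: (@rint_le _ _ _ _ _ mD _ (fun s => (2 * x ^+ 2) * u s c 0 ^+ 2 + 2 * v s c 0 ^+ 2)).
- exact: measurable_funX.
- by apply: rintD => //; exact: rintZ.
- move=> s Ds; rewrite !mxE ger0_norm ?sqr_ge0//.
  have := sqr_ge0 (x * u s c 0 - v s c 0); nra.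
Qed.

Lemma L20 : L2 mu D (0 : T -> 'cV[R]_n).
Proof.
move=> c; split.
  rewrite (_ : (fun s => _) = cst 0); first exact: measurable_cst.
  by apply/funext => s; rewrite mxE.
by apply: (rint_eq mD _ (rint0 mu D)) => s _; rewrite mxE expr0n.
Qed.

Lemma L2Z (x : R) u : L2 mu D u -> L2 mu D (x *: u).
Proof. by move=> hu; rewrite -[x *: u]addr0; apply: L2_lin => //; exact: L20. Qed.

Lemma L2D u v : L2 mu D u -> L2 mu D v -> L2 mu D (u + v).
Proof. by move=> hu hv; rewrite -[u]scale1r; exact: L2_lin. Qed.

Lemma L2B u v : L2 mu D u -> L2 mu D v -> L2 mu D (u - v).
Proof. by move=> hu hv; rewrite addrC -scaleN1r; exact: L2_lin. Qed.

Lemma L2_rint u c : (mu D < +oo)%E -> L2 mu D u ->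
  mu.-integrable D (EFin \o (fun s => u s c 0)).
Proof.
move=> fD hu; have [mu_ su] := hu c.
apply: (@rint_le _ _ _ _ _ mD _ (fun s => 1 + u s c 0 ^+ 2)) => //.
  apply: rintD => //.
  apply/integrableP; split; first exact: measurable_cst.
  by rewrite integral_cst//= normr1 mul1e.
move=> s _; rewrite -(real_normK (num_real (u s c 0))).
by set y := `|_|; have := sqr_ge0 (y - 1); nra.
Qed.

(** The squared norm as a real number: estimates on it avoid square roots and extended reals, and
    [L2normE] returns to the norm. *)
Definition sqn u : R := \int[mu]_(s in D) (\sum_k (u s k 0) ^+ 2).

Lemma sqn_ge0 u : 0 <= sqn u.
Proof. by apply: Rintegral_ge0 => s _; apply: sumr_ge0 => k _; exact: sqr_ge0. Qed.

Lemma rint_sqn u : L2 mu D u -> mu.-integrable D (EFin \o (fun s => \sum_k (u s k 0) ^+ 2)).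
Proof. by move=> hu; apply: rint_sum => // k; have [] := hu k. Qed.

Lemma L2normE u : L2 mu D u -> L2norm mu D u = (Num.sqrt (sqn u))%:E.
Proof.
move=> hu; rewrite /L2norm /sqn /Rintegral.
have := integrable_fin_num mD (rint_sqn hu).
rewrite -[X in sqrte X]/(integral mu D (EFin \o (fun s => \sum_k (u s k 0) ^+ 2))).
by case: integral => [r|//|//] _ /=.
Qed.

Lemma ae_eq_sqn u v : L2 mu D u -> L2 mu D v -> ae_eq mu D u v -> sqn u = sqn v.
Proof.
move=> hu hv uv; apply: Rint_ae => //.
- exact: rint_measurable (rint_sqn hu).
- exact: rint_measurable (rint_sqn hv).
- by apply: filterS uv => s h Ds; rewrite h.
Qed.

Lemma sqn_triangle u v : L2 mu D u -> L2 mu D v -> sqn (u + v) <= 2 * (sqn u + sqn v).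
Proof.
move=> hu hv; rewrite /sqn -RintegralD//; try exact: rint_sqn.
rewrite -RintegralZl//; last by apply: rintD => //; exact: rint_sqn.
apply: le_Rintegral => //.
- by apply: rint_sqn; exact: L2D.
- by apply: rintZ => //; apply: rintD => //; exact: rint_sqn.
- move=> s Ds; rewrite -big_split/= mulr_sumr; apply: ler_sum => k _.
  by rewrite mxE; have := sqr_ge0 (u s k 0 - v s k 0); nra.
Qed.

Lemma sqn0_ae u v : L2 mu D u -> L2 mu D v -> sqn (u - v) = 0 -> ae_eq mu D u v.
Proof.
move=> hu hv h; have huv := L2B hu hv; have ri := rint_sqn huv.
pose q (s : T) : R := \sum_k ((u - v) s k 0) ^+ 2.
have q0 s : 0 <= q s by apply: sumr_ge0 => k _; exact: sqr_ge0.
have mq : measurable_fun D (EFin \o q) by apply/measurable_EFinP; exact: rint_measurable ri.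
have h0 : (\int[mu]_(s in D) `|(EFin \o q) s| = 0)%E.
  rewrite (eq_integral (EFin \o q)); last by move=> s _ /=; rewrite ger0_norm.
  move: h; rewrite /sqn /Rintegral; have := integrable_fin_num mD ri.
  by rewrite -/q; case: integral => // r _ /= ->.
have /(ae_eq_integral_abs mu mD mq) hq := h0.
apply: filterS hq => s + Ds => /(_ Ds) /= [] qs0.
apply/matrixP => k z; rewrite ord1.
have /eqP := qs0; rewrite psumr_eq0; last by move=> k' _; exact: sqr_ge0.
move=> /allP /(_ k (mem_index_enum _)) /=; rewrite sqrf_eq0 !mxE subr_eq0.
by move=> /eqP.
Qed.

End L2_facts.

(** * Bounds, transposes and commutation of the operators on the box *)

Section opA_slices.
Context (R : realType) (N n : nat) (a b : 'I_N -> R).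
Hypothesis ltab : forall i, a i < b i.
Variable delta : 'I_N -> nat.
Variables B C : forall i, 'I_(delta i) -> 'I_(delta i) -> 'M[R]_n.
Local Notation leb := (@lebesgue_measure R).
Local Notation mR := (measurableTypeR R).
Local Notation Omega := (box a b : set (pt R N)).
Local Notation box' i := (box (a \o lift i) (b \o lift i) : set (pt R N.-1)).
Local Notation mu := (lebn R N).
Local Notation I i := (`[a i, b i]%classic : set mR).
Local Notation opA := (opA a b B C).
Local Notation opA1i i := (opA1 (a i) (b i) (@B i) (@C i)).
Local Notation F := (pt R N -> 'cV[R]_n).
Implicit Types v w : F.

Let mO : measurable Omega. Proof. exact: measurable_box. Qed.

Lemma opA_ins i j v t x :
  opA i j v (ins i t x) = opA1i i j (fun th => v (ins i th x)) t.
Proof.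
rewrite /Defs.opA /opA1; case: ifP => // jd; apply/matrixP => c z.
rewrite !mxE crd_ins; congr (_ - _); apply: Rint_eq => th _; rewrite upd_ins//.
Qed.

Lemma opA_out i j v : (delta i <= j)%N -> opA i j v = v.
Proof. by move=> ij; apply/funext => s; rewrite /Defs.opA ltnNge ij. Qed.

Lemma measurable_upd i : measurable_fun setT (fun p : pt R N * mR => upd i p.2 p.1).
Proof.
apply/measurable_fun_tnthP => k.
rewrite (_ : _ \o _ = (fun p : pt R N * mR => if k == i then p.2 else crd p.1 k)); last first.
  by apply/funext => p /=; rewrite tnth_mktuple.
case: (k == i); first exact: measurable_snd.
by apply: (measurableT_comp (@measurable_crd R N k)); exact: measurable_fst.
Qed.

Lemma upd_box i t s : Omega s -> I i t -> Omega (upd i t s).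
Proof.
move=> Os It k; rewrite /crd tnth_mktuple; case: eqP => [->|_]; last exact: Os.
by move: It; rewrite /= in_itv.
Qed.

(** Both integrals are rewritten over the whole line, the bounds of integration becoming indicators,
    so that the integrand is jointly measurable in the point and the integration variable. *)
Lemma measurable_opA i j v c : (forall k, measurable_fun Omega (fun s => v s k 0)) ->
  measurable_fun Omega (fun s => opA i j v s c 0).
Proof.
move=> mv; have [ij|ji] := leqP (delta i) j; first by rewrite opA_out.
(* Only the values of v in the box matter; the extension by zero is measurable on the whole
   space. *)
pose vt k := (fun s => v s k 0) \_ Omega.
have mvt k : measurable_fun setT (vt k) by exact/(measurable_restrictT _ mO).
have mupd k : measurable_fun setT (fun p : pt R N * mR => vt k (upd i p.2 p.1)).
  exact: measurableT_comp (measurable_upd i).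
have mc : measurable_fun setT (fun p : pt R N * mR => crd p.1 i).
  by apply: (measurableT_comp (@measurable_crd R N i)); exact: measurable_fst.
have mm m (g : pt R N * mR -> R) : measurable_fun setT g ->
    measurable_fun setT (fun p => mono m (g p)).
  by move=> mg; apply: (measurableT_comp (smooth1_measurable measurableT (@smooth1_mono R m))).
have me k (g : pt R N * mR -> R) : measurable_fun setT g ->
    measurable_fun setT (fun p => emono j k (g p)).
  by move=> mg; apply: (measurableT_comp (smooth1_measurable measurableT (@smooth1_emono R j k))).
have ms : measurable_fun setT (fun p : pt R N * mR => p.2 : R) by exact: measurable_snd.
pose F1 (p : pt R N * mR) : R := \1_(I i) p.2 * \1_(`[0, +oo[%classic : set mR) (crd p.1 i - p.2) *
  (mono (delta i - 1 - j) (crd p.1 i - p.2) * vt c (upd i p.2 p.1)).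
pose F2 (p : pt R N * mR) : R := \1_(I i) p.2 * \sum_k
  (\sum_(k' < delta i) \sum_(l < delta i) (emono j k' (crd p.1 i - a i) *
     mono (delta i - 1 - l) (b i - p.2)) * Kb (a i) (b i) (@B i) (@C i) k' l c k) * vt k (upd i p.2 p.1).
have mI1 : measurable_fun setT (fun p : pt R N * mR => \1_(I i) p.2 : R).
  by apply: measurableT_comp => //; exact: measurable_indic.
have mJ : measurable_fun setT (\1_(`[0, +oo[%classic : set mR) : mR -> R) by exact: measurable_indic.
have mF1 : measurable_fun setT F1.
  apply: measurable_funM; last first.
    by apply: measurable_funM => //; apply: mm; exact: measurable_funB.
  apply: measurable_funM => //.
  by apply: (measurableT_comp mJ); exact: measurable_funB.
have mF2 : measurable_fun setT F2.
  apply: measurable_funM => //; apply: measurable_sum => k; apply: measurable_funM => //.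
  apply: measurable_sum => k'; apply: measurable_sum => l; apply: measurable_funM => //.
  by apply: measurable_funM; [apply: me|apply: mm]; exact: measurable_funB.
have H1 := measurable_Rintegral leb mF1; have H2 := measurable_Rintegral leb mF2.
have := measurable_funS measurableT (@subsetT _ Omega) (measurable_funB H1 H2).
apply: eq_measurable_fun => s; rewrite inE => Os /=.
have Is := Os i; rewrite /Defs.opA ji mxE; congr (_ - _).
  rewrite -[RHS](Rint_le_indic (a i) _ (andP Is).2) Rintegral_mkcond; apply: Rint_eq => t _.
  rewrite patchE /F1/= indicE; have [It|nIt] := boolP (t \in _); last by rewrite !mul0r.
  by rewrite mul1r /vt patchE mem_set//; apply: upd_box => //; exact: set_mem.
rewrite [RHS]Rintegral_mkcond; apply: Rint_eq => t _.
rewrite patchE /F2/= indicE; have [It|nIt] := boolP (t \in _); last by rewrite !mul0r.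
rewrite mul1r kernelE mxE; apply: eq_bigr => k _.
rewrite /vt patchE mem_set; last by apply: upd_box => //; exact: set_mem.
congr (_ * _); rewrite summxE; apply: eq_bigr => k' _; rewrite summxE; apply: eq_bigr => l _.
by rewrite [RHS]mxE.
Qed.

Lemma ae_L2_line i v : L2 mu Omega v -> {ae lebn R N.-1, forall x, box' i x ->
  L2 leb (I i) (fun t => v (ins i t x))}.
Proof.
move=> hv.
have : {ae lebn R N.-1, forall x, forall c, box' i x ->
    leb.-integrable (I i) (EFin \o (fun t => v (ins i t x) c 0 ^+ 2))}.
  by apply: ae_forall_ord => c; have [_] := hv c; exact: ae_integrable_line.
apply: filterS => x h bx c; split; last exact: h.
by have [mv _] := hv c; apply: (measurable_ins_line mO mv) => t It; apply/box_insP.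
Qed.

(** On almost every line the pointwise bound is a constant times the square integral [q] of v along
    that line. Integrating it over the box yields the length of side i, and summing over components
    the factor n. *)
Lemma opA_L2_bound i j : exists2 K0 : R, 0 <= K0 & forall v, L2 mu Omega v ->
  L2 mu Omega (opA i j v) /\ sqn mu Omega (opA i j v) <= K0 * sqn mu Omega v.
Proof.
have [ij|ji] := leqP (delta i) j.
  by exists 1 => // v hv; rewrite opA_out// mul1r.
have [K0 K00 hK] := opA1_sqr_bound (@B i) (@C i) (ltab i) ji.
exists (n%:R * (K0 * (b i - a i))).
  by rewrite !mulr_ge0// subr_ge0 ltW.
move=> v hv; have rv := rint_sqn mO hv.
pose q x := \int[leb]_(t in I i) (\sum_l (v (ins i t x) l 0) ^+ 2).
have rq : (lebn R N.-1).-integrable (box' i) (EFin \o q) := rint_line i rv.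
have [rqo qo] := rint_outs rq.
have rKq : mu.-integrable Omega (EFin \o (fun s => K0 * q (outs i s))) by exact: rintZ.
have le_ae c : {ae mu, forall s, Omega s -> (opA i j v s c 0) ^+ 2 <= K0 * q (outs i s)}.
  have := ae_outs (i := i) (P := fun x => L2 leb (I i) (fun t => v (ins i t x))) (ae_L2_line i hv).
  apply: filterS => s h Os; have := hK _ (h Os) (crd s i) _ c; rewrite -opA_ins ins_outs.
  by apply; rewrite /= in_itv/=; exact: Os.
have mA c : measurable_fun Omega (fun s => opA i j v s c 0).
  by apply: measurable_opA => k; have [] := hv k.
have hA : L2 mu Omega (opA i j v).
  move=> c; split => //; apply: (rint_le_ae mO _ rKq); first exact: measurable_funX.
  by apply: filterS (le_ae c) => s h Os; rewrite ger0_norm ?sqr_ge0// h.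
split => //; have -> : n%:R * (K0 * (b i - a i)) * sqn mu Omega v =
    \int[mu]_(s in Omega) (n%:R * (K0 * q (outs i s))).
  rewrite RintegralZl// RintegralZl// qo [fine _](fine_leb_cc (ltW (ltab i))).
  by rewrite /sqn (Rint_line i rv) -!mulrA.
apply: le_Rint_ae => //.
- exact: rint_sqn.
- exact: rintZ.
- by move=> s _; apply: sumr_ge0 => k _; exact: sqr_ge0.
- have := ae_forall_ord le_ae; apply: filterS => s h Os.
  apply: (@le_trans _ _ (\sum_(k < n) K0 * q (outs i s))).
    by apply: ler_sum => c _; exact: h.
  by rewrite sumr_const card_ord mulr_natl.
Qed.

Lemma L2_opA i j v : L2 mu Omega v -> L2 mu Omega (opA i j v).
Proof. by have [K0 _ h] := opA_L2_bound i j => /h[]. Qed.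

Lemma rintO v c : L2 mu Omega v -> mu.-integrable Omega (EFin \o (fun s => v s c 0)).
Proof. by apply: L2_rint => //; exact: lebn_box_fin. Qed.

Local Notation adji i := (adj (a i) (b i) (@B i) (@C i)).

Lemma bmeas_adj i j g c c' : bmeas (a i) (b i) g ->
  bmeas (a i) (b i) (fun t => adji i j g t c c').
Proof.
move=> [mg [M M0 gM]].
have gM' x : I i x -> `|g x| <= M by rewrite /= in_itv/=; exact: gM.
split; first exact: (adj_measurable (@B i) (@C i) j c c' mg gM').
have [M' M'0 hM] := adj_bounded (@B i) (@C i) (ltab i) j M.
by exists M' => // x xi; apply: (hM _ mg gM'); rewrite /= in_itv.
Qed.

(** On a line in direction i the other factors are a constant [P], and the univariate transposition
    applies; only factor i changes. *)
Lemma opA_adjoint i j v f c : L2 mu Omega v -> bmeasN a b f ->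
  \int[mu]_(s in Omega) (opA i j v s c 0 * prodf f s) =
  \sum_c' \int[mu]_(s in Omega) (v s c' 0 * prodf (upf f i (fun t => adji i j (f i) t c c')) s).
Proof.
move=> hv bf.
have bfa c' : bmeasN a b (upf f i (fun t => adji i j (f i) t c c')).
  by apply: bmeasN_upf => //; apply: bmeas_adj; exact: bf.
have r1 := rint_prodf (rintO c (L2_opA i j hv)) bf.
have r2 c' := rint_prodf (rintO c' hv) (bfa c').
rewrite -Rint_sum//.
have r3 := rint_sum mO (index_enum _) r2.
rewrite (Rint_line i r1) (Rint_line i r3); apply: Rint_ae.
- exact: measurable_box.
- exact: rint_measurable (rint_line i r1).
- exact: rint_measurable (rint_line i r3).
have [mf [M M0 fM]] := bf i.
have fM' x : I i x -> `|f i x| <= M by rewrite /= in_itv/=; exact: fM.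
apply: filterS (ae_L2_line i hv) => x h bx.
have L1x := L2_L1 (h bx); pose P := prodf (fun k => f (lift i k)) x.
transitivity (\int[leb]_(t in I i) (P * (opA1i i j (fun t => v (ins i t x)) t c 0 * f i t))).
  by apply: Rint_eq => t _; rewrite opA_ins prodf_ins -/P; ring.
transitivity (\int[leb]_(t in I i) (P * (adji i j (f i) t *m v (ins i t x)) c 0)); last first.
  apply: Rint_eq => t _; rewrite mxE mulr_sumr; apply: eq_bigr => c' _.
  rewrite prodf_ins upf_same (_ : prodf _ x = P); first by ring.
  by congr prodf; apply/funext => k; rewrite upf_neq// eq_sym neq_lift.
rewrite !RintegralZl//.
- by rewrite (opA1_adjoint (@B i) (@C i) (ltab i) j c L1x mf fM').
- exact: (rint_adj (@B i) (@C i) (ltab i) j c L1x mf fM').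
- exact: (rintM _ (L2_L1 (L2_opA1 (@B i) (@C i) (ltab i) j (h bx)) c) mf fM').
Qed.

Lemma L2_ext u v : L2 mu Omega u -> L2 mu Omega v -> (forall c f, bmeasN a b f ->
  \int[mu]_(s in Omega) (u s c 0 * prodf f s) = \int[mu]_(s in Omega) (v s c 0 * prodf f s)) ->
  ae_eq mu Omega u v.
Proof.
move=> hu hv uv; apply/ae_eq_colP => c.
by apply: bmeas_ae_eq => [||f]; [exact: rintO|exact: rintO|exact: uv].
Qed.

Lemma ae_pairing u v c f : L2 mu Omega u -> L2 mu Omega v -> bmeasN a b f -> ae_eq mu Omega u v ->
  \int[mu]_(s in Omega) (u s c 0 * prodf f s) = \int[mu]_(s in Omega) (v s c 0 * prodf f s).
Proof.
move=> hu hv bf uv; apply: Rint_ae => //.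
- exact: rint_measurable (rint_prodf (rintO c hu) bf).
- exact: rint_measurable (rint_prodf (rintO c hv) bf).
- by apply: filterS uv => s h Os; rewrite h.
Qed.

(** The operator acts on representatives line by line; after transposition it acts on the test
    factor, and only the class of the argument counts. *)
Lemma opA_ae i j u v : L2 mu Omega u -> L2 mu Omega v -> ae_eq mu Omega u v ->
  ae_eq mu Omega (opA i j u) (opA i j v).
Proof.
move=> hu hv uv; apply: L2_ext; try exact: L2_opA.
move=> c f bf; rewrite !opA_adjoint//; apply: eq_bigr => c' _.
by apply: ae_pairing => //; apply: bmeasN_upf => //; apply: bmeas_adj; exact: bf.
Qed.

Lemma pairing_lin (x : R) u v c f : L2 mu Omega u -> L2 mu Omega v -> bmeasN a b f ->
  \int[mu]_(s in Omega) ((x *: u + v) s c 0 * prodf f s) =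
  x * \int[mu]_(s in Omega) (u s c 0 * prodf f s) + \int[mu]_(s in Omega) (v s c 0 * prodf f s).
Proof.
move=> hu hv bf; have ru := rint_prodf (rintO c hu) bf; have rv := rint_prodf (rintO c hv) bf.
rewrite (Rint_eq mu (g := fun s => x * (u s c 0 * prodf f s) + v s c 0 * prodf f s)).
  by rewrite RintegralD ?RintegralZl//; exact: rintZ.
by move=> s _; rewrite !mxE; ring.
Qed.

(** Only almost everywhere, since additivity of the integral may fail on lines where a
    representative is not integrable. *)
Lemma opA_lin i j (x : R) u v : L2 mu Omega u -> L2 mu Omega v ->
  ae_eq mu Omega (opA i j (x *: u + v)) (x *: opA i j u + opA i j v).
Proof.
move=> hu hv; have huv := L2_lin mO x hu hv; apply: L2_ext.
- exact: L2_opA.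
- by apply: L2_lin => //; exact: L2_opA.
move=> c f bf; rewrite pairing_lin//; try exact: L2_opA.
rewrite !opA_adjoint// mulr_sumr -big_split/=; apply: eq_bigr => c' _.
by rewrite pairing_lin//; apply: bmeasN_upf => //; apply: bmeas_adj; exact: bf.
Qed.

Hypothesis cons : consistent a b B C.

(** The values of the transposes are combinations of the identity and of the blocks of K^i,
    respectively K^i', and these blocks commute by consistency. *)
Lemma adj_comm i j i' j' f g t t' : i != i' ->
  adji i j f t *m adji i' j' g t' = adji i' j' g t' *m adji i j f t.
Proof.
move=> ii'; rewrite -/(comm_mx _ _) /adj.
case: ifP => _; last exact: comm_scalar_mx.
case: ifP => _; last exact: comm_mx_scalar.
apply: comm_mxB; first exact: comm_mx_scalar.
apply: comm_mx_sum => k' _; apply: comm_mx_sum => l' _; apply: comm_mx_sym.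
apply: comm_mxB; first exact: comm_mx_scalar.
apply: comm_mx_sum => k _; apply: comm_mx_sum => l _.
by rewrite /comm_mx -!scalemxAl -!scalemxAr [X in _ *: (_ *: X) = _]cons// 1?eq_sym// scalerA mulrC -scalerA.
Qed.

(* Paired with a product function, the two operators act on different factors,
   through matrices that commute by consistency. *)
Lemma opA_comm i j i' j' v : i != i' -> L2 mu Omega v ->
  ae_eq mu Omega (opA i j (opA i' j' v)) (opA i' j' (opA i j v)).
Proof.
move=> ii' hv; have i'i : i' != i by rewrite eq_sym.
apply: L2_ext; try by do 2 apply: L2_opA.
move=> c f bf.
have bu k l g p q : bmeasN a b g -> bmeasN a b (upf g k (fun t => adji k l (g k) t p q)).
  by move=> bg; apply: bmeasN_upf => //; apply: bmeas_adj; exact: bg.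
rewrite (opA_adjoint i j c (L2_opA i' j' hv) bf) (opA_adjoint i' j' c (L2_opA i j hv) bf).
under eq_bigr => c' _ do rewrite (opA_adjoint i' j' c' hv (bu i j f c c' bf)).
under [RHS]eq_bigr => c' _ do rewrite (opA_adjoint i j c' hv (bu i' j' f c c' bf)).
rewrite exchange_big [RHS]exchange_big/=; apply: eq_bigr => e _.
have bb k l k' l' p q p' q' := bu k' l' _ p' q' (bu k l f p q bf).
have rb k l k' l' p q p' q' := rint_prodf (rintO e hv) (bb k l k' l' p q p' q').
rewrite -(Rint_sum mO _ (fun c' => rb i j i' j' c c' c' e)) -(Rint_sum mO _ (fun c' => rb i' j' i j c c' c' e)).
apply: Rint_eq => s _; rewrite -!mulr_sumr; congr (_ * _).
have swap g g' : upf (upf f i g) i' g' = upf (upf f i' g') i g.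
  apply/funext => k; rewrite /upf; case: (k =P i') => [->|//].
  by rewrite (negbTE i'i).
pose P := prodf (upf (upf f i' (fun=> 1)) i (fun=> 1)) s.
transitivity ((adji i j (f i) (crd s i) *m adji i' j' (f i') (crd s i')) c e * P).
  rewrite mxE mulr_suml; apply: eq_bigr => c' _.
  rewrite prodf_upf swap prodf_upf upf_neq//.
  by rewrite /P; ring.
rewrite adj_comm// mxE mulr_suml; apply: eq_bigr => c' _.
rewrite prodf_upf -swap prodf_upf swap upf_neq//.
by rewrite /P; ring.
Qed.

End opA_slices.

(** * Multivariate test functions *)

Section test_functions.
Context (R : realType) (N : nat).
Local Notation leb := (@lebesgue_measure R).
Local Notation mR := (measurableTypeR R).
Implicit Types (phi : 'rV[R]_N -> R).

Lemma vec_ins i (h t : R) (x : pt R N.-1) :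
  vec (ins i (h + t) x) = h *: delta_mx 0 i + vec (ins i t x).
Proof.
apply/rowP => k; rewrite !mxE /crd !tnth_mktuple eqxx/=.
case: unliftP => [k' ->|->]; last by rewrite eqxx mulr1.
by rewrite eq_sym (negbTE (neq_lift _ _)) mulr0 add0r.
Qed.

Lemma derivable_slice i phi x t : derivable phi (vec (ins i t x)) (delta_mx 0 i) ->
  derivable (fun t : R => phi (vec (ins i t x))) t 1.
Proof.
rewrite /derivable (_ : (fun h => h^-1 *: ((_ \o shift t) _ - _)) = (fun h : R => h^-1 *:
  ((phi \o shift (vec (ins i t x))) (h *: delta_mx 0 i) - phi (vec (ins i t x)))))//.
by apply/funext => h /=; rewrite -[h *: 1]/(h * 1) mulr1 vec_ins.
Qed.

Lemma derive1_slice i phi x :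
  derive1 (fun t : R => phi (vec (ins i t x))) = (fun t : R => partial i phi (vec (ins i t x))).
Proof.
apply/funext => t; rewrite /derive1 /partial /derive.
rewrite (_ : (fun h => h^-1 *: (phi (vec (ins i (h + t) x)) - _)) = (fun h : R => h^-1 *:
  ((phi \o shift (vec (ins i t x))) (h *: delta_mx 0 i) - phi (vec (ins i t x)))))//.
by apply/funext => h /=; rewrite vec_ins.
Qed.

Lemma derive1n_slice i k phi x :
  derive1n k (fun t : R => phi (vec (ins i t x))) =
  (fun t : R => iter k (partial i) phi (vec (ins i t x))).
Proof.
by elim: k => [//|k IH]; rewrite derive1nS IH derive1_slice.
Qed.

Lemma foldr_nseq i k phi : foldr (@partial R N) phi (nseq k i) = iter k (partial i) phi.
Proof. by elim: k => //= k ->. Qed.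

Lemma vec_ins_continuous (i : 'I_N) (x : pt R N.-1) : continuous (fun t : R => vec (ins i t x)).
Proof.
move=> t; apply: cvg_mx => k l; rewrite ord1 !mxE /crd !tnth_mktuple.
under eq_fun do rewrite !mxE /crd tnth_mktuple.
by case: unliftP => [k' _|_]; [exact: cvg_cst|exact: cvg_id].
Qed.

Context (a b : 'I_N -> R).

Lemma test_slice i phi x : test_function a b phi ->
  test_function1 (a i) (b i) (fun t : R => phi (vec (ins i t x))).
Proof.
move=> [sphi cphi]; split.
  move=> k t; rewrite derive1n_slice; apply: derivable_slice.
  by have [_] := sphi (nseq k i); rewrite foldr_nseq; exact.
move=> t ct; rewrite /= in_itv/=.
have : closure [set x | phi x != 0] (vec (ins i t x)).
  move=> U /(@vec_ins_continuous i x t) nU.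
  by have [s [? ?]] := ct _ nU; exists (vec (ins i s x)).
by move=> /cphi /(_ i); rewrite mxE crd_ins.
Qed.

(** Where phi vanishes on a neighbourhood its difference quotients eventually vanish, so
    differentiating does not enlarge the support. *)
Lemma test_partial i phi : test_function a b phi -> test_function a b (partial i phi).
Proof.
move=> [sphi cphi]; split.
  by move=> l; have := sphi (rcons l i); rewrite foldr_rcons.
apply: subset_trans cphi => x cx U /nbhs_interior nU.
have [y [/= py Uy]] := cx _ nU.
apply: contrapT => /forallNP h; move: py; rewrite /partial /derive.
have -> : lim (h^-1 *: ((phi \o shift y) (h *: delta_mx 0 i) - phi y) @[h --> 0^']) = 0.
  apply: cvg_lim => //.
  have phi0 z : U z -> phi z = 0.
    by move=> Uz; apply/eqP/negPn/negP => pz; apply: (h z).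
  apply: cvg_near_cst.
  have cy : {for 0, continuous (fun h : R => h *: delta_mx 0 i + y : 'rV[R]_N)}.
    by apply: cvgD; [apply: cvgZr_tmp; exact: cvg_id|exact: cvg_cst].
  have : \forall h \near (0 : R), U (h *: delta_mx 0 i + y).
    by apply: cy; rewrite scale0r add0r.
  move=> /(@nbhs_dnbhs _ _ _); apply: filterS => k Uk.
  by rewrite /= phi0// phi0 ?subrr ?scaler0//; exact: interior_subset.
by rewrite eqxx.
Qed.

(** Points carry the product sigma-algebra and row vectors a topology; the link is that an open set
    is a countable union of cubes with rational centres and radii. *)
Lemma measurable_vec_open (U : set 'rV[R]_N) : open U -> measurable (@vec R N @^-1` U).
Proof.
move=> oU.
pose W (p : 'rV[rat]_N * rat) : set (pt R N) :=
  [set s | forall i, `|crd s i - ratr (p.1 0 i)| < ratr p.2].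
pose G : set ('rV[rat]_N * rat) := [set p | W p `<=` @vec R N @^-1` U].
have -> : @vec R N @^-1` U = \bigcup_(p in G) W p.
  apply/seteqP; split => [s /= Us|s [p Gp Wp]]; last exact: Gp.
  have := open_nbhs_nbhs (conj oU Us); rewrite -nbhs_ballE => -[e/= e0 he].
  have [r r0 re] : exists2 r : rat, 0 < (ratr r : R) & ratr r < e / 2.
    have [|r] := @rat_in_itvoo R 0 (e / 2); first by rewrite divr_gt0.
    by rewrite in_itv/= => /andP[? ?]; exists r.
  have /choice[q hq] : forall i, exists q : rat, `|crd s i - ratr q| < ratr r.
    move=> i; have [|q] := @rat_in_itvoo R (crd s i - ratr r) (crd s i + ratr r); first by lra.
    by rewrite in_itv/= => /andP[? ?]; exists q; rewrite ltr_norml; apply/andP; split; lra.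
  exists (\row_i q i, r); last by move=> i /=; rewrite mxE.
  move=> s' /= Ws'; apply: he; split => // k i; rewrite ord1 !mxE.
  have := Ws' i; rewrite mxE/= => h1; have h2 := hq i.
  rewrite /ball/= (_ : _ - _ = (crd s i - ratr (q i)) - (crd s' i - ratr (q i))); last by ring.
  by apply: le_lt_trans (ler_normB _ _) _; lra.
rewrite bigcup_mkcond; apply: countable_bigcupT_measurable; first exact: countableP.
move=> p; case: ifP => // _.
rewrite (_ : W p = \bigcap_i (fun s => `|crd s i - ratr (p.1 0 i)|) @^-1` [set t : R | t < ratr p.2]); last first.
  by apply/seteqP; split => s /= h i; [move=> _|]; exact: h.
apply: fin_bigcap_measurable; first exact: finite_finset.
move=> i _; rewrite -[X in measurable X]setTI.
have mc : measurable_fun setT (fun s : pt R N => `|crd s i - ratr (p.1 0 i)|).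
  by apply: measurableT_comp => //; apply: measurable_funB => //; exact: measurable_crd.
rewrite (_ : [set t : R | _] = `]-oo, (ratr p.2 : R)[%classic); last by apply/seteqP; split => t /=; rewrite in_itv.
by apply: mc => //; exact: measurable_itv.
Qed.

Lemma measurable_vec_continuous phi (D : set (pt R N)) : measurable D -> continuous phi ->
  measurable_fun D (fun s => phi (vec s)).
Proof.
move=> mD /continuousP cphi; apply: measurable_funTS.
apply: (measurability _ (RGenOpens.measurableE R)).
move=> _ [_ [p [q ->] <-]]; rewrite setTI.
exact: (measurable_vec_open (cphi _ (interval_open _ _))).
Qed.

Lemma test_vec_bounded phi : continuous phi ->
  exists2 M : R, 0 <= M & forall s, (box a b : set (pt R N)) s -> `|phi (vec s)| <= M.
Proof.
move=> cphi.
have cK : compact [set v : 'rV[R]_N | forall i, `[a i, b i]%classic (v 0 i)].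
  by apply: (@rV_compact R N (fun i => `[a i, b i]%classic)) => i; exact: segment_compact.
have := continuous_compact (continuous_subspaceT cphi) cK.
move=> /compact_bounded [M [_ hM]].
exists (`|M| + 1) => // s bs; apply: (hM (`|M| + 1)).
  by rewrite (le_lt_trans (ler_norm _))// ltrDl.
exists (vec s) => // i; rewrite mxE /= in_itv/=; exact: bs.
Qed.

End test_functions.

(** * Test functions of product form *)

Section product_tests.
Context (R : realType) (N : nat).

Definition prodT (f : 'I_N -> R -> R) (x : 'rV[R]_N) : R := \prod_i f i (x 0 i).

Lemma prodT_vec f s : prodT f (vec s) = prodf f s.
Proof. by apply: eq_bigr => i _; rewrite mxE. Qed.

Lemma prodT_shift f i (h : R) (x : 'rV[R]_N) :
  prodT f (h *: delta_mx 0 i + x) = f i (h + x 0 i) * \prod_(k | k != i) f k (x 0 k).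
Proof.
rewrite /prodT (bigD1 i)//= !mxE !eqxx mulr1; congr (_ * _).
by apply: eq_bigr => k ki; rewrite !mxE eqxx (negbTE ki) mulr0 add0r.
Qed.

Lemma prodT_partial f i x : (forall k, smooth1 (f k)) ->
  derivable (prodT f) x (delta_mx 0 i) /\
  partial i (prodT f) x = prodT (upf f i (derive1 (f i))) x.
Proof.
move=> sf; have d1 : derivable (f i) (x 0 i) 1 by exact: (sf i 0%N).
pose P := \prod_(k | k != i) f k (x 0 k).
have : h^-1 *: ((prodT f \o shift x) (h *: delta_mx 0 i) - prodT f x) @[h --> 0^'] -->
    derive1 (f i) (x 0 i) * P.
  have -> : (fun h : R => h^-1 *: ((prodT f \o shift x) (h *: delta_mx 0 i) - prodT f x)) =
     (fun h : R => h^-1 *: (f i (h + x 0 i) - f i (x 0 i)) * P).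
    apply/funext => h /=; rewrite prodT_shift -[x in prodT f x]add0r -(scale0r (delta_mx 0 i)).
    by rewrite prodT_shift add0r -mulrBl -scalerAl.
  apply: cvgM; last exact: cvg_cst.
  have := d1; rewrite /derivable; set g := (fun h => _); set g' := (fun h => _).
  have -> : g = g' by apply/funext => h; rewrite /g /g' /= -[h *: 1]/(h * 1) mulr1.
  exact.
move=> hc; split; first by apply/cvg_ex; eexists; exact: hc.
rewrite /partial /derive (cvg_lim _ hc)// /prodT [RHS](bigD1 i)//= upf_same; congr (_ * _).
by apply: eq_bigr => k ki; rewrite upf_neq.
Qed.

Lemma prodT_continuous f : (forall k, smooth1 (f k)) -> continuous (prodT f).
Proof.
move=> sf; rewrite /prodT; elim: (index_enum _) => [|i r IH] x.
  rewrite (_ : (fun x => _) = cst 1); first exact: cst_continuous.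
  by apply/funext => y; rewrite big_nil.
rewrite (_ : (fun x : 'rV[R]_N => _) = (fun x : 'rV[R]_N => f i (x 0 i) * \prod_(k <- r) f k (x 0 k))); last first.
  by apply/funext => y; rewrite big_cons.
have hi : {for x, continuous (fun x : 'rV[R]_N => f i (x 0 i))}.
  apply: (@continuous_comp _ _ _ (fun x : 'rV[R]_N => x 0 i) (f i)); first exact: coord_continuous.
  exact: smooth1_continuous.
exact: continuousM hi (IH x).
Qed.

Lemma smooth1_upf (f : 'I_N -> R -> R) i k : (forall k, smooth1 (f k)) ->
  forall l, smooth1 (upf f i (derive1n k (f i)) l).
Proof.
by move=> sf l; rewrite /upf; case: eqP => // _; exact: smooth1_derive1n.
Qed.

Lemma foldr_prodT f (l : seq 'I_N) : (forall k, smooth1 (f k)) ->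
  exists2 g, (forall k, smooth1 (g k)) & foldr (@partial R N) (prodT f) l = prodT g.
Proof.
move=> sf; elim: l => [|i l [g sg e]]; first by exists f.
exists (upf g i (derive1 (g i))); first exact: (@smooth1_upf g i 1).
by rewrite /= e; apply/funext => x; have [] := prodT_partial i x sg.
Qed.

Lemma test_prodT (a b : 'I_N -> R) f : (forall i, test_function1 (a i) (b i) (f i)) ->
  test_function a b (prodT f).
Proof.
move=> tf; have sf k : smooth1 (f k) by have [] := tf k.
split.
  move=> l; have [g sg ->] := foldr_prodT l sf; split; first exact: prodT_continuous.
  by move=> i x; have [] := prodT_partial i x sg.
move=> x cx i; have [_ cf] := tf i.
have := cf (x 0 i); rewrite /= in_itv/=; apply => U nU.
have [|y [/= fy Uy]] := cx ((fun x : 'rV[R]_N => x 0 i) @^-1` U).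
  exact: (coord_continuous nU).
exists (y 0 i); split => //=; apply: contra fy => /eqP fy.
by rewrite /prodT (bigD1 i)//= fy mul0r.
Qed.

Lemma iter_partial_prodT f i k : (forall k, smooth1 (f k)) ->
  iter k (partial i) (prodT f) = prodT (upf f i (derive1n k (f i))).
Proof.
move=> sf; elim: k => [|k IH]; first by rewrite /= upf_id.
rewrite iterS IH; apply/funext => x.
have [_ ->] := prodT_partial i x (@smooth1_upf f i k sf).
by rewrite upf_upf upf_same derive1nS.
Qed.

Lemma partials_prodT f alpha : (forall k, smooth1 (f k)) ->
  partials alpha (prodT f) = prodT (fun i => derive1n (alpha i) (f i)).
Proof.
move=> sf; rewrite /partials.
have H r : uniq r -> (\big[comp/id]_(i <- r) iter (alpha i) (@partial R N i)) (prodT f) =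
    prodT (fun i => if i \in r then derive1n (alpha i) (f i) else f i).
  elim: r => [|i r IH]; first by rewrite big_nil.
  rewrite cons_uniq big_cons => /andP[ir ur] /=; rewrite IH// iter_partial_prodT.
    congr prodT; apply/funext => k; rewrite /upf inE.
    by case: eqP => [->|//]; rewrite (negbTE ir).
  by move=> k; case: ifP => // _; exact: smooth1_derive1n.
rewrite H; last exact: index_enum_uniq.
by congr prodT; apply/funext => i; rewrite mem_index_enum.
Qed.

End product_tests.

(** * Weak derivatives of the operators *)

Section weak_derivatives.
Context (R : realType) (N n : nat) (a b : 'I_N -> R).
Hypothesis ltab : forall i, a i < b i.
Variable delta : 'I_N -> nat.
Variables B C : forall i, 'I_(delta i) -> 'I_(delta i) -> 'M[R]_n.
Local Notation leb := (@lebesgue_measure R).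
Local Notation mR := (measurableTypeR R).
Local Notation Omega := (box a b : set (pt R N)).
Local Notation box' i := (box (a \o lift i) (b \o lift i) : set (pt R N.-1)).
Local Notation mu := (lebn R N).
Local Notation I i := (`[a i, b i]%classic : set mR).
Local Notation opA := (opA a b B C).
Local Notation opA1i i := (opA1 (a i) (b i) (@B i) (@C i)).
Local Notation F := (pt R N -> 'cV[R]_n).
Implicit Types (v w : F) (phi : 'rV[R]_N -> R).

Let mO : measurable Omega. Proof. exact: measurable_box. Qed.

Local Opaque Defs.opA opA1.

Lemma test_continuous phi : test_function a b phi -> continuous phi.
Proof. by move=> [/(_ [::]) []]. Qed.

Lemma test_iter i k phi : test_function a b phi -> test_function a b (iter k (partial i) phi).
Proof. by move=> tphi; elim: k => //= k; exact: test_partial. Qed.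

Lemma test_partials_seq alpha r phi : test_function a b phi ->
  test_function a b ((\big[comp/id]_(i <- r) iter (alpha i) (partial i)) phi).
Proof.
move=> tphi; elim: r => [|k r IH]; first by rewrite big_nil.
by rewrite big_cons; exact: test_iter.
Qed.

Lemma test_partials alpha phi : test_function a b phi -> test_function a b (partials alpha phi).
Proof. exact: test_partials_seq. Qed.

Lemma rint_vec (h : pt R N -> R) phi : mu.-integrable Omega (EFin \o h) -> continuous phi ->
  mu.-integrable Omega (EFin \o (fun s => h s * phi (vec s))).
Proof.
move=> rh cphi; have [M M0 hM] := test_vec_bounded a b cphi.
by apply: (rintM _ rh _ hM) => //; exact: measurable_vec_continuous.
Qed.

Lemma opA_weak i j v phi c : (j <= delta i)%N -> L2 mu Omega v -> test_function a b phi ->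
  \int[mu]_(s in Omega) (opA i 0 v s c 0 * iter j (partial i) phi (vec s)) =
  (-1) ^+ j * \int[mu]_(s in Omega) (opA i j v s c 0 * phi (vec s)).
Proof.
move=> ji hv tphi.
have r0 := rint_vec (rintO c (L2_opA ltab B C i 0 hv)) (test_continuous (test_iter i j tphi)).
have r1 := rint_vec (rintO c (L2_opA ltab B C i j hv)) (test_continuous tphi).
rewrite -RintegralZl//; have r2 := rintZ mO ((-1) ^+ j) r1.
rewrite (Rint_line i r0) (Rint_line i r2); apply: Rint_ae.
- exact: measurable_box.
- exact: rint_measurable (rint_line i r0).
- exact: rint_measurable (rint_line i r2).
apply: filterS (ae_L2_line i hv) => x h bx.
have L1x := L2_L1 (h bx); have tx := test_slice i x tphi.
have wx := weak_opA1 (@B i) (@C i) (ltab i) L1x ji tx c; move: wx; rewrite derive1n_slice => wx.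
have rx := rint_test (L2_L1 (L2_opA1 (@B i) (@C i) (ltab i) j (h bx)) c) tx.
have mI := measurable_cc (a i) (b i); have e1 := RintegralZl ((-1) ^+ j) mI rx.
transitivity (\int[leb]_(t in I i) (opA1i i 0 (fun th => v (ins i th x)) t c 0 *
    iter j (partial i) phi (vec (ins i t x)))).
  by apply: Rint_eq => t _; rewrite opA_ins.
by rewrite wx -e1; apply: Rint_eq => t _; rewrite opA_ins.
Qed.

(** Partial products over a sequence of directions, on which the inductions run; the full sequence
    of indices gives T. *)
Local Notation opL alpha r := (\big[comp/id]_(i <- r) opA i (alpha i)).

Lemma L2_opL alpha r v : L2 mu Omega v -> L2 mu Omega (opL alpha r v).
Proof.
move=> hv; elim: r => [|i r IH]; rewrite ?big_nil// big_cons/=; exact: L2_opA.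
Qed.

Lemma opL_bound alpha r : exists2 K0 : R, 0 <= K0 & forall v, L2 mu Omega v ->
  sqn mu Omega (opL alpha r v) <= K0 * sqn mu Omega v.
Proof.
elim: r => [|i r [K0 K00 IH]].
  by exists 1 => // v _; rewrite big_nil mul1r.
have [K1 K10 h] := opA_L2_bound ltab B C i (alpha i).
exists (K1 * K0); first exact: mulr_ge0.
move=> v hv; rewrite big_cons/=; have [_ h1] := h _ (L2_opL alpha r hv).
by apply: le_trans h1 _; rewrite -mulrA ler_wpM2l// IH.
Qed.

Lemma opL_ae alpha r u v : L2 mu Omega u -> L2 mu Omega v -> ae_eq mu Omega u v ->
  ae_eq mu Omega (opL alpha r u) (opL alpha r v).
Proof.
move=> hu hv uv; elim: r => [|i r IH]; first by rewrite big_nil.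
by rewrite !big_cons/=; apply: opA_ae => //; exact: L2_opL.
Qed.

Lemma opL_lin alpha r (x : R) u v : L2 mu Omega u -> L2 mu Omega v ->
  ae_eq mu Omega (opL alpha r (x *: u + v)) (x *: opL alpha r u + opL alpha r v).
Proof.
move=> hu hv; elim: r => [|i r IH]; first by rewrite !big_nil; exact: ae_eq_refl.
have hu' := L2_opL alpha r hu; have hv' := L2_opL alpha r hv.
rewrite !big_cons/=; apply: ae_eq_trans (opA_lin ltab B C i (alpha i) x hu' hv').
by apply: opA_ae => //; [apply: L2_opL|]; exact: L2_lin.
Qed.

Hypothesis cons : consistent a b B C.

Lemma opL_opA alpha r i j v : i \notin r -> L2 mu Omega v ->
  ae_eq mu Omega (opL alpha r (opA i j v)) (opA i j (opL alpha r v)).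
Proof.
move=> + hv; elim: r => [|k r IH]; first by rewrite !big_nil; move=> _; exact: ae_eq_refl.
rewrite inE negb_or => /andP[ik ir]; rewrite !big_cons/=.
have hr := L2_opL alpha r hv.
have ki : k != i by rewrite eq_sym.
apply: ae_eq_trans (opA_comm ltab cons (alpha k) j ki hr).
apply: opA_ae => //; last exact: IH.
  by apply: L2_opL; exact: L2_opA.
exact: L2_opA.
Qed.

Lemma ae_pairing_vec u v phi c : L2 mu Omega u -> L2 mu Omega v -> continuous phi ->
  ae_eq mu Omega u v ->
  \int[mu]_(s in Omega) (u s c 0 * phi (vec s)) = \int[mu]_(s in Omega) (v s c 0 * phi (vec s)).
Proof.
move=> hu hv tp uv; apply: Rint_ae => //.
- exact: rint_measurable (rint_vec (rintO c hu) tp).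
- exact: rint_measurable (rint_vec (rintO c hv) tp).
- by apply: filterS uv => s h Os; rewrite h.
Qed.

(** The outermost direction is differentiated first by [opA_weak]; the resulting A_{i,alpha_i} is
    then moved inside past the others, so that the induction hypothesis applies to A_{i,alpha_i} v,
    and finally moved back out. Distinct directions are what makes both moves possible. *)
Lemma opL_weak alpha r v phi c : uniq r -> (forall i, (alpha i <= delta i)%N) ->
  L2 mu Omega v -> test_function a b phi ->
  \int[mu]_(s in Omega) (opL (fun=> 0%N) r v s c 0 *
     (\big[comp/id]_(i <- r) iter (alpha i) (partial i)) phi (vec s)) =
  (-1) ^+ (\sum_(i <- r) alpha i)%N * \int[mu]_(s in Omega) (opL alpha r v s c 0 * phi (vec s)).
Proof.
move=> + ad hv tphi; elim: r v hv => [|i r IH] v hv; first by rewrite !big_nil mul1r.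
rewrite cons_uniq => /andP[ir ur]; rewrite !big_cons /=.
have tr := test_partials_seq alpha r tphi.
have h0 := L2_opL (fun=> 0%N) r hv; have hi := L2_opA ltab B C i (alpha i) hv.
rewrite (opA_weak c (ad i) h0 tr) exprD -mulrA; congr (_ * _).
have e1 := ae_eq_sym (opL_opA (fun=> 0%N) (alpha i) ir hv).
have h1 := L2_opA ltab B C i (alpha i) h0; have h2 := L2_opL (fun=> 0%N) r hi.
have h3 := L2_opL alpha r hi; have h4 := L2_opA ltab B C i (alpha i) (L2_opL alpha r hv).
rewrite (ae_pairing_vec c h1 h2 (test_continuous tr) e1) (IH _ hi ur); congr (_ * _).
exact: (ae_pairing_vec c h3 h4 (test_continuous tphi) (opL_opA alpha (alpha i) ir hv)).
Qed.

Local Notation opT := (opT a b B C).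

Lemma opTE v : opT v = opL (fun=> 0%N) (index_enum _) v. Proof. by []. Qed.

Lemma L2_opT v : L2 mu Omega v -> L2 mu Omega (opT v).
Proof. by rewrite opTE; exact: L2_opL. Qed.

Lemma weak_opT alpha v : (forall i, (alpha i <= delta i)%N) -> L2 mu Omega v ->
  weak_deriv a b alpha (opT v) ((\big[comp/id]_(i < N) opA i (alpha i)) v).
Proof.
move=> ad hv phi tphi c; rewrite /partials opTE.
by apply: opL_weak => //; exact: index_enum_uniq.
Qed.

Lemma weak_deriv_unique alpha (u p q : F) : L2 mu Omega p -> L2 mu Omega q ->
  weak_deriv a b alpha u p -> weak_deriv a b alpha u q -> ae_eq mu Omega p q.
Proof.
move=> hp hq wp wq; apply/ae_eq_colP => c; apply: test_ae_eq => //; try exact: rintO.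
move=> f tf; apply/(mulfI (sign_neq0 R (\sum_i alpha i))).
have E (z : F) : \int[mu]_(s in Omega) (z s c 0 * prodf f s) =
    \int[mu]_(s in Omega) (z s c 0 * prodT f (vec s)).
  by apply: Rint_eq => s _; rewrite prodT_vec.
by rewrite !E -(wp _ (test_prodT tf) c) -(wq _ (test_prodT tf) c).
Qed.

End weak_derivatives.

(** * The domains *)

Lemma univ_domain_ae (R : realType) (n d : nat) (a b : R) (B C : 'I_d -> 'I_d -> 'M[R]_n)
    (u u' : R -> 'cV[R]_n) : a < b -> L2 (@lebesgue_measure R) `[a, b] u ->
  L2 (@lebesgue_measure R) `[a, b] u' ->
  ae_eq (@lebesgue_measure R) `[a, b]%classic u u' -> univ_domain a b B C u' ->
  univ_domain a b B C u.
Proof.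
move=> ab hu hu' uu' [[_ wu'] [g [wg bg]]].
have wk k w : weak_deriv1 a b k u' w -> weak_deriv1 a b k u w.
  move=> h f tf c; rewrite -h//; have tk := test_derive1n k tf.
  have r := rint_test (L2_L1 hu c) tk; have r' := rint_test (L2_L1 hu' c) tk.
  apply: Rint_ae; first exact: (measurable_cc a b).
  - exact: rint_measurable r.
  - exact: rint_measurable r'.
  - by apply: filterS uu' => x h' Ix; rewrite h'.
split; last by exists g; split => // k; have [? ?] := wg k; split => //; exact: wk.
by split => // k kd; have [w hw ww] := wu' k kd; exists w => //; exact: wk.
Qed.

Section domains.
Context (R : realType) (N n : nat) (a b : 'I_N -> R).
Hypothesis ltab : forall i, a i < b i.
Variable delta : 'I_N -> nat.
Variables B C : forall i, 'I_(delta i) -> 'I_(delta i) -> 'M[R]_n.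
Hypothesis adm : forall i, admissible (a i) (b i) (@B i) (@C i).
Hypothesis cons : consistent a b B C.
Local Notation leb := (@lebesgue_measure R).
Local Notation mR := (measurableTypeR R).
Local Notation Omega := (box a b : set (pt R N)).
Local Notation box' i := (box (a \o lift i) (b \o lift i) : set (pt R N.-1)).
Local Notation mu := (lebn R N).
Local Notation I i := (`[a i, b i]%classic : set mR).
Local Notation opA := (opA a b B C).
Local Notation opT := (opT a b B C).
Local Notation opA1i i := (opA1 (a i) (b i) (@B i) (@C i)).
Local Notation opL alpha r := (\big[comp/id]_(i <- r) opA i (alpha i)).
Local Notation F := (pt R N -> 'cV[R]_n).
Implicit Types (u v w : F) (phi : 'rV[R]_N -> R).

Let mO : measurable Omega. Proof. exact: measurable_box. Qed.

Local Opaque Defs.opA opA1.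

(** Commutation brings any chosen direction to the front. This exhibits T v as A_{i,0} z for each i,
    and hence as a member of every lifted domain. *)
Lemma opL_front alpha r i v : i \in r -> uniq r -> L2 mu Omega v ->
  exists2 z, L2 mu Omega z & ae_eq mu Omega (opL alpha r v) (opA i (alpha i) z).
Proof.
move=> + + hv; elim: r => [//|k r IH]; rewrite inE cons_uniq => + /andP[kr ur].
rewrite big_cons /=; have [<- _|ik /= ir] := eqVneq i k.
  by exists (opL alpha r v); [exact: L2_opL|exact: ae_eq_refl].
have [z hz rz] := IH ir ur; exists (opA k (alpha k) z); first exact: L2_opA.
have ki : k != i by rewrite eq_sym.
apply: ae_eq_trans (opA_comm ltab cons (alpha k) (alpha i) ki hz).
apply: (opA_ae ltab _ _ _ _ _ _ rz); first exact: L2_opL.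
exact: (L2_opA ltab _ _ _ _ hz).
Qed.

Lemma weak_deriv_ae alpha u u' w : L2 mu Omega u -> L2 mu Omega u' -> ae_eq mu Omega u u' ->
  weak_deriv a b alpha u w -> weak_deriv a b alpha u' w.
Proof.
move=> hu hu' uu' h phi tphi c; rewrite -h//; apply: ae_pairing_vec => //; last exact: ae_eq_sym.
exact: test_continuous (test_partials alpha tphi).
Qed.

Lemma S2_opT delta' v : (forall i, (delta' i <= delta i)%N) -> L2 mu Omega v ->
  S2 a b delta' (opT v).
Proof.
move=> dd hv; split; first exact: L2_opT.
move=> alpha ad; exists ((\big[comp/id]_(i < N) opA i (alpha i)) v); first exact: L2_opL.
by apply: weak_opT => // i; apply: leq_trans (ad i) (dd i).
Qed.

Lemma domain_opT v : L2 mu Omega v -> domain a b B C (opT v).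
Proof.
move=> hv; have hT := L2_opT ltab B C hv; split; first exact: S2_opT.
move=> i; split; first by apply: S2_opT => // j; case: eqP => [->|].
have [z hz rz] := opL_front (fun=> 0%N) (mem_index_enum i) (index_enum_uniq _) hv.
have := ae_line i rz; have := ae_L2_line i hz; have := ae_L2_line i hT.
apply: filterS3 => x hTx hzx ex bx.
have {}hTx := hTx bx; have {}hzx := hzx bx; have {}ex := ex bx.
have hz1 := L2_opA1 (@B i) (@C i) (ltab i) 0 hzx.
apply: (univ_domain_ae (ltab i) hTx hz1); last exact: univ_domain_opA1.
by apply: filterS ex => t h It; rewrite -opA_ins -h.
Qed.

Lemma weak_deriv_prodf alpha u w f c : (forall i, test_function1 (a i) (b i) (f i)) ->
  weak_deriv a b alpha u w ->
  \int[mu]_(s in Omega) (u s c 0 * prodf (fun i => derive1n (alpha i) (f i)) s) =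
  (-1) ^+ (\sum_i alpha i)%N * \int[mu]_(s in Omega) (w s c 0 * prodf f s).
Proof.
move=> tf h; have sf k : smooth1 (f k) by have [] := tf k.
have := h _ (test_prodT tf) c; rewrite partials_prodT//.
have E (z : F) g : \int[mu]_(s in Omega) (z s c 0 * prodT g (vec s)) =
    \int[mu]_(s in Omega) (z s c 0 * prodf g s).
  by apply: Rint_eq => s _; rewrite prodT_vec.
by rewrite !E.
Qed.

Lemma sum_single i d : (\sum_(j < N) (if j == i then d else 0%N))%N = d.
Proof. by rewrite -big_mkcond/= big_pred1_eq. Qed.

Definition slotf i (p : 'I_N.-1 -> R -> R) (g : R -> R) : 'I_N -> R -> R :=
  fun k => if unlift i k is Some k' then p k' else g.

Lemma prodf_slotf i p g t x : prodf (slotf i p g) (ins i t x) = g t * prodf p x.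
Proof.
rewrite prodf_ins /slotf unlift_none; congr (_ * _).
by apply: eq_bigr => k _; rewrite liftK.
Qed.

(** The difference of the two line integrals is a function of the remaining variables. Tested
    against products, it gives the weak derivative identity of u for a test function of product
    form, hence 0. The exceptional set of lines depends on [f]. *)
Lemma weak_line i d u w f c : L2 mu Omega u -> L2 mu Omega w ->
  weak_deriv a b (fun j => if j == i then d else 0%N) u w -> test_function1 (a i) (b i) f ->
  {ae lebn R N.-1, forall x, box' i x ->
    \int[leb]_(t in I i) (u (ins i t x) c 0 * derive1n d f t - (-1) ^+ d * (w (ins i t x) c 0 * f t)) = 0}.
Proof.
move=> hu hw uw tf.
have slot h (g : R -> R) : mu.-integrable Omega (EFin \o h) -> test_function1 (a i) (b i) g ->
    mu.-integrable Omega (EFin \o (fun s => h s * g (crd s i))).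
  move=> rh tg; have [M _ gM] := test_bounded tg.
  apply: (rintM mO rh (M := M)) => // s.
  by apply: measurable_crd_comp; have [] := bmeas_test tg.
have r1 := slot _ _ (rintO c hu) (test_derive1n d tf).
have r2 := rintZ mO ((-1) ^+ d) (slot _ _ (rintO c hw) tf).
have rh := rintB mO r1 r2.
have := rint_line i rh.
set H := (fun x => \int[leb]_(t in _) _) => rH.
have HE x : H x = \int[leb]_(t in I i) (u (ins i t x) c 0 * derive1n d f t - (-1) ^+ d * (w (ins i t x) c 0 * f t)).
  by apply: Rint_eq => t _; rewrite crd_ins.
have : ae_eq (lebn R N.-1) (box' i) H (cst 0).
  apply: test_ae0 => //; first by move=> k; exact: ltab.
  move=> p tp.
  have tF g : test_function1 (a i) (b i) g -> forall k, test_function1 (a k) (b k) (slotf i p g k).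
    by move=> tg k; rewrite /slotf; case: unliftP => [k' ->|->//]; exact: tp.
  have bF g : test_function1 (a i) (b i) g -> bmeasN a b (slotf i p g).
    by move=> tg k; apply: bmeas_test; exact: tF.
  have s1 := rint_prodf (rintO c hu) (bF _ (test_derive1n d tf)).
  have s2 := rintZ mO ((-1) ^+ d) (rint_prodf (rintO c hw) (bF _ tf)).
  transitivity (\int[mu]_(s in Omega) (u s c 0 * prodf (slotf i p (derive1n d f)) s -
     (-1) ^+ d * (w s c 0 * prodf (slotf i p f) s))).
    rewrite (Rint_line i (rintB mO s1 s2)); apply: Rint_ae.
    - exact: measurable_box.
    - apply: rint_measurable (rint_prodf rH _) => k; exact: bmeas_test.
    - exact: rint_measurable (rint_line i (rintB mO s1 s2)).
    apply: filterS (ae_integrable_line i rh) => x rx bx; have {}rx := rx bx.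
    rewrite mulrC /H -(RintegralZl _ (measurable_cc (a i) (b i)) rx); apply: Rint_eq => t _.
    by rewrite crd_ins !prodf_slotf; ring.
  rewrite RintegralB// RintegralZl; last 2 first => //.
    exact: (rint_prodf (rintO c hw) (bF _ tf)).
  have := weak_deriv_prodf c (tF _ tf) uw; rewrite sum_single => <-.
  apply/eqP; rewrite subr_eq0; apply/eqP; apply: Rint_eq => s _; congr (_ * _).
  apply: eq_bigr => k _; rewrite /slotf; case: unliftP => [k' ->|->]; last by rewrite eqxx.
  by rewrite eq_sym (negbTE (neq_lift _ _)).
by apply: filterS => x h bx; rewrite -HE h.
Qed.

(* The weak derivative of u along a line is determined by countably many bump
   functions, so a single null set of lines has to be discarded. *)
Lemma lifted_inverse i u w : lifted_domain a b i (@B i) (@C i) u -> L2 mu Omega w ->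
  weak_deriv a b (fun j => if j == i then delta i else 0%N) u w ->
  ae_eq mu Omega u (opA i 0 w).
Proof.
move=> [[hu _] du] hw uw; set d := delta i.
pose good c (om : option rat * nat) x :=
  \int[leb]_(t in I i) (u (ins i t x) c 0 * derive1n d (sbump (lo (a i) om.1) (b i) om.2) t -
    (-1) ^+ d * (w (ins i t x) c 0 * sbump (lo (a i) om.1) (b i) om.2 t)) = 0.
have ag : {ae lebn R N.-1, forall x, forall c, forall om, box' i x -> good c om x}.
  apply: ae_forall_ord => c.
  have : {ae lebn R N.-1, forall x, forall k : nat,
      if unpickle k is Some om then box' i x -> good c om x else True}.
    apply/ae_foralln => k; case: unpickle => [om|]; last by apply: aeW.
    by apply: weak_line => //; apply: test_sbump => //; exact: lo_ge.
  by apply: filterS => x h om; have := h (pickle om); rewrite pickleK.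
apply/ae_eq_colP => c; apply: (@ae_eq_of_line _ _ i).
- by have [] := hu c.
- by have [] := L2_opA ltab B C i 0 hw c.
have hL : {ae lebn R N.-1, forall x, box' i x -> L2 leb (I i) (fun t => u (ins i t x)) /\
    L2 leb (I i) (fun t => w (ins i t x))}.
  by have := ae_L2_line i hw; have := ae_L2_line i hu; apply: filterS2 => x h h' bx; split; auto.
have := hL; have := du; have := ag; apply: filterS3 => x hg hd huw bx.
have [hux hwx] := huw bx.
have dx := hd bx.
have [[_ hW] _] := dx; have [W L2W wW] := hW d (leqnn _).
(* Membership in the domain supplies some weak derivative W on the line. The bump functions alone
   identify it with the restriction of w, after which every test function on the line is covered. *)
have Ww : ae_eq leb (I i) W (fun t => w (ins i t x)).
  apply/ae_eq_colP => e.
  have rW := L2_L1 L2W e; have rw := L2_L1 hwx e.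
  apply: fundamental1_eq => // o m; have := hg e (o, m) bx; rewrite /good /=.
  set f := sbump _ _ _.
  have tf : test_function1 (a i) (b i) f by apply: test_sbump => //; exact: lo_ge.
  have rwf := rint_test rw tf; have mI := measurable_cc (a i) (b i).
  rewrite RintegralB//; last 2 first.
    exact: rint_test (L2_L1 hux e) (test_derive1n d tf).
    exact: rintZ.
  rewrite (wW _ tf e) RintegralZl// -mulrBr => /eqP.
  by rewrite mulf_eq0 (negbTE (sign_neq0 _ _))/= subr_eq0 => /eqP.
have ww : weak_deriv1 (a i) (b i) d (fun t => u (ins i t x)) (fun t => w (ins i t x)).
  move=> f tf e; rewrite (wW _ tf e); congr (_ * _); apply: Rint_ae.
  - exact: (measurable_cc (a i) (b i)).
  - exact: rint_measurable (rint_test (L2_L1 L2W e) tf).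
  - exact: rint_measurable (rint_test (L2_L1 hwx e) tf).
  - by apply: filterS Ww => t h It; rewrite h.
have := opA1_inverse (ltab i) (adm i) dx hwx ww.
by apply: filterS => t h It; rewrite h// opA_ins.
Qed.

Lemma weak_deriv0 u w : L2 mu Omega u -> L2 mu Omega w ->
  weak_deriv a b (fun=> 0%N) u w -> ae_eq mu Omega u w.
Proof.
move=> hu hw uw; apply: (weak_deriv_unique ltab hu hw _ uw) => phi _ c.
have -> : partials (fun=> 0%N) phi = phi.
  by rewrite /partials; elim: (index_enum _) => [|k r IH]; rewrite ?big_nil// big_cons /= IH.
by rewrite big1// expr0 mul1r.
Qed.

(** * Lowering the order of a mixed derivative in one direction *)

Section one_slot.
Variables (i : 'I_N) (r : seq 'I_N) (u w w' z : F).
Hypothesis ir : i \notin r.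
Let al (r : seq 'I_N) j := if j \in r then delta j else 0%N.
Hypotheses (hu : L2 mu Omega u) (hw : L2 mu Omega w) (hw' : L2 mu Omega w') (hz : L2 mu Omega z).
Hypothesis uw' : weak_deriv a b (al r) u w'.
Hypothesis uw : weak_deriv a b (al (i :: r)) u w.
Hypothesis uz : weak_deriv a b (fun j => if j == i then delta i else 0%N) u z.

Let sgn : R := (-1) ^+ (\sum_j al r j)%N.
Let der (f : 'I_N -> R -> R) : 'I_N -> R -> R := fun k => derive1n (al r k) (f k).

Lemma sum_al_cons : (\sum_j al (i :: r) j = delta i + \sum_j al r j)%N.
Proof.
rewrite -(sum_single i (delta i)) -big_split/=; apply: eq_bigr => j _.
by rewrite /al inE; case: eqP => [->|//]; rewrite (negbTE ir) addn0.
Qed.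

(** Up to sign, both sides are the pairing of u with a product differentiated in every direction of
    [i :: r]: z has absorbed the derivatives in direction i only, w has absorbed all of them. *)
Lemma slot_test f p c : (forall k, test_function1 (a k) (b k) (f k)) ->
  test_function1 (a i) (b i) p ->
  \int[mu]_(s in Omega) (z s c 0 * prodf (upf (der f) i p) s) =
  sgn * \int[mu]_(s in Omega) (w s c 0 * prodf (upf f i p) s).
Proof.
move=> tf tp.
have tu g : (forall k, test_function1 (a k) (b k) (g k)) ->
    forall k, test_function1 (a k) (b k) (upf g i p k).
  by move=> tg k; rewrite /upf; case: eqP => [->|].
have td : forall k, test_function1 (a k) (b k) (der f k) by move=> k; exact: test_derive1n.
apply: (mulfI (sign_neq0 R (delta i))).
have := weak_deriv_prodf c (tu _ td) uz; rewrite sum_single => <-.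
rewrite mulrA /sgn -exprD -sum_al_cons.
have := weak_deriv_prodf c (tu _ tf) uw => <-.
apply: Rint_eq => s _; congr (_ * _); apply: eq_bigr => k _; congr (_ _).
rewrite /upf /der /al inE; case: eqP => [->|]//=.
Qed.

(* Needed because the transpose of A_{i,0} maps test functions to functions that
   are bounded and measurable but not compactly supported. *)
Lemma slot_bmeas f g c : (forall k, test_function1 (a k) (b k) (f k)) ->
  bmeas (a i) (b i) g ->
  \int[mu]_(s in Omega) (z s c 0 * prodf (upf (der f) i g) s) =
  sgn * \int[mu]_(s in Omega) (w s c 0 * prodf (upf f i g) s).
Proof.
move=> tf bg.
have bf : bmeasN a b f by move=> k; exact: bmeas_test.
have bd : bmeasN a b (der f) by move=> k; apply: bmeas_test; exact: test_derive1n.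
have bone : bmeas (a i) (b i) (fun=> 1) by exact: bmeas_cst.
pose h s := z s c 0 * prodf (upf (der f) i (fun=> 1)) s -
  sgn * (w s c 0 * prodf (upf f i (fun=> 1)) s).
have rh : mu.-integrable Omega (EFin \o h).
  apply: rintB => //; first by apply: rint_prodf; [exact: rintO|exact: bmeasN_upf].
  by apply: rintZ => //; apply: rint_prodf; [exact: rintO|exact: bmeasN_upf].
have hE p : bmeas (a i) (b i) p ->
   \int[mu]_(s in Omega) (h s * prodf (upf (fun _ _ => 1) i p) s) =
   \int[mu]_(s in Omega) (z s c 0 * prodf (upf (der f) i p) s) -
   sgn * \int[mu]_(s in Omega) (w s c 0 * prodf (upf f i p) s).
  move=> bp; have r1 := rint_prodf (rintO c hz) (bmeasN_upf bd bp).
  have r2 := rint_prodf (rintO c hw) (bmeasN_upf bf bp).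
  rewrite -RintegralZl// -RintegralB//; last exact: rintZ.
  apply: Rint_eq => s _; rewrite (prodf_upf _ _ p) (prodf_upf f _ p) (prodf_upf (der f) _ p) /h.
  rewrite (_ : prodf (upf (fun _ _ => 1) _ _) s = 1); first by ring.
  by apply: big1 => k _; rewrite /upf; case: ifP.
apply/eqP; rewrite -subr_eq0 -hE//; apply/eqP; apply: slot_extension => //.
  by move=> k; exact: bmeas_cst.
by move=> p tp; rewrite hE ?slot_test ?subrr//; exact: bmeas_test.
Qed.

(** The boundary conditions of direction i are known for u, not for its derivative w'. Pairing w'
    with a test product moves the derivatives of directions [r] onto the factors; u = A_{i,0} z is
    then transposed onto factor i, which these derivatives do not touch, and [slot_bmeas] replaces z
    by w. *)
Lemma slot_inverse : ae_eq mu Omega u (opA i 0 z) -> ae_eq mu Omega w' (opA i 0 w).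
Proof.
move=> uz'; have hA := L2_opA ltab B C i 0 hw; have hAz := L2_opA ltab B C i 0 hz.
apply/ae_eq_colP => c.
apply: test_ae_eq => // [||f tf]; try exact: rintO.
have bf : bmeasN a b f by move=> k; exact: bmeas_test.
have bd : bmeasN a b (der f) by move=> k; apply: bmeas_test; exact: test_derive1n.
apply: (mulfI (sign_neq0 R (\sum_j al r j))).
rewrite -(weak_deriv_prodf c tf uw') (ae_pairing c hu hAz bd uz').
rewrite (opA_adjoint ltab B C i 0 c hz bd) (opA_adjoint ltab B C i 0 c hw bf).
rewrite mulr_sumr; apply: eq_bigr => c' _.
have -> : der f i = f i by rewrite /der /al (negbTE ir).
by apply: slot_bmeas => //; apply: bmeas_adj.
Qed.

End one_slot.

Lemma domain_inverse u v : domain a b B C u -> L2 mu Omega v -> weak_deriv a b delta u v ->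
  ae_eq mu Omega u (opT v).
Proof.
move=> [[hu su] du] hv uv.
(* The directions in [r] are those in which u is differentiated to full order: the empty list is
   order 0, the list of all indices gives D^delta. *)
have H r : uniq r -> forall w, L2 mu Omega w ->
    weak_deriv a b (fun j => if j \in r then delta j else 0%N) u w ->
    ae_eq mu Omega u (opL (fun=> 0%N) r w).
  elim: r => [_ w hw uw|i r IH]; first by rewrite big_nil; exact: weak_deriv0.
  rewrite cons_uniq => /andP[ir ur] w hw uw.
  have [|w' hw' uw'] := su (fun j => if j \in r then delta j else 0%N).
    by move=> j; case: ifP.
  have [|z hz uz] := su (fun j => if j == i then delta i else 0%N).
    by move=> j; case: eqP => [->|].
  (* Here w' is the derivative of full order in the directions [r] and w the one that adds i, so
     that w' = A_{i,0} w. *)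
  have e1 := slot_inverse ir hu hw hw' hz uw' uw uz (lifted_inverse (du i) hz uz).
  have hA := L2_opA ltab B C i 0 hw.
  rewrite big_cons /=; apply: ae_eq_trans (opL_opA ltab cons (fun=> 0%N) 0 ir hw).
  by apply: ae_eq_trans (IH ur _ hw' uw') _; exact: opL_ae.
apply: H => //; first exact: index_enum_uniq.
by rewrite (_ : (fun j => _) = delta)//; apply/funext => j; rewrite mem_index_enum.
Qed.

End domains.

(** * Equivalence of the PDE and the PIE *)

Section time_filter.
Context (R : realType).

(** At t = 0 only nonnegative increments are admissible, so the witness is taken positive. *)
Lemma time_filter_ex (t : R) (P : R -> Prop) : 0 <= t ->
  (\forall h \near within [set h | 0 <= t + h] 0^', P h) -> exists h, P h.
Proof.
move=> t0; rewrite /dnbhs 2!near_withinE -nbhs_ballE => -[e /= e0 he].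
have e2 : 0 < e / 2 by rewrite divr_gt0.
exists (e / 2); apply: he => //=.
- by rewrite /ball/= sub0r normrN gtr0_norm//; lra.
- by rewrite gt_eqF.
- by rewrite addr_ge0// ltW.
Qed.

Lemma cvg0_le (G : set_system R) (f g : R -> \bar R) (K0 : R) : Filter G ->
  (\forall h \near G, (0 <= f h <= K0%:E * g h)%E) ->
  g h @[h --> G] --> 0%E -> f h @[h --> G] --> 0%E.
Proof.
move=> FG fg g0; apply: (@squeeze_cvge _ _ _ _ (fun=> 0%E) _ (fun h => K0%:E * g h)%E) => //.
  exact: cvg_cst.
rewrite -[X in _ --> X](mule0 K0%:E); exact: cvgeZl.
Qed.

End time_filter.

Section dq.
Context (R : realType) (V : lmodType R).

(** The error term measured by [time_deriv]: x and y are the states at t + h and t, z the candidate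
    derivative. *)
Definition dq (h : R) (x y z : V) : V := h^-1 *: (x - y) - z.

(** Nested combinations of the form c *: u + v, the shape of all the linearity lemmas; x is split in
    two so that the innermost term is a vector and not 0. *)
Lemma dqE h x y z :
  dq h x y z = (h^-1 - 1) *: x + ((- h^-1) *: y + ((-1) *: z + x)).
Proof.
rewrite /dq scalerBl scalerBr !scaleNr !scale1r.
by rewrite [- z + x]addrC [- _ + (x - z)]addrCA [RHS]addrA subrK addrA.
Qed.

End dq.

(** An operator bounded between two norms carries derivatives to derivatives; the hypothesis is that
    bound, evaluated on error terms at admissible times only. *)
Lemma time_deriv_le (R : realType) (V W : lmodType R) (nrm : V -> \bar R) (nrm' : W -> \bar R)
    (f : R -> V) (g : R -> W) (t K0 : R) (p : V) (q : W) : (forall x, (0 <= nrm' x)%E) ->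
  (forall h, 0 <= t + h ->
    (nrm' (dq h (g (t + h)%R) (g t) q) <= K0%:E * nrm (dq h (f (t + h)%R) (f t) p))%E) ->
  time_deriv nrm f t p -> time_deriv nrm' g t q.
Proof.
move=> nrm0 fg; apply: cvg0_le; rewrite near_withinE; near=> h => th.
by rewrite nrm0; exact: fg.
Unshelve. all: by end_near. Qed.

(** * Chosen weak derivatives and the norm of S_2^delta *)

Section wD_facts.
Context (R : realType) (N n : nat) (a b : 'I_N -> R).
Hypothesis ltab : forall i, a i < b i.
Local Notation Omega := (box a b : set (pt R N)).
Local Notation mu := (lebn R N).
Local Notation F := (pt R N -> 'cV[R]_n).
Implicit Types (u v w z : F) (alpha delta : 'I_N -> nat).

Let mO : measurable Omega. Proof. exact: measurable_box. Qed.

Lemma wDP alpha u : (exists2 w, L2 mu Omega w & weak_deriv a b alpha u w) ->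
  L2 mu Omega (wD a b alpha u) /\ weak_deriv a b alpha u (wD a b alpha u).
Proof.
move=> [w hw uw]; rewrite /wD.
by have := @xgetPex _ 0 [set w | L2 mu Omega w /\ weak_deriv a b alpha u w] (ex_intro _ w (conj hw uw)).
Qed.

(** An equality of functions, not only almost everywhere: u and u' have the same set of weak
    derivatives, from which [xget] chooses the same element. *)
Lemma wD_ae alpha u u' : L2 mu Omega u -> L2 mu Omega u' -> ae_eq mu Omega u u' ->
  wD a b alpha u = wD a b alpha u'.
Proof.
move=> hu hu' uu'; rewrite /wD; congr xget; apply/seteqP; split => w [hw uw]; split => //.
  exact: weak_deriv_ae uw.
by apply: weak_deriv_ae uw => //; exact: ae_eq_sym.
Qed.

Lemma wD_unique alpha u w : L2 mu Omega w -> weak_deriv a b alpha u w ->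
  ae_eq mu Omega (wD a b alpha u) w.
Proof.
move=> hw uw; have [|h1 h2] := @wDP alpha u; first by exists w.
exact: (weak_deriv_unique ltab h1 hw h2 uw).
Qed.

Lemma weak_deriv_lin alpha (x : R) u u' w w' :
  L2 mu Omega u -> L2 mu Omega u' -> L2 mu Omega w -> L2 mu Omega w' ->
  weak_deriv a b alpha u w -> weak_deriv a b alpha u' w' ->
  weak_deriv a b alpha (x *: u + u') (x *: w + w').
Proof.
move=> hu hu' hw hw' uw uw' phi tphi c.
have lin (p q : F) f : continuous f -> L2 mu Omega p -> L2 mu Omega q ->
    \int[mu]_(s in Omega) ((x *: p + q) s c 0 * f (vec s)) =
    x * \int[mu]_(s in Omega) (p s c 0 * f (vec s)) + \int[mu]_(s in Omega) (q s c 0 * f (vec s)).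
  move=> cf hp hq; have rp := rint_vec (rintO c hp) cf; have rq := rint_vec (rintO c hq) cf.
  rewrite (Rint_eq mu (g := fun s => x * (p s c 0 * f (vec s)) + q s c 0 * f (vec s))).
    by rewrite RintegralD ?RintegralZl//; exact: rintZ.
  by move=> s _; rewrite !mxE; ring.
have cp : continuous (partials alpha phi) := test_continuous (test_partials alpha tphi).
rewrite (lin u u' _ cp hu hu') (lin w w' _ (test_continuous tphi) hw hw') (uw _ tphi) (uw' _ tphi).
by rewrite mulrDr mulrCA.
Qed.

Lemma S2_lin delta (x : R) u v : S2 a b delta u -> S2 a b delta v -> S2 a b delta (x *: u + v).
Proof.
move=> [hu su] [hv sv]; split; first exact: L2_lin.
move=> al ad; have [p hp up] := su al ad; have [q hq vq] := sv al ad.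
by exists (x *: p + q); [exact: L2_lin|exact: weak_deriv_lin].
Qed.

Lemma L2_dq h u v w : L2 mu Omega u -> L2 mu Omega v -> L2 mu Omega w -> L2 mu Omega (dq h u v w).
Proof. by move=> hu hv hw; rewrite dqE; do 3 apply: L2_lin => //. Qed.

Lemma S2_dq delta h u v w : S2 a b delta u -> S2 a b delta v -> S2 a b delta w ->
  S2 a b delta (dq h u v w).
Proof. by move=> hu hv hw; rewrite dqE; do 3 apply: S2_lin => //. Qed.

Lemma wD_dq delta h u v w : S2 a b delta u -> S2 a b delta v -> S2 a b delta w ->
  forall alpha, (forall i, (alpha i <= delta i)%N) ->
  ae_eq mu Omega (wD a b alpha (dq h u v w))
    (dq h (wD a b alpha u) (wD a b alpha v) (wD a b alpha w)).
Proof.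
move=> [hu su] [hv sv] [hw sw] al ad.
have [hu' wu] := wDP (su al ad); have [hv' wv] := wDP (sv al ad); have [hw' ww] := wDP (sw al ad).
apply: wD_unique; first exact: L2_dq.
rewrite !dqE; do 3 (apply: weak_deriv_lin => //; try by do 3 (try apply: L2_lin => //)).
Qed.

Section norms.
Variable delta : 'I_N -> nat.

Lemma wDS2 (alpha : mindex delta) z : S2 a b delta z ->
  L2 mu Omega (wD a b (fun i => alpha i) z) /\
  weak_deriv a b (fun i => alpha i) z (wD a b (fun i => alpha i) z).
Proof. by move=> [_ sz]; apply: wDP; apply: sz => i; rewrite -ltnS. Qed.

Lemma S2normE z : S2 a b delta z -> S2norm a b delta z =
  (Num.sqrt (\sum_(alpha : mindex delta) sqn mu Omega (wD a b (fun i => alpha i) z)))%:E.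
Proof.
move=> sz; rewrite /S2norm.
rewrite (eq_bigr (fun alpha : mindex delta => (sqn mu Omega (wD a b (fun i => alpha i) z))%:E)).
  by rewrite sumEFin.
move=> al _; have [h _] := wDS2 al sz.
by rewrite L2normE// -EFin_expe sqr_sqrtr// sqn_ge0.
Qed.

Lemma le_S2norm (alpha : mindex delta) z : S2 a b delta z ->
  (L2norm mu Omega (wD a b (fun i => alpha i) z) <= S2norm a b delta z)%E.
Proof.
move=> sz; have [h _] := wDS2 alpha sz.
rewrite S2normE// L2normE// lee_fin; apply: ler_wsqrtr; rewrite (bigD1 alpha)//= lerDl.
by apply: sumr_ge0 => al _; exact: sqn_ge0.
Qed.

Lemma S2norm_ae z z' : S2 a b delta z -> S2 a b delta z' -> ae_eq mu Omega z z' ->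
  S2norm a b delta z = S2norm a b delta z'.
Proof.
move=> sz sz' e; have E : (fun al => wD a b al z) = (fun al => wD a b al z').
  by apply/funext => al; exact: wD_ae sz.1 sz'.1 e.
rewrite (S2normE sz) (S2normE sz').
exact: (congr1 (fun G : ('I_N -> nat) -> F =>
  (Num.sqrt (\sum_(alpha : mindex delta) sqn mu Omega (G (fun i => alpha i))))%:E) E).
Qed.

Lemma L2norm_ae z z' : L2 mu Omega z -> L2 mu Omega z' -> ae_eq mu Omega z z' ->
  L2norm mu Omega z = L2norm mu Omega z'.
Proof. by move=> hz hz' e; rewrite !L2normE// (ae_eq_sqn mO hz hz' e). Qed.

Lemma L2norm_le_S2norm z : S2 a b delta z -> (L2norm mu Omega z <= S2norm a b delta z)%E.
Proof.
move=> sz; pose al0 : mindex delta := [ffun i => ord0].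
have e0 : (fun i => al0 i : nat) = (fun=> 0%N) by apply/funext => i; rewrite ffunE.
have := le_S2norm al0 sz; have [h1 h2] := wDS2 al0 sz; have [hz _] := sz.
move: h1 h2; rewrite e0 => h1 h2; rewrite (L2norm_ae hz h1)//.
exact: weak_deriv0.
Qed.

Lemma L2norm_wD_le z : S2 a b delta z ->
  (L2norm mu Omega (wD a b delta z) <= S2norm a b delta z)%E.
Proof.
move=> sz; pose al : mindex delta := [ffun i => ord_max].
have e : (fun i => al i : nat) = delta by apply/funext => i; rewrite ffunE.
by have := le_S2norm al sz; rewrite e.
Qed.

End norms.

Lemma ae_eq_lin (x : R) u u' v v' : ae_eq mu Omega u u' -> ae_eq mu Omega v v' ->
  ae_eq mu Omega (x *: u + v) (x *: u' + v').
Proof.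
move=> h1 h2; have := h2; have := h1; apply: filterS2 => s e1 e2 Os.
by rewrite -[LHS]/(x *: u s + v s) e1// e2.
Qed.

Lemma ae_eq_dq h u u' v v' w w' : ae_eq mu Omega u u' -> ae_eq mu Omega v v' ->
  ae_eq mu Omega w w' -> ae_eq mu Omega (dq h u v w) (dq h u' v' w').
Proof. by move=> h1 h2 h3; rewrite !dqE; do 3 apply: ae_eq_lin => //. Qed.

(** At a common increment h, the difference p - q is a difference of two error terms, both small. *)
Lemma time_deriv_unique (f : R -> F) t p q : 0 <= t -> L2 mu Omega p -> L2 mu Omega q ->
  (forall t, 0 <= t -> L2 mu Omega (f t)) ->
  time_deriv (L2norm mu Omega) f t p -> time_deriv (L2norm mu Omega) f t q ->
  ae_eq mu Omega p q.
Proof.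
move=> t0 hp hq hf dp dq_; apply: sqn0_ae => //.
apply/eqP; rewrite eq_le sqn_ge0 andbT; apply/ler_addgt0Pr => e e0; rewrite add0r.
(* The threshold e / 4 compensates [sqn_triangle]: 2 (e/4 + e/4) = e. *)
have small r : L2 mu Omega r -> time_deriv (L2norm mu Omega) f t r ->
    \forall h \near within [set h | 0 <= t + h] 0^',
      L2 mu Omega (dq h (f (t + h)) (f t) r) /\ sqn mu Omega (dq h (f (t + h)) (f t) r) <= e / 4.
  move=> hr dr.
  have : \forall h \near within [set h | 0 <= t + h] 0^',
      (L2norm mu Omega (dq h (f (t + h)%R) (f t) r) < (Num.sqrt (e / 4))%:E)%E.
    apply: (dr [set x | (x < (Num.sqrt (e / 4))%:E)%E]); apply: open_nbhs_nbhs; split.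
      exact: open_ereal_lt_ereal.
    by rewrite /= lte_fin sqrtr_gt0 divr_gt0.
  rewrite !near_withinE; apply: filterS => h hh h0 th.
  have hd : L2 mu Omega (dq h (f (t + h)) (f t) r) by apply: L2_dq => //; exact: hf.
  split => //; have := hh h0 th; rewrite L2normE// lte_fin ltr_sqrt ?divr_gt0//.
  exact: ltW.
have [h [[h1 s1] [h2 s2]]] := time_filter_ex t0 (filterI (small _ hp dp) (small _ hq dq_)).
have -> : p - q = dq h (f (t + h)) (f t) q + (-1) *: dq h (f (t + h)) (f t) p.
  by rewrite /dq scaleN1r opprB [RHS]addrC [RHS]addrA subrK.
apply: le_trans (sqn_triangle mO h2 (L2Z mO (-1) h1)) _.
have -> : sqn mu Omega ((-1) *: dq h (f (t + h)) (f t) p) = sqn mu Omega (dq h (f (t + h)) (f t) p).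
  by apply: Rint_eq => s _; apply: eq_bigr => k _; rewrite mxE mulN1r sqrrN.
lra.
Qed.

End wD_facts.

(** * The two implications *)

Section equivalence.
Context (R : realType) (N n : nat) (a b : 'I_N -> R).
Hypothesis ltab : forall i, a i < b i.
Variable delta : 'I_N -> nat.
Variables B C : forall i, 'I_(delta i) -> 'I_(delta i) -> 'M[R]_n.
Hypothesis adm : forall i, admissible (a i) (b i) (@B i) (@C i).
Hypothesis cons : consistent a b B C.
Variable A : mindex delta -> 'M[mpoly.mpoly N R]_n.
Local Notation Omega := (box a b : set (pt R N)).
Local Notation mu := (lebn R N).
Local Notation opA := (opA a b B C).
Local Notation opT := (opT a b B C).
Local Notation opL alpha r := (\big[comp/id]_(i <- r) opA i (alpha i)).
Local Notation F := (pt R N -> 'cV[R]_n).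
Implicit Types (u v w z : F) (alpha : 'I_N -> nat).

Let mO : measurable Omega. Proof. exact: measurable_box. Qed.

Local Opaque Defs.opA.

Lemma wD_opT alpha v : (forall i, (alpha i <= delta i)%N) -> L2 mu Omega v ->
  ae_eq mu Omega (wD a b alpha (opT v)) ((\big[comp/id]_(i < N) opA i (alpha i)) v).
Proof.
move=> ad hv; apply: wD_unique => //; first exact: L2_opL.
exact: weak_opT.
Qed.

Lemma wD_delta_opT v : L2 mu Omega v -> ae_eq mu Omega v (wD a b delta (opT v)).
Proof.
move=> hv; have := wD_opT (fun i => leqnn _) hv.
have -> : (\big[comp/id]_(i < N) opA i (delta i)) v = v.
  by elim: (index_enum _) => [|k r IH]; rewrite ?big_nil// big_cons /= IH opA_out.
exact: ae_eq_sym.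
Qed.

Lemma opPDE_opPIE u v : L2 mu Omega u -> L2 mu Omega v -> ae_eq mu Omega u (opT v) ->
  ae_eq mu Omega (opPDE a b A u) (opPIE a b B C A v).
Proof.
move=> hu hv uv; rewrite /opPDE /opPIE; apply: big_ind2.
- exact: ae_eq_refl.
- move=> p p' q q' h1 h2; have := h2; have := h1; apply: filterS2 => s e1 e2 Os.
  by rewrite -[LHS]/(p s + q s) e1// e2.
move=> al _; rewrite (wD_ae _ hu (L2_opT ltab B C hv) uv).
have ad i : (al i <= delta i)%N by rewrite -ltnS.
by have := wD_opT ad hv; apply: filterS => s h Os; rewrite /opM h.
Qed.

Lemma opL_dq alpha r h u v w : L2 mu Omega u -> L2 mu Omega v -> L2 mu Omega w ->
  ae_eq mu Omega (opL alpha r (dq h u v w)) (dq h (opL alpha r u) (opL alpha r v) (opL alpha r w)).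
Proof.
move=> hu hv hw; rewrite !dqE.
have h1 : L2 mu Omega ((-1) *: w + u) by exact: L2_lin.
have h2 : L2 mu Omega ((- h^-1) *: v + ((-1) *: w + u)) by exact: L2_lin.
apply: ae_eq_trans (opL_lin ltab B C alpha r _ hu h2) _; apply: ae_eq_lin; first exact: ae_eq_refl.
apply: ae_eq_trans (opL_lin ltab B C alpha r _ hv h1) _; apply: ae_eq_lin; first exact: ae_eq_refl.
exact: opL_lin.
Qed.

(** Each D^alpha (T v) with alpha <= delta is a product of operators bounded on L_2; the constant
    collects the bounds of these finitely many products. *)
Lemma S2norm_opT_le : exists K0 : R, forall v, L2 mu Omega v ->
  (S2norm a b delta (opT v) <= K0%:E * L2norm mu Omega v)%E.
Proof.
have /choice[K1 hK] : forall al : mindex delta, exists K1 : R, 0 <= K1 /\ forall v, L2 mu Omega v ->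
    sqn mu Omega ((\big[comp/id]_(i < N) opA i (al i)) v) <= K1 * sqn mu Omega v.
  move=> al; have [K1 ? ?] := opL_bound ltab B C (fun i => al i) (index_enum _).
  by exists K1.
exists (Num.sqrt (\sum_al K1 al)) => v hv.
have sT : S2 a b delta (opT v) by exact: S2_opT.
rewrite S2normE// L2normE// -EFinM lee_fin -sqrtrM; last first.
  by apply: sumr_ge0 => al _; have [] := hK al.
apply: ler_wsqrtr; rewrite mulr_suml; apply: ler_sum => al _; have [_ h] := hK al.
have ad i : (al i <= delta i)%N by rewrite -ltnS.
have [h1 _] := wDS2 al sT.
by rewrite (ae_eq_sqn mO h1 (L2_opL ltab B C _ _ hv) (wD_opT ad hv)) h.
Qed.

(** Both time derivatives required by the PIE come from that of u in S_2^delta, with constant 1: the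
    norms of D^delta and of the inclusion into L_2 are terms of the S_2^delta norm. *)
Lemma PDE_to_PIE (u : R -> F) u0 : domain a b B C u0 -> solves_PDE a b B C A u u0 ->
  let v := fun t => wD a b delta (u t) in
  solves_PIE a b opT (opPIE a b B C A) v (wD a b delta u0) /\
  forall t, 0 <= t -> ae_eq mu Omega (u t) (opT (v t)).
Proof.
move=> du0 [_ uu0 hu] v.
have su t : 0 <= t -> S2 a b delta (u t) by move=> /hu[[]].
have hut t : 0 <= t -> L2 mu Omega (u t) by move=> /su[].
have wu t : 0 <= t -> L2 mu Omega (v t) /\ weak_deriv a b delta (u t) (v t).
  by move=> /su[_ h]; apply: wDP; exact: h.
have uT t : 0 <= t -> ae_eq mu Omega (u t) (opT (v t)).
  by move=> t0; have [h1 h2] := wu t t0; apply: domain_inverse => //; have [] := hu t t0.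
have [[hu0 su0] _] := du0.
split => //; split.
- by have [] := wDP (su0 delta (fun i => leqnn _)).
- by rewrite /v (wD_ae delta (hut 0 (lexx _)) hu0 uu0); exact: ae_eq_refl.
move=> t t0; have [hvt _] := wu t t0; have [_ [u' [su' du' eu']]] := hu t t0.
have hu' : L2 mu Omega u' by have [] := su'.
have hv' : L2 mu Omega (wD a b delta u').
  by have [_ h] := su'; have [] := wDP (h delta (fun i => leqnn _)).
split => //.
- exists (wD a b delta u') => //.
  apply: (time_deriv_le (K0 := 1) _ _ du') => [z|h th]; first exact: sqrte_ge0.
  rewrite mul1e.
  have sd := S2_dq h (su _ th) (su _ t0) su'.
  have ed := wD_dq ltab h (su _ th) (su _ t0) su' (fun i => leqnn _).
  have [h1 _] := wDP (sd.2 delta (fun i => leqnn _)).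
  have h2 := L2_dq h (wu _ th).1 hvt hv'.
  by rewrite -(L2norm_ae h1 h2 ed); exact: L2norm_wD_le.
exists u'; split => //.
(* Since T v(t) = u(t) almost everywhere at each time, the derivative u' of u is also the L_2
   derivative of T v. *)
- apply: (time_deriv_le (K0 := 1) _ _ du') => [z|h th]; first exact: sqrte_ge0.
  rewrite mul1e.
  have sd := S2_dq h (su _ th) (su _ t0) su'.
  have ed := ae_eq_dq h (uT _ th) (uT _ t0) (ae_eq_refl mu Omega u').
  have hd := L2_dq h (L2_opT ltab B C (wu _ th).1) (L2_opT ltab B C hvt) hu'.
  by rewrite -(L2norm_ae sd.1 hd ed); exact: L2norm_le_S2norm.
- apply: ae_eq_trans eu' _; apply: opPDE_opPIE => //; [exact: hut|exact: uT].
Qed.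

(** Boundedness of T into S_2^delta differentiates T v in the strong norm, with derivative T v'. The
    PIE equation concerns the L_2 derivative w of T v; the two agree by uniqueness. *)
Lemma PIE_to_PDE (v : R -> F) v0 : L2 mu Omega v0 ->
  solves_PIE a b opT (opPIE a b B C A) v v0 ->
  let u := fun t => opT (v t) in
  solves_PDE a b B C A u (opT v0) /\
  forall t, 0 <= t -> ae_eq mu Omega (v t) (wD a b delta (u t)).
Proof.
move=> hv0 [_ vv0 hv] u.
have hvt t : 0 <= t -> L2 mu Omega (v t) by move=> /hv[].
split; last by move=> t t0; apply: wD_delta_opT; exact: hvt.
split; first exact: domain_opT.
  by apply: opL_ae => //; exact: hvt.
move=> t t0; split; first by apply: domain_opT => //; exact: hvt.
have [_ [v' hv' dv'] [w [hw dw ew]]] := hv t t0.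
have sT z : L2 mu Omega z -> S2 a b delta (opT z) by exact: S2_opT.
have du : time_deriv (S2norm a b delta) u t (opT v').
  have [K0 hK] := S2norm_opT_le.
  apply: (time_deriv_le (K0 := K0) _ _ dv') => [z|h th]; first exact: sqrte_ge0.
  have hd := L2_dq h (hvt _ th) (hvt _ t0) hv'.
  have ed := opL_dq (fun=> 0%N) (index_enum _) h (hvt _ th) (hvt _ t0) hv'.
  have sd := S2_dq h (sT _ (hvt _ th)) (sT _ (hvt _ t0)) (sT _ hv').
  by rewrite -(S2norm_ae (sT _ hd) sd ed); exact: hK.
exists (opT v'); split => //; first exact: sT.
(* The derivative is weakened to the L_2 norm, the only one in which it can be compared with w. *)
have du' : time_deriv (L2norm mu Omega) u t (opT v').
  apply: (time_deriv_le (K0 := 1) _ _ du) => [z|h th]; first exact: sqrte_ge0.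
  rewrite mul1e.
  by apply: L2norm_le_S2norm => //; apply: S2_dq; apply: sT => //; exact: hvt.
have e1 : ae_eq mu Omega (opT v') w.
  apply: (time_deriv_unique t0 _ hw _ du' dw); first exact: L2_opT.
  by move=> s s0; apply: L2_opT => //; exact: hvt.
apply: ae_eq_trans e1 _; apply: ae_eq_trans ew _; apply: ae_eq_sym.
exact: (opPDE_opPIE (L2_opT ltab B C (hvt t t0)) (hvt t t0) (ae_eq_refl _ _ _)).
Qed.

End equivalence.

Theorem theorem19 (R : realType) (n N : nat) (n_gt0 : (0 < n)%N)
    (N_gt0 : (0 < N)%N) (a b : 'I_N -> R) (ltab : forall i, a i < b i)
    (delta : 'I_N -> nat)
    (B C : forall i : 'I_N, 'I_(delta i) -> 'I_(delta i) -> 'M[R]_n)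
    (adm : forall i, admissible (a i) (b i) (B i) (C i))
    (cons : consistent a b B C)
    (A : mindex delta -> 'M[mpoly.mpoly N R]_n) :
  (forall (u : R -> pt R N -> 'cV[R]_n) (u0 : pt R N -> 'cV[R]_n),
     domain a b B C u0 ->
     solves_PDE a b B C A u u0 ->
     let v := fun t => wD a b delta (u t) in
     solves_PIE a b (opT a b B C) (opPIE a b B C A) v (wD a b delta u0) /\
     forall t, 0 <= t -> ae_eq (lebn R N) (box a b) (u t) (opT a b B C (v t))) /\
  (forall (v : R -> pt R N -> 'cV[R]_n) (v0 : pt R N -> 'cV[R]_n),
     L2 (lebn R N) (box a b) v0 ->
     solves_PIE a b (opT a b B C) (opPIE a b B C A) v v0 ->
     let u := fun t => opT a b B C (v t) in
     solves_PDE a b B C A u (opT a b B C v0) /\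
     forall t, 0 <= t -> ae_eq (lebn R N) (box a b) (v t) (wD a b delta (u t))).
Proof.
split=> [u u0 du0|v v0 hv0]; first exact: PDE_to_PIE.
exact: PIE_to_PDE.
Qed.
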